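(* Let $1<p<\infty$ and $\gamma\in\mathbb R\setminus[-1,0]$. Then $$\mathscr K^{\frac{\gamma+1}{p}}:[V^\infty,\dot{BV}]_{\frac1p,1}\to L^{p,\infty}(\lambda_\gamma)$$ is bounded. In particular $$\nabla\mathscr P:[V^\infty,\dot{BV}]_{\frac12,1}\to L^{2,\infty}(dx\,dt)$$ is bounded.
   Context: All function spaces are over $\mathbb R^d$, $d\ge1$; $\mathbb R^{d+1}_+=\{(x,t):x\in\mathbb R^d,t>0\}$. $V^\infty$ is the quotient of $L^\infty(\mathbb R^d)$ by constants, with norm $\inf_{c\in\mathbb C}\|f-c\|_\infty$. $\dot{BV}$ is the homogeneous space of functions of bounded variation: locally integrable functions, modulo constants, whose distributional gradient is a finite Radon measure, normed by the total variation of the gradient. $[X_0,X_1]_{\theta,r}$ is the real interpolation space (Peetre $K_{\theta,r}$ method), with norm $\big(\int_0^\infty(t^{-\theta}K(t,f))^r\frac{dt}{t}\big)^{1/r}$, $K(t,f)=\inf_{f=f_0+f_1}\|f_0\|_{X_0}+t\|f_1\|_{X_1}$. The harmonic (Poisson) extension is $$\mathscr Pf(x,t)=\frac{\Gamma(\frac{d+1}{2})}{\pi^{\frac{d+1}{2}}}\int_{\mathbb R^d}\frac{t}{(|x-y|^2+t^2)^{\frac{d+1}{2}}}f(y)\,dy,$$ and $\nabla\mathscr P$ is its gradient in $(x,t)$, $t>0$, i.e. $$\nabla\mathscr Pf(x,t)=\frac{\Gamma(\frac{d+1}{2})}{\pi^{\frac{d+1}{2}}}\int_{\mathbb R^d}\frac{((d+1)t(y-x),\,|x-y|^2-dt^2)}{(|x-y|^2+t^2)^{\frac{d+3}{2}}}(f(y)-f(x))\,dy,$$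 which makes sense for $f\in V^\infty+\dot{BV}$. For $b\in\mathbb R$, $\mathscr K^bf(x,t)=t^{1-b}\nabla\mathscr Pf(x,t)$. The measure $\lambda_\gamma$ on $\mathbb R^{d+1}_+$ is $\lambda_\gamma(E)=\iint_Edx\frac{dt}{t^{1-\gamma}}$, and $L^{p,\infty}(\mu)$ is weak $L^p$: $[g]_{L^{p,\infty}(\mu)}=\sup_{\lambda>0}\lambda\,\mu(\{|g|>\lambda\})^{1/p}$. *)

(* Defs.v *)
From HB Require Import structures.
From mathcomp Require Import all_boot all_order all_algebra.
From mathcomp Require Import all_classical all_reals all_analysis.
From mathcomp Require Import measurable_realfun.
From mathcomp Require Import complex.

Set Implicit Arguments.
Unset Strict Implicit.
Unset Printing Implicit Defensive.
Import Order.TTheory GRing.Theory Num.Theory.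
Import numFieldNormedType.Exports.

Local Open Scope classical_set_scope.
Local Open Scope ring_scope.

Section rV_measurable.
Context {R : realType} (n : nat).

Let coord : 'I_n -> 'rV[R]_n -> R := fun i x => x ord0 i.

Let rV_set0 : g_sigma_preimage coord set0.
Proof. exact: sigma_algebra0. Qed.

Let rV_setC A : g_sigma_preimage coord A -> g_sigma_preimage coord (~` A).
Proof. exact: sigma_algebraC. Qed.

Let rV_bigcup (F : (set 'rV[R]_n)^nat) :
  (forall i, g_sigma_preimage coord (F i)) ->
  g_sigma_preimage coord (\bigcup_i (F i)).
Proof. exact: sigma_algebra_bigcup. Qed.

(* The sigma-algebra generated by the coordinates, i.e. the Borel sets of R^n *)
HB.instance Definition _ := @isMeasurable.Build default_measure_display
  'rV[R]_n (g_sigma_preimage coord) rV_set0 rV_setC rV_bigcup.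

End rV_measurable.

Section rV_measurable_fun.
Context {R : realType}.

Lemma measurable_rV_coord n (i : 'I_n) :
  measurable_fun [set: 'rV[R]_n] (fun x => x ord0 i).
Proof.
move=> _ Y mY; rewrite setTI; apply: sub_sigma_algebra => /=.
rewrite -bigcup_seq/=; exists i => /=; first by rewrite mem_index_enum.
by exists Y => //; rewrite setTI.
Qed.

Lemma measurable_fun_rV d (T : measurableType d) n (f : T -> 'rV[R]_n) :
  (forall i, measurable_fun [set: T] (fun x => f x ord0 i)) ->
  measurable_fun [set: T] f.
Proof.
move=> mf _ A; rewrite setTI => mA.
pose C := [set B : set 'rV[R]_n | measurable (f @^-1` B)].
suff: C A by [].
move: A mA; apply: smallest_sub => /=.
  split => [|B mB|F mF]; rewrite /C/=.
  - by rewrite preimage_set0.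
  - rewrite setTD preimage_setC; exact: measurableC.
  - by rewrite preimage_bigcup; apply: bigcupT_measurable => k; exact: mF.
move=> B; rewrite -bigcup_seq. move=> [i _ [Y mY <-]].
by rewrite /C/= setTI -[X in measurable X]setTI; exact: mf.
Qed.

Definition rVcons n (p : R * 'rV[R]_n) : 'rV[R]_n.+1 := row_mx p.1%:M p.2.
Definition rVuncons n (x : 'rV[R]_n.+1) : R * 'rV[R]_n :=
  (x ord0 ord0, \row_j x ord0 (rshift 1 j)).

Lemma rVunconsK n : cancel (@rVuncons n) (@rVcons n).
Proof.
move=> x; apply/rowP => i; rewrite /rVcons /rVuncons/= mxE.
case: splitP => [j|j] ij; rewrite mxE.
- rewrite !ord1 eqxx mulr1n; congr (x _ _); apply/val_inj.
  by rewrite /= ij ord1.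
- by congr (x _ _); exact/val_inj.
Qed.

Lemma rVconsK n : cancel (@rVcons n) (@rVuncons n).
Proof.
case=> a y; rewrite /rVcons /rVuncons/=; congr pair.
- rewrite (_ : ord0 = lshift n ord0 :> 'I_(1 + n)); last exact/val_inj.
  by rewrite (row_mxEl a%:M y) mxE eqxx.
- by apply/rowP => j; rewrite mxE (row_mxEr a%:M y).
Qed.

Lemma measurable_rVcons n : measurable_fun [set: R * 'rV[R]_n] (@rVcons n).
Proof.
apply: measurable_fun_rV => i; have [->|i0] := eqVneq i ord0.
- rewrite (_ : (fun _ => _) = fst); first exact: measurable_fst.
  by apply/funext => p; rewrite -[p in RHS](@rVconsK n).
- have in1 : (i.-1 < n)%N by rewrite prednK ?lt0n// -ltnS.
  rewrite (_ : (fun _ => _) =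
      (fun y : 'rV[R]_n => y ord0 (Ordinal in1)) \o snd).
    exact: (measurableT_comp (@measurable_rV_coord n _)).
  have iE : i = rshift 1 (Ordinal in1) :> 'I_(1 + n).
    by apply/val_inj/esym => /=; rewrite add1n prednK ?lt0n.
  by apply/funext => p /=; rewrite {1}iE; exact: row_mxEr.
Qed.

Lemma measurable_rVuncons n : measurable_fun [set: 'rV[R]_n.+1] (@rVuncons n).
Proof.
apply/measurable_fun_pairP; split; first exact: measurable_rV_coord.
apply: measurable_fun_rV => i /=.
rewrite (_ : (fun _ => _) = fun x : 'rV[R]_n.+1 => x ord0 (rshift 1 i)).
  exact: measurable_rV_coord.
by apply/funext => x; rewrite mxE.
Qed.

End rV_measurable_fun.

Section lebesgue_rV.
Context {R : realType}.

Section cons_measure.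
Context n (m : {sigma_finite_measure set 'rV[R]_n -> \bar R}).
Local Open Scope ereal_scope.

Definition cons_measure :=
  pushforward (@lebesgue_measure R \x m) (@rVcons R n).

Let mpre A : measurable A -> measurable (@rVcons R n @^-1` A).
Proof. by move=> mA; rewrite -[X in measurable X]setTI; exact: measurable_rVcons. Qed.

Let cons0 : cons_measure set0 = 0.
Proof. by rewrite /cons_measure /pushforward preimage_set0 measure0. Qed.

Let cons_ge0 A : 0 <= cons_measure A.
Proof. by rewrite /cons_measure /pushforward measure_ge0. Qed.

Let cons_sigma_additive : semi_sigma_additive cons_measure.
Proof.
move=> F mF tF mUF; rewrite /cons_measure /pushforward preimage_bigcup.
apply: measure_semi_sigma_additive.
- by move=> k; exact: mpre.
- apply/trivIsetP => /= i j _ _ ij; rewrite -preimage_setI.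
  by move/trivIsetP : tF => /(_ _ _ _ _ ij) ->//; rewrite preimage_set0.
- by rewrite -preimage_bigcup; exact: mpre.
Qed.

HB.instance Definition _ := isMeasure.Build _ _ _ cons_measure
  cons0 cons_ge0 cons_sigma_additive.

Let cons_sigma_finite : sigma_finite [set: 'rV[R]_n.+1] cons_measure.
Proof.
have /sigma_finiteP[F [TF ndF Foo]] := sigma_finiteT (@lebesgue_measure R).
have /sigma_finiteP[G [TG ndG Goo]] := sigma_finiteT m.
exists (fun k => @rVuncons R n @^-1` (F k `*` G k)) => [|k].
  rewrite -preimage_bigcup (_ : \bigcup_k _ = setT) ?preimage_setT//.
  apply/seteqP; split => // -[x y] _.
  have [k _ Fkx] : (\bigcup_k F k) x by rewrite -TF.
  have [l _ Gly] : (\bigcup_k G k) y by rewrite -TG.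
  exists (maxn k l) => //; split => /=.
  - by move: x Fkx; exact/subsetPset/ndF/leq_maxl.
  - by move: y Gly; exact/subsetPset/ndG/leq_maxr.
have [mFk Fkoo] := Foo k; have [mGk Gkoo] := Goo k.
have mFG : measurable (F k `*` G k) by exact: measurableX.
split.
  by rewrite -[X in measurable X]setTI; exact: measurable_rVuncons.
rewrite /cons_measure /pushforward -comp_preimage.
rewrite (_ : _ \o _ = id); last by apply/funext => p /=; exact: rVconsK.
by rewrite preimage_id product_measure1E// lte_mul_pinfty// ge0_fin_numE.
Qed.

HB.instance Definition _ :=
  Measure_isSigmaFinite.Build _ _ _ cons_measure cons_sigma_finite.

End cons_measure.

(* Lebesgue measure on R^n, as the n-fold product of Lebesgue measure on R *)
Fixpoint lebesgue_rV n : {sigma_finite_measure set 'rV[R]_n -> \bar R} :=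
  match n with
  | 0 => \d_(0 : 'rV[R]_0)
  | n'.+1 => cons_measure (lebesgue_rV n')
  end.

End lebesgue_rV.

Section euclidean.
Context {R : realType}.

Definition enorm n (x : 'rV[R]_n) : R := Num.sqrt (\sum_j x ord0 j ^+ 2).

Definition cenorm n (v : 'rV[R[i]]_n) : R :=
  Num.sqrt (\sum_j Normc.normc (v ord0 j) ^+ 2).

End euclidean.

Section complex_functions.
Context {R : realType} d {T : measurableType d}.

Definition cmeasurable_fun (D : set T) (f : T -> R[i]) :=
  measurable_fun D (fun x => complex.Re (f x)) /\
  measurable_fun D (fun x => complex.Im (f x)).

Definition cintegral (mu : {measure set T -> \bar R}) (f : T -> R[i]) : R[i] :=
  (\int[mu]_x complex.Re (f x) +i* \int[mu]_x complex.Im (f x))%C.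

End complex_functions.

Section test_functions.
Context {R : realType} (d : nat).

Definition partial (j : 'I_d) (phi : 'rV[R]_d -> R) : 'rV[R]_d -> R :=
  fun x => 'D_(delta_mx ord0 j) phi x.

Definition partials (s : seq 'I_d) (phi : 'rV[R]_d -> R) : 'rV[R]_d -> R :=
  foldr partial phi s.

Definition smooth (phi : 'rV[R]_d -> R) := forall s : seq 'I_d,
  continuous (partials s phi) /\
  forall j x, derivable (partials s phi) x (delta_mx ord0 j).

Definition test_function (phi : 'rV[R]_d -> R) :=
  smooth phi /\ compact (closure [set x | phi x != 0]).

End test_functions.

Section vector_measures.
Context {R : realType} (d : nat).

(* A C^d-valued Borel measure on R^d, given by the real and imaginary parts of
   its d components; a charge has finite values, and every finite Borel measure
   on R^d is Radon. *)
Definition vector_charge : Type :=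
  'I_d -> {charge set 'rV[R]_d -> \bar R} * {charge set 'rV[R]_d -> \bar R}.

Definition vector_charge_val (nu : vector_charge) (E : set 'rV[R]_d) :
    'rV[R[i]]_d :=
  \row_j (fine ((nu j).1 E) +i* fine ((nu j).2 E))%C.

Definition total_variation (nu : vector_charge) : \bar R :=
  ereal_sup [set (\sum_(k <oo) (cenorm (vector_charge_val nu (E k)))%:E)%E |
    E in [set E : (set 'rV[R]_d)^nat | [/\ forall k, measurable (E k),
      trivIset setT E & \bigcup_k E k = setT]]].

Definition charge_integral (nu : {charge set 'rV[R]_d -> \bar R})
    (phi : 'rV[R]_d -> R) : R :=
  let: exist P hP := cid (Hahn_decomposition nu) in
  let: exist N hPN := cid hP in
  \int[jordan_pos hPN]_x phi x - \int[jordan_neg hPN]_x phi x.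

End vector_measures.

(* Function spaces modulo constants are handled through representatives:
   a space is a set of functions with an extended-real-valued norm. *)
Section function_spaces.
Context {R : realType} (d : nat).
Local Notation fct := ('rV[R]_d -> R[i]).
Local Notation leb := (@lebesgue_rV R d).

Definition eq_mod_cst (f g : fct) :=
  exists c : R[i], {ae leb, forall x, f x = g x + c}.

Definition Vinf_norm (f : fct) : \bar R :=
  ereal_inf [set Lnorm leb +oo%E (fun x => (Normc.normc (f x - c))%:E) |
    c in [set: R[i]]].

Definition Vinf : set fct :=
  [set f | cmeasurable_fun setT f /\ (Vinf_norm f < +oo)%E].

Definition locally_integrable_rV (f : fct) :=
  cmeasurable_fun setT f /\ forall K : set 'rV[R]_d, compact K ->
    (\int[leb]_(x in K) (Normc.normc (f x))%:E < +oo)%E.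

Definition distr_gradient (f : fct) (nu : vector_charge d) :=
  forall phi : 'rV[R]_d -> R, test_function phi -> forall j,
    cintegral leb (fun x => (partial j phi x)%:C%C * f x) =
    - (charge_integral (nu j).1 phi +i* charge_integral (nu j).2 phi)%C.

Definition BV : set fct :=
  [set f | locally_integrable_rV f /\ exists nu, distr_gradient f nu].

(* The gradient of f in BV is unique, so that the infimum is over one measure *)
Definition BV_norm (f : fct) : \bar R :=
  ereal_inf [set total_variation nu | nu in [set nu | distr_gradient f nu]].

Definition peetreK (X0 X1 : set fct) (N0 N1 : fct -> \bar R) (t : R)
    (f : fct) : \bar R :=
  ereal_inf [set (N0 f01.1 + t%:E * N1 f01.2)%E |
    f01 in [set f01 : fct * fct | [/\ X0 f01.1, X1 f01.2 &
      eq_mod_cst f (fun x => f01.1 x + f01.2 x)]]].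

Definition interp_norm (X0 X1 : set fct) (N0 N1 : fct -> \bar R)
    (theta r : R) (f : fct) : \bar R :=
  ((\int[@lebesgue_measure R]_(t in `]0%R, +oo[)
      (((t `^ (- theta))%:E * peetreK X0 X1 N0 N1 t f) `^ r * (t^-1)%:E))
    `^ r^-1)%E.

Definition Vinf_BV_norm (theta r : R) : fct -> \bar R :=
  interp_norm Vinf BV Vinf_norm BV_norm theta r.

(* Measurability of the representative is required separately: the norm does
   not see a modification of f on a null set. *)
Definition Vinf_BV (theta r : R) : set fct :=
  [set f | cmeasurable_fun setT f /\ (Vinf_BV_norm theta r f < +oo)%E].

End function_spaces.

Section poisson.
Context {R : realType} (d : nat).
Local Notation fct := ('rV[R]_d -> R[i]).
Local Notation half := ('rV[R]_d * measurableTypeR R)%type.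

Definition Gamma (s : R) : R :=
  \int[@lebesgue_measure R]_(x in `]0, +oo[) (x `^ (s - 1) * expR (- x)).

Definition poisson_cst : R := Gamma (d.+1%:R / 2) / pi `^ (d.+1%:R / 2).

(* The gradient in (x, t) of t / (|x - y|^2 + t^2)^((d + 1) / 2): d components
   in x, then one in t. Its integral over y is 0, whence the subtraction of f(x)
   below, which makes the gradient well defined on functions modulo constants. *)
Definition grad_poisson_kernel (z : half) (y : 'rV[R]_d) : 'rV[R]_(d + 1) :=
  let: (x, t) := z in
  ((enorm (x - y) ^+ 2 + t ^+ 2) `^ (d.+3%:R / 2))^-1 *:
  row_mx ((d.+1%:R * t) *: (y - x)) (enorm (x - y) ^+ 2 - d%:R * t ^+ 2)%:M.

Definition grad_poisson (f : fct) (z : half) : 'rV[R[i]]_(d + 1) :=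
  \row_j (poisson_cst%:C%C *
    cintegral (lebesgue_rV d)
      (fun y => (grad_poisson_kernel z y ord0 j)%:C%C * (f y - f z.1))).

Definition Kop (b : R) (f : fct) (z : half) : 'rV[R[i]]_(d + 1) :=
  (z.2 `^ (1 - b))%:C%C *: grad_poisson f z.

End poisson.

Section half_space.
Context {R : realType} (d : nat).
Local Notation half := ('rV[R]_d * measurableTypeR R)%type.

Definition halfspace : set half := [set z | 0 < z.2 :> R].

Lemma measurable_halfspace : measurable halfspace.
Proof.
rewrite (_ : halfspace = setT `*` `]0, +oo[); first exact: measurableX.
by apply/seteqP; split => [[x t]|[x t] []]; rewrite /halfspace/= in_itv/= andbT.
Qed.

(* dx dt on the upper half-space, extended by 0 to t <= 0 *)
Definition lebesgue_half : {measure set half -> \bar R} :=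
  mrestr (lebesgue_rV d \x @lebesgue_measure R)%E measurable_halfspace.

Section lambda_measure.
Context (gamma : R).
Local Open Scope ereal_scope.

Definition lambda_measure (E : set half) : \bar R :=
  \int[lebesgue_half]_(z in E) (((z.2 `^ (1 - gamma))^-1)%R)%:E.

Let density : half -> \bar R := fun z => (((z.2 `^ (1 - gamma))^-1)%R)%:E.

Let density_ge0 z : 0 <= density z.
Proof. by rewrite lee_fin invr_ge0 powR_ge0. Qed.

Let measurable_density (E : set half) : measurable_fun E density.
Proof.
apply/measurable_EFinP.
under eq_fun do rewrite -powRN.
apply: measurable_funTS.
by apply: (measurableT_comp (measurable_powR _)).
Qed.

Let lambda0 : lambda_measure set0 = 0.
Proof. exact: integral_set0. Qed.

Let lambda_ge0 E : 0 <= lambda_measure E.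
Proof. by apply: integral_ge0 => z _; exact: density_ge0. Qed.

Let lambda_sigma_additive : semi_sigma_additive lambda_measure.
Proof.
move=> F mF tF mUF; rewrite /lambda_measure ge0_integral_bigcup//; last first.
  by move=> z _; exact: density_ge0.
apply: is_cvg_ereal_nneg_natsum_cond => n _ _; exact: lambda_ge0.
Qed.

HB.instance Definition _ := isMeasure.Build _ _ _ lambda_measure
  lambda0 lambda_ge0 lambda_sigma_additive.

End lambda_measure.

Definition weakLp_norm (p : R) (mu : {measure set half -> \bar R}) n
    (g : half -> 'rV[R[i]]_n) : \bar R :=
  ereal_sup [set (l%:E *
      (mu [set z | halfspace z /\ (l < cenorm (g z))%R]) `^ p^-1)%E |
    l in [set l : R | 0 < l]].

Definition weakLp (p : R) (mu : {measure set half -> \bar R}) n :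
    set (half -> 'rV[R[i]]_n) :=
  [set g : half -> 'rV[R[i]]_n |
    (forall j, cmeasurable_fun halfspace (fun z => g z ord0 j)) /\
    (weakLp_norm p mu g < +oo)%E].

Definition bounded_to_weakLp (theta r p : R)
    (mu : {measure set half -> \bar R}) n
    (S : ('rV[R]_d -> R[i]) -> half -> 'rV[R[i]]_n) :=
  exists C : R, forall f, Vinf_BV theta r f ->
    weakLp p mu (S f) /\
    (weakLp_norm p mu (S f) <= C%:E * Vinf_BV_norm theta r f)%E.

End half_space.

Arguments lebesgue_half {R} d.
Arguments lambda_measure {R} d gamma.

(* Main.v *)
(* With D = |h|^2 + t^2, the gradient of the Poisson extension at (x, t) is at
   most a constant times the integral over h of D^{-(d+1)/2} |f(x+h) - f(x)|.
   For every s = 2^k, k an integer, choose f = f0_s + f1_s + const with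
   |f0_s - c| <= m_s and s TV(f1_s) <= m_s, m_s close to K(s, f), so that
   sum_s s^{-1/p} m_s is at most a constant times the norm of f.  The increments
   of f are dominated by the sum over s of those of g_s = f1_s - f1_{2s}, which
   are bounded by M ~ m_s and have L^1 norm at most V |h|_1, V ~ m_s / s; hence
   V M^{p-1} ~ (s^{-1/p} m_s)^p.
   For one such g and any tau > 0, comparing D with t^2 (M / (tau t^b))^4 bounds
   t^{1-b} int D^{-(d+1)/2} |g(x+h) - g(x)| dh by tau + G, where the L^oo bound
   M yields tau and the L^1 bound gives
   int G dlambda_gamma <= C V M^{p-1} tau^{1-p}: the power of t left over is
   integrated over {t^b < C M / tau}, on the correct side exactly because b <> 0.
   Taking tau proportional to s^{-1/p} m_s, summing over s and applying
   Chebyshev's inequality gives the weak-type bound. *)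
Require Import Defs.
From HB Require Import structures.
From mathcomp Require Import all_boot all_order all_algebra.
From mathcomp Require Import all_classical all_reals all_analysis.
From mathcomp Require Import measurable_realfun ess_sup_inf complex ring lra.

Set Implicit Arguments.
Unset Strict Implicit.
Unset Printing Implicit Defensive.
Import Order.TTheory GRing.Theory Num.Theory.
Import numFieldNormedType.Exports.

Local Open Scope classical_set_scope.
Local Open Scope ring_scope.

(** * Lebesgue integration on R^n *)

Section lebesgue_rV_integral.
Context {R : realType}.
Local Open Scope ereal_scope.
Local Notation mu := (@lebesgue_measure R).

(** The pairs (tau, G) are what makes the levels summable: the tau add up to lambda and the
    integrals of the G add up too, so that no triangle inequality for the weak quasi-norm is used.
    With tau_k proportional to a_k the k-th integral is a multiple of a_k^p a_k^(1-p) = a_k, which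
    is where the index r = 1 enters. The fourth power in the comparison for D is dictated by the
    bounded half: it keeps the kernel D^(-(d+1/2)/2), and rho = t (Q t^(-b))^2 is the threshold at
    which t^(1-b) rho^(-1/2) t^(-1/2) M is a multiple of tau free of t. The L^1 half gets the extra
    decay e = (p-1)/4, small enough to leave the positive power p-1-2e of Q for the integral in t.
    Bounded variation enters only through the L^1 size of increments. This is found without
    mollifying f: the gradient is tested against tensor products in which one factor is a primitive
    of phi - phi(. - h). The sum over scales is cut at s = 1, f1_1 being telescoped upwards and f0_1
    downwards. What remains after N steps tends to 0 almost everywhere, upwards by integrability in
    x, downwards by an essential bound. *)

Lemma ge0_integral_shift (a : R) (f : R -> \bar R) :
  measurable_fun setT f -> (forall x, 0 <= f x) ->
  \int[mu]_x f (x + a)%R = \int[mu]_x f x.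
Proof.
move=> mf f0; pose s : measurableTypeR R -> measurableTypeR R := +%R^~ a.
have ms : measurable_fun setT s by exact: measurable_funD.
rewrite -[LHS]/(\int[mu]_(x in s @^-1` setT) (f \o s) x).
rewrite -(ge0_integral_pushforward ms)//.
apply: eq_measure_integral => //= A mA _.
apply/esym/lebesgue_measure_unique => //= _ [[b c]] _ <-.
rewrite /pushforward (_ : s @^-1` _ = `](b - a)%R, (c - a)%R]%classic).
  rewrite !lebesgue_measure_itv/= !lte_fin ltrD2r; case: ifP => // _.
  by rewrite -!EFinD; congr EFin; ring.
by apply/seteqP; split => x/=; rewrite !in_itv/= /s ltrBlDr lerBrDr.
Qed.

Lemma measurable_comp_rVcons n (f : 'rV[R]_n.+1 -> \bar R) :
  measurable_fun setT f ->
  measurable_fun [set: measurableTypeR R * 'rV[R]_n] (f \o @rVcons R n).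
Proof.
have mc : measurable_fun [set: measurableTypeR R * 'rV[R]_n] (@rVcons R n).
  exact: measurable_rVcons.
by move=> mf; exact: measurableT_comp mf mc.
Qed.

Lemma ge0_integral_rVcons n (f : 'rV[R]_n.+1 -> \bar R) :
  measurable_fun setT f -> (forall x, 0 <= f x) ->
  \int[lebesgue_rV n.+1]_x f x =
  \int[lebesgue_rV n]_y \int[mu]_s f (rVcons (s, y)).
Proof.
move=> mf f0.
have mc : measurable_fun [set: measurableTypeR R * 'rV[R]_n] (@rVcons R n).
  exact: measurable_rVcons.
transitivity (\int[mu \x lebesgue_rV n]_(z in @rVcons R n @^-1` setT)
    (f \o @rVcons R n) z).
  exact: (ge0_integral_pushforward mc (mu \x lebesgue_rV n)).
rewrite preimage_setT fubini_tonelli2//=.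
exact: measurable_comp_rVcons.
Qed.

Lemma measurable_rVD n (a : 'rV[R]_n) :
  measurable_fun [set: 'rV[R]_n] (fun x => x + a)%R.
Proof.
apply: measurable_fun_rV => i; under eq_fun do rewrite mxE.
by apply: measurable_funD => //; exact: measurable_rV_coord.
Qed.

Lemma rVconsD n (s t : R) (y z : 'rV[R]_n) :
  (rVcons (s, y) + rVcons (t, z) = rVcons (s + t, y + z))%R.
Proof.
rewrite /rVcons/= raddfD/=.
exact: (add_row_mx s%:M y t%:M z).
Qed.

Lemma rVcons_coord0 n (s : R) (y : 'rV[R]_n) : rVcons (s, y) ord0 ord0 = s.
Proof. by have [] := rVconsK (s, y). Qed.

Lemma rVcons_coordS n (s : R) (y : 'rV[R]_n) j :
  rVcons (s, y) ord0 (lift ord0 j) = y ord0 j.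
Proof.
have [_ /rowP/(_ j)] := rVconsK (s, y); rewrite mxE => <-.
by congr (rVcons _ _ _); exact/val_inj.
Qed.

Lemma ge0_integral_rV_translation n (a : 'rV[R]_n) (f : 'rV[R]_n -> \bar R) :
  measurable_fun setT f -> (forall x, 0 <= f x) ->
  \int[lebesgue_rV n]_x f (x + a)%R = \int[lebesgue_rV n]_x f x.
Proof.
elim: n a f => [|n IH] a f mf f0.
  by apply: eq_integral => x _; congr f; apply/rowP => -[].
have mfa := measurableT_comp mf (measurable_rVD a).
rewrite (ge0_integral_rVcons mf f0) (ge0_integral_rVcons mfa); last first.
  by move=> x; exact: f0.
rewrite -(rVunconsK a); case: (rVuncons a) => t z.
transitivity (\int[lebesgue_rV n]_y \int[mu]_s f (rVcons (s, y + z))%R).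
  apply: eq_integral => y _.
  under eq_integral do rewrite /= rVconsD.
  rewrite (ge0_integral_shift t (f := fun s : R => f (rVcons (s, y + z))%R))//.
  exact: measurableT_comp (measurable_comp_rVcons mf) (pair2_measurable _).
apply: (IH z (fun y => \int[mu]_s f (rVcons (s, y)))).
  have := @measurable_fun_fubini_tonelli_G _ _ _ _ R mu (f \o @rVcons R n).
  by apply; [exact: measurable_comp_rVcons|move=> x; exact: f0].
by move=> y; apply: integral_ge0 => s _; exact: f0.
Qed.

(** Tonelli, one coordinate at a time. Every kernel integral over R^n is reduced to the line by this
    product bound, which takes the place of polar coordinates. *)
Lemma integral_prod_coord_le n (phi : R -> R) (c : R) :
  measurable_fun setT phi -> (forall s, 0 <= phi s)%R ->
  \int[mu]_s (phi s)%:E <= c%:E ->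
  \int[lebesgue_rV n]_x (\prod_(j < n) phi (x ord0 j))%:E <= (c ^+ n)%:E.
Proof.
move=> mphi phi0 phic.
have mp m : measurable_fun setT
    (fun x : 'rV[R]_m => (\prod_(j < m) phi (x ord0 j))%:E).
  apply/measurable_EFinP; apply: measurable_prod => i _.
  by apply: measurableT_comp => //; exact: measurable_rV_coord.
have mE : measurable_fun setT (EFin \o phi) by exact/measurable_EFinP.
have c0 : (0 <= c)%R.
  rewrite -lee_fin (le_trans _ phic)//; apply: integral_ge0 => s _.
  by rewrite lee_fin.
elim: n => [|n IH].
  under eq_integral do rewrite big_ord0.
  (* In dimension 0 the measure is a Dirac mass and the product is empty: both sides are 1. *)
  rewrite [X in integral X](_ : _ = \d_(0%R : 'rV[R]_0))// integral_cst//=.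
  by rewrite diracT mule1 expr0.
rewrite ge0_integral_rVcons//; last first.
  by move=> x; rewrite lee_fin prodr_ge0.
under eq_integral => y _.
  under eq_integral => s _.
    rewrite big_ord_recl rVcons_coord0.
    under eq_bigr do rewrite rVcons_coordS.
    rewrite EFinM muleC.
    over.
  rewrite ge0_integralZl//; last 2 first.
    by move=> s _; rewrite lee_fin.
    by rewrite lee_fin prodr_ge0.
  over.
rewrite /= ge0_integralZr//; last 2 first.
  by move=> y _; rewrite lee_fin prodr_ge0.
  by apply: integral_ge0 => s _; rewrite lee_fin.
rewrite exprS EFinM muleC; apply: lee_pmul => //.
- by apply: integral_ge0 => s _; rewrite lee_fin.
- by apply: integral_ge0 => s _; rewrite lee_fin prodr_ge0.
exact: mp.
Qed.

End lebesgue_rV_integral.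

(** * Integrals of the Poisson-type kernels *)

Section real_integrals.
Context {R : realType}.
Local Notation mu := (@lebesgue_measure R).

Lemma FTC2_is_derive (f F : R -> R) (a b : R) : a < b ->
  (forall x, a <= x <= b -> is_derive x 1 F (f x)) ->
  (forall x, a <= x <= b -> {for x, continuous f}) ->
  (\int[mu]_(x in `[a, b]) (f x)%:E)%E = (F b - F a)%:E.
Proof.
move=> ab dF cf.
have cF x : a <= x <= b -> {for x, continuous F}.
  move=> xab; apply/differentiable_continuous/derivable1_diffP.
  by have [] := dF _ xab.
rewrite (@continuous_FTC2 _ f F)//.
- by apply: continuous_in_subspaceT => x /[!inE]/= /[!in_itv]/= /cf.
- split.
  + move=> x; rewrite in_itv/= => /andP[ax xb].
    by have [|//] := dF x; rewrite (ltW ax) (ltW xb).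
  + by apply: cvg_at_right_filter; apply: cF; rewrite lexx ltW.
  + by apply: cvg_at_left_filter; apply: cF; rewrite lexx ltW.
- move=> x; rewrite in_itv/= => /andP[ax xb]; rewrite derive1E.
  by have [|_ ->] := dF x; rewrite ?(ltW ax) ?(ltW xb).
Qed.

Lemma integral_itv_powR (a t u v : R) : a != 0 -> u < v -> 0 < u + t ->
  (\int[mu]_(s in `[u, v]) ((s + t) `^ (a - 1))%:E)%E =
  (((v + t) `^ a - (u + t) `^ a) / a)%:E.
Proof.
move=> a0 uv ut.
have pos x : u <= x <= v -> 0 < x + t.
  by move=> /andP[ux _]; rewrite (lt_le_trans ut)// lerD2r.
have dp e x : u <= x <= v ->
    is_derive x 1 (fun s => (s + t) `^ e) (e * (x + t) `^ (e - 1)).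
  move=> /pos xt.
  rewrite -[X in is_derive _ _ _ X]mulr1.
  apply: (@is_derive1_comp _ (fun s => s `^ e) (shift t)).
    exact: is_derive1_powR.
  exact: is_derive_shift.
rewrite mulrBl; apply: (@FTC2_is_derive (fun s => (s + t) `^ (a - 1))
  (fun s => (s + t) `^ a / a)) => //.
- move=> x /(dp a) h; rewrite (_ : _ `^ _ = a^-1 *: (a * (x + t) `^ (a - 1))).
    under eq_fun do rewrite mulrC; exact: is_deriveZ.
  by rewrite scalerA mulVf// scale1r.
- move=> x /(dp (a - 1)) [h _].
  exact/differentiable_continuous/derivable1_diffP.
Qed.

(** Monotone convergence along an exhaustion; it turns explicit integrals over segments into bounds
    for improper integrals without computing a limit. *)
Lemma integral_bigcup_le d (T : measurableType d) (m : {measure set T -> \bar R})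
    (f : T -> \bar R) (F : (set T)^nat) (C : \bar R) :
  measurable_fun setT f -> (forall x, 0 <= f x)%E ->
  nondecreasing_seq F -> (forall n, measurable (F n)) ->
  (forall n, \int[m]_(x in F n) f x <= C)%E ->
  (\int[m]_(x in \bigcup_n F n) f x <= C)%E.
Proof.
move=> mf f0 ndF mF FC.
have h := @ge0_nondecreasing_set_cvg_integral _ _ R F f m ndF mF
  (fun=> measurable_funTS mf) (fun _ x _ => f0 x).
rewrite -(cvg_lim _ h)//; apply: lime_le; first by apply/cvg_ex; eexists; exact: h.
exact: nearW.
Qed.

Lemma measurable_powRD (a t : R) :
  measurable_fun setT (fun s : R => ((s + t) `^ a)%:E).
Proof.
apply/measurable_EFinP; apply: (measurableT_comp (measurable_powR _)).
exact: measurable_funD.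
Qed.

Lemma integral_powRD_tail (b t : R) : 0 < b -> 0 < t ->
  (\int[mu]_(s in `[0%R, +oo[) ((s + t) `^ (- b - 1))%:E <= (t `^ (- b) / b)%:E)%E.
Proof.
move=> b0 t0.
have -> : `[(0:R), +oo[%classic =
    \bigcup_n `[(0:R), n.+1%:R]%classic :> set (measurableTypeR R).
  apply/seteqP; split => [x|x [n _]]/=; rewrite !in_itv/= ?andbT.
    move=> x0; exists (Num.truncn x) => //=; rewrite in_itv/= x0/=.
    by rewrite ltW// truncnS_gt.
  by case/andP.
apply: integral_bigcup_le => //.
- exact: measurable_powRD.
- by move=> x; rewrite lee_fin powR_ge0.
- move=> m n mn; apply/subsetPset => x/=; rewrite !in_itv/= => /andP[-> xm]/=.
  by rewrite (le_trans xm)// ler_nat.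
- move=> n; rewrite integral_itv_powR ?oppr_eq0 ?gt_eqF ?add0r ?ltr0n// lee_fin.
  rewrite invrN mulrN -mulNr opprB ler_pM2r ?invr_gt0//.
  by rewrite gerBl powR_ge0.
Qed.

Lemma integral_even_le (f : R -> \bar R) (C : \bar R) :
  measurable_fun setT f -> (forall x, 0 <= f x)%E -> (forall x, f (- x) = f x) ->
  (\int[mu]_(x in `[0%R, +oo[) f x <= C)%E -> (\int[mu]_x f x <= C + C)%E.
Proof.
move=> mf f0 fN fC.
have <- : `[(0:R), +oo[%classic `|` `]-oo, (0:R)[%classic
    = setT :> set (measurableTypeR R).
  apply/seteqP; split => // x _ /=; rewrite !in_itv/= andbT.
  by case: (lerP 0 x); [left|right].
rewrite ge0_integral_setU//; last 2 first.
- by apply: measurable_funTS.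
- apply/disj_setPS => x /=; rewrite !in_itv/= andbT => -[x0].
  by rewrite ltNge x0.
apply: leeD => //; apply: le_trans fC.
rewrite ge0_integration_by_substitution0//; under [leRHS]eq_integral do rewrite fN.
apply: ge0_subset_integral => //; first exact: measurable_funTS.
by move=> x/=; rewrite !in_itv/= => /ltW.
Qed.

(** The inequality (x + t)^2 <= 2 (x^2 + t^2) compares the integrand with a power of x + t, whose
    primitive is explicit. This costs 2^((1+b)/2), and evenness doubles the half-line. *)
Lemma integral_sqr_powR_le (b t : R) : 0 < b -> 0 < t ->
  (\int[mu]_s ((s ^+ 2 + t ^+ 2) `^ (- (1 + b) / 2))%:E <=
   (2 * 2 `^ ((1 + b) / 2) / b * t `^ (- b))%:E)%E.
Proof.
move=> b0 t0.
have mf : measurable_fun setT (fun s : R => ((s ^+ 2 + t ^+ 2) `^ (- (1 + b) / 2))%:E).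
  apply/measurable_EFinP; apply: (measurableT_comp (measurable_powR _)).
  by apply: measurable_funD => //; exact: measurable_funX.
rewrite (_ : _ * _ = 2 `^ ((1 + b) / 2) * (t `^ (- b) / b) +
  2 `^ ((1 + b) / 2) * (t `^ (- b) / b)); last by ring.
rewrite EFinD; apply: integral_even_le => //.
  by move=> x; rewrite lee_fin powR_ge0.
  by move=> x; rewrite sqrrN.
rewrite EFinM.
apply: (le_trans _ (lee_wpmul2l _ (integral_powRD_tail b0 t0))); last first.
  by rewrite lee_fin powR_ge0.
rewrite -ge0_integralZl//; last 2 first.
- exact: measurable_funTS (measurable_powRD (- b - 1) t).
- by move=> x _; rewrite lee_fin powR_ge0.
apply: ge0_le_integral => //.
- by move=> x _; rewrite lee_fin powR_ge0.
- exact: measurable_funTS.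
- by apply: measurable_funeM; exact: measurable_funTS (measurable_powRD (- b - 1) t).
move=> x/=; rewrite in_itv/= andbT => x0.
have xt : 0 < x + t by rewrite ltr_wpDl.
rewrite -EFinM lee_fin mulNr powRN.
have -> : (x + t) `^ (- b - 1) = (((x + t) ^+ 2) `^ ((1 + b) / 2))^-1.
  rewrite -powR_mulrn 1?ltW// -powRrM -powRN; congr (_ `^ _).
  by field.
have D0 : 0 < x ^+ 2 + t ^+ 2 by rewrite ltr_wpDl ?sqr_ge0// exprn_gt0.
rewrite -ler_pdivrMl ?powR_gt0// -invfM lef_pV2 ?posrE ?mulr_gt0 ?powR_gt0 ?exprn_gt0//.
rewrite -powRM ?(ltW D0)//; apply: ge0_ler_powR.
- by lra.
- by rewrite nnegrE sqr_ge0.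
- by rewrite nnegrE mulr_ge0// ltW.
- have H (y : R) : (y + t) ^+ 2 <= 2 * (y ^+ 2 + t ^+ 2).
    by rewrite -subr_ge0 (_ : _ - _ = (y - t) ^+ 2) ?sqr_ge0//; ring.
  exact: H.
Qed.

End real_integrals.

Section kernel_integrals.
Context {R : realType}.

Lemma le_truncnS (x : R) : x <= (Num.truncn x).+1%:R.
Proof. by rewrite ltW// truncnS_gt. Qed.

Local Notation mu := (@lebesgue_measure R).

Lemma ler_powR_neg (a x y : R) : a <= 0 -> 0 < x -> x <= y -> y `^ a <= x `^ a.
Proof.
move=> a0 x0 xy; have y0 := lt_le_trans x0 xy.
have : 0 <= - a by rewrite oppr_ge0.
rewrite -{2 3}(opprK a); move: (- a) => c c0.
rewrite !powRN lef_pV2 ?posrE ?powR_gt0//.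
by apply: ge0_ler_powR; rewrite ?nnegrE//; exact: ltW.
Qed.

(** With T = Q^(1/b) the domain is ]0, T[ for b > 0 and ]T, oo[ for b < 0. Since b c has the sign of
    b, t^(b c - 1) is integrable at the end that the domain reaches, and the boundary term at T
    gives Q^c / (|b| c) in both cases. *)
Lemma integral_powR_sublevel (b c Q : R) : b != 0 -> 0 < c -> 0 < Q ->
  (\int[mu]_(t in [set t | 0 < t /\ t `^ b < Q]%R) (t `^ (b * c - 1))%:E <=
   (Q `^ c / (`|b| * c))%:E)%E.
Proof.
move=> b0 c0 Q0; set T := Q `^ b^-1.
have T0 : 0 < T by rewrite powR_gt0.
have TQ : T `^ b = Q by rewrite -powRrM mulVf// powRr1// ltW.
have bc0 : b * c != 0 by rewrite mulf_neq0// gt_eqF.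
have TQc : T `^ (b * c) = Q `^ c by rewrite powRrM TQ.
pose f := fun t : measurableTypeR R => (t `^ (b * c - 1))%:E.
have mf : measurable_fun setT f.
  by apply/measurable_EFinP; exact: measurable_powR.
have f0 x : (0 <= f x)%E by rewrite lee_fin powR_ge0.
have itvE (u v : R) : u < v -> 0 < u ->
    (\int[mu]_(s in `[u, v]) f s = ((v `^ (b * c) - u `^ (b * c)) / (b * c))%:E)%E.
  move=> uv u0.
  transitivity (\int[mu]_(s in `[u, v]) ((s + 0) `^ (b * c - 1))%:E)%E.
    by apply: eq_integral => x _; rewrite addr0.
  by rewrite integral_itv_powR ?addr0.
have mD : measurable ([set t : R | 0 < t /\ t `^ b < Q] : set (measurableTypeR R)).
  rewrite (_ : [set t : R | _] = `]0, +oo[%classic `&`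
      ((fun t => t `^ b) @^-1` `]-oo, Q[%classic)).
    apply: measurableI => //; rewrite -[X in measurable X]setTI.
    exact: measurable_powR.
  by apply/seteqP; split => x/=; rewrite !in_itv/= ?andbT.
have [bneg|bpos|bz] := ltrgtP b 0; last by rewrite bz eqxx in b0.
- pose F n : set (measurableTypeR R) := `[T, T + n.+1%:R]%classic.
  apply: (@le_trans _ _ (\int[mu]_(t in \bigcup_n F n) f t)%E).
    apply: ge0_subset_integral => //.
    - by apply: bigcup_measurable => n _; exact: measurable_itv.
    - exact: measurable_funTS.
    - by move=> x _; exact: f0.
    - suff H (t : R) : 0 < t -> t `^ b < Q -> F (Num.truncn t) t.
        by move=> t [t0 tQ]; exists (Num.truncn (t : R)) => //; exact: H.
      move=> t0 tQ; rewrite /F/= in_itv/=.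
      have -> /= : T <= t.
        rewrite leNgt; apply/negP => tT; move: tQ; rewrite ltNge -TQ.
        by rewrite ler_powR_neg// ltW.
      by rewrite (le_trans (le_truncnS _))// lerDr ltW.
  apply: integral_bigcup_le => //.
  + move=> m n mn; apply/subsetPset => x/=; rewrite /F/= !in_itv/= => /andP[-> xm]/=.
    by rewrite (le_trans xm)// lerD2l ler_nat.
  + by move=> n; exact: measurable_itv.
  + move=> n; rewrite /F itvE//; last by rewrite ltrDl ltr0n.
    rewrite lee_fin TQc ltr0_norm// mulNr invrN mulrN -mulNr ler_nM2r.
      by rewrite lerDr powR_ge0.
    by rewrite invr_lt0 nmulr_rlt0.
(* The divisor starts at 2, so that every segment is nondegenerate. *)
- pose F n : set (measurableTypeR R) := `[T / n.+2%:R, T]%classic.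
  have TnT n : T / n.+2%:R < T.
    by rewrite ltr_pdivrMr ?ltr0n// ltr_pMr// ltr1n.
  apply: (@le_trans _ _ (\int[mu]_(t in \bigcup_n F n) f t)%E).
    apply: ge0_subset_integral => //.
    - by apply: bigcup_measurable => n _; exact: measurable_itv.
    - exact: measurable_funTS.
    - by move=> x _; exact: f0.
    - suff H (t : R) : 0 < t -> t `^ b < Q -> F (Num.truncn (T / t)) t.
        by move=> t [t0 tQ]; exists (Num.truncn (T / (t : R))) => //; exact: H.
      move=> t0 tQ; rewrite /F/= in_itv/=.
      apply/andP; split.
        rewrite ler_pdivrMr ?ltr0n// mulrC -ler_pdivrMr// (le_trans (le_truncnS _))//.
        by rewrite ler_nat.
      rewrite leNgt; apply/negP => tT; move: tQ; rewrite ltNge -TQ.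
      by rewrite ge0_ler_powR// ?nnegrE ltW.
  apply: integral_bigcup_le => //.
  + move=> m n mn; apply/subsetPset => x/=; rewrite /F/= !in_itv/= => /andP[mx ->].
    rewrite andbT (le_trans _ mx)// ler_pM2l// lef_pV2 ?posrE ?ltr0n//.
    by rewrite ler_nat.
  + by move=> n; exact: measurable_itv.
  + move=> n; rewrite /F itvE ?divr_gt0 ?ltr0n// lee_fin TQc gtr0_norm// ler_pM2r.
      by rewrite gerBl powR_ge0.
    by rewrite invr_gt0 mulr_gt0.
Qed.


(** The quantity D of the overview. *)
Definition ksq n (t : R) (h : 'rV[R]_n) : R := enorm h ^+ 2 + t ^+ 2.

Lemma ksqE n t (h : 'rV[R]_n) : ksq t h = \sum_j h ord0 j ^+ 2 + t ^+ 2.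
Proof. by rewrite /ksq /enorm sqr_sqrtr// sumr_ge0// => j _; exact: sqr_ge0. Qed.

Lemma ksq_gt0 n t (h : 'rV[R]_n) : 0 < t -> 0 < ksq t h.
Proof. by move=> t0; rewrite ltr_wpDl ?sqr_ge0// exprn_gt0. Qed.

Lemma coord_le_ksq n t (h : 'rV[R]_n) j : h ord0 j ^+ 2 + t ^+ 2 <= ksq t h.
Proof.
rewrite ksqE lerD2r (bigD1 j)//= lerDl sumr_ge0// => i _; exact: sqr_ge0.
Qed.

Lemma measurable_ksq_powR n (a : R) :
  measurable_fun [set: measurableTypeR R * 'rV[R]_n] (fun p => ksq p.1 p.2 `^ a).
Proof.
apply: (measurableT_comp (measurable_powR _)).
under eq_fun do rewrite ksqE; apply: measurable_funD; last first.
  apply: measurable_funX; exact: measurable_fst.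
apply: measurable_sum => j; apply: measurable_funX.
by apply: (measurableT_comp (@measurable_rV_coord _ _ j)); exact: measurable_snd.
Qed.

Lemma measurable_ksq_powR2 n (a t : R) :
  measurable_fun [set: 'rV[R]_n] (fun h => ksq t h `^ a).
Proof.
apply: (measurableT_comp (measurable_powR _)).
rewrite (_ : ksq t = fun h : 'rV[R]_n => \sum_j h ord0 j ^+ 2 + t ^+ 2); last first.
  by apply/funext => h; rewrite ksqE.
apply: measurable_funD => //.
apply: measurable_sum => j; apply: measurable_funX.
exact: measurable_rV_coord.
Qed.

Definition ksq_cst n (a : R) : R :=
  (2 * 2 `^ ((1 + a / n%:R) / 2) / (a / n%:R)) ^+ n.

Lemma ksq_cst_ge0 n (a : R) : 0 <= a -> 0 <= ksq_cst n a.
Proof. by move=> a0; rewrite exprn_ge0// divr_ge0 ?mulr_ge0 ?powR_ge0 ?divr_ge0. Qed.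

(** The exponent is shared equally among the coordinates: D^(-(n+a)/2) is a product of n factors
    D^(-(1+a/n)/2), and D >= h_j^2 + t^2 in the j-th one. The bound then factors into
    one-dimensional integrals with a/n in place of a. *)
Lemma integral_ksq_powR n (a t : R) : (0 < n)%N -> 0 < a -> 0 < t ->
  (\int[lebesgue_rV n]_h (ksq t h `^ (- (n%:R + a) / 2))%:E <=
   (ksq_cst n a * t `^ (- a))%:E)%E.
Proof.
move=> n0 a0 t0; have nR : n%:R != 0 :> R by rewrite pnatr_eq0 -lt0n.
pose phi (s : R) := (s ^+ 2 + t ^+ 2) `^ (- (1 + a / n%:R) / 2).
have an0 : 0 < a / n%:R by rewrite divr_gt0// ltr0n.
have -> : ksq_cst n a * t `^ (- a) =
    (2 * 2 `^ ((1 + a / n%:R) / 2) / (a / n%:R) * t `^ (- (a / n%:R))) ^+ n.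
  rewrite exprMn; congr (_ * _); rewrite -powR_mulrn ?powR_ge0// -powRrM.
  by rewrite mulNr mulfVK.
have mphi : measurable_fun setT phi.
  apply: (measurableT_comp (measurable_powR _)).
  by apply: measurable_funD => //; exact: measurable_funX.
apply: le_trans (integral_prod_coord_le n mphi _ (integral_sqr_powR_le an0 t0)); last first.
  by move=> s; exact: powR_ge0.
apply: ge0_le_integral => //.
- by move=> h _; rewrite lee_fin powR_ge0.
- by apply/measurable_EFinP; exact: measurable_ksq_powR2.
- apply/measurable_EFinP; apply: measurable_prod => j _.
  by apply: (measurableT_comp mphi); exact: measurable_rV_coord.
move=> h _; rewrite lee_fin.
have -> : ksq t h `^ (- (n%:R + a) / 2) =
    \prod_(j < n) ksq t h `^ (- (1 + a / n%:R) / 2).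
  rewrite prodr_const card_ord -powR_mulrn ?powR_ge0// -powRrM.
  by congr (_ `^ _); field.
apply: ler_prod => j _; rewrite powR_ge0/= ler_powR_neg ?coord_le_ksq//.
- by rewrite mulNr oppr_le0 divr_ge0// addr_ge0// ltW.
- by rewrite ltr_wpDl ?sqr_ge0// exprn_gt0.
Qed.

End kernel_integrals.

(** * Tensor products of smooth bump functions *)

Section smooth_real_functions.
Context {R : realType}.

Definition smooth1 (f : R -> R) := forall n x, derivable (derive1n n f) x 1.

Lemma smooth1_derivable f x : smooth1 f -> derivable f x 1.
Proof. by move=> /(_ 0%N x). Qed.

Lemma smooth1_derive1 f : smooth1 f -> smooth1 (derive1 f).
Proof. by move=> sf n x; have := sf n.+1 x; rewrite /derive1n iterSr. Qed.

Lemma smooth1_continuous f : smooth1 f -> continuous f.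
Proof.
by move=> sf x; exact/differentiable_continuous/derivable1_diffP/smooth1_derivable.
Qed.

(* A set of functions whose derivatives stay in the algebra it generates consists
   of smooth functions: this avoids the Leibniz formula of higher order. *)
Inductive deriv_alg (B : set (R -> R)) : (R -> R) -> Prop :=
| deriv_alg_base f : B f -> deriv_alg B f
| deriv_algD f g : deriv_alg B f -> deriv_alg B g -> deriv_alg B (fun x => f x + g x)
| deriv_algZ a f : deriv_alg B f -> deriv_alg B (fun x => a * f x)
| deriv_algM f g : deriv_alg B f -> deriv_alg B g -> deriv_alg B (fun x => f x * g x).

Lemma deriv_alg_smooth1 (B : set (R -> R)) :
  (forall f, B f -> exists2 g, deriv_alg B g & forall x : R, is_derive x 1 f (g x)) ->
  forall f, deriv_alg B f -> smooth1 f.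
Proof.
move=> HB.
have step f : deriv_alg B f ->
    exists2 g, deriv_alg B g & forall x : R, is_derive x 1 f (g x).
  elim => {f} [f /HB//|f g Bf [f' Bf' ff'] Bg [g' Bg' gg']
    |a f Bf [f' Bf' ff']|f g Bf [f' Bf' ff'] Bg [g' Bg' gg']].
  - by exists (fun x => f' x + g' x); [exact: deriv_algD|move=> x; exact: is_deriveD].
  - by exists (fun x => a * f' x); [exact: deriv_algZ|move=> x; exact: is_deriveZ].
  - exists (fun x => f x * g' x + g x * f' x).
      by apply: deriv_algD; exact: deriv_algM.
    by move=> x; exact: is_deriveM.
have stepn n f : deriv_alg B f -> deriv_alg B (derive1n n f).
  elim: n f => // n IH f Bf; rewrite /derive1n iterSr; apply: IH.
  have [g Bg fg] := step _ Bf.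
  rewrite (_ : derive1 f = g)//; apply/funext => x; rewrite derive1E.
  exact: (@derive_val _ _ _ _ _ _ _ (fg x)).
by move=> f Bf n x; have [g _ /(_ x) []] := step _ (stepn n _ Bf).
Qed.

Lemma smooth1M f g : smooth1 f -> smooth1 g -> smooth1 (fun x => f x * g x).
Proof.
move=> sf sg; apply: (@deriv_alg_smooth1 smooth1).
  move=> h sh; exists (derive1 h); first exact/deriv_alg_base/smooth1_derive1.
  by move=> x; rewrite derive1E; exact/derivableP/smooth1_derivable.
by apply: deriv_algM; exact: deriv_alg_base.
Qed.

Lemma smooth1B f g : smooth1 f -> smooth1 g -> smooth1 (fun x => f x - g x).
Proof.
move=> sf sg; apply: (@deriv_alg_smooth1 smooth1).
  move=> h sh; exists (derive1 h); first exact/deriv_alg_base/smooth1_derive1.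
  by move=> x; rewrite derive1E; exact/derivableP/smooth1_derivable.
rewrite (_ : (fun x => f x - g x) = (fun x => f x + (-1) * g x)).
  apply: deriv_algD; first exact: deriv_alg_base.
  by apply: deriv_algZ; exact: deriv_alg_base.
by apply/funext => x; rewrite mulN1r.
Qed.

(** Used for [slide], whose derivative is a difference of smooth functions. *)
Lemma smooth1_of_derive f g :
  (forall x : R, is_derive x 1 f (g x)) -> smooth1 g -> smooth1 f.
Proof.
move=> fg sg [|n] x; first by have [] := fg x.
rewrite /derive1n iterSr (_ : derive1 f = g); first exact: sg.
apply/funext => y; rewrite derive1E; exact: (@derive_val _ _ _ _ _ _ _ (fg y)).
Qed.

Lemma is_derive_affine (f : R -> R) (c d x l : R) :
  is_derive (c * x + d) 1 f l -> is_derive x 1 (fun y => f (c * y + d)) (c * l).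
Proof.
move=> fl; rewrite mulrC.
apply: (@is_derive1_comp _ f (fun y => c * y + d)) => //.
rewrite -[X in is_derive _ _ _ X]addr0; apply: is_deriveD.
rewrite -[X in is_derive _ _ _ X]mulr1; exact: is_deriveZ.
Qed.

Lemma smooth1_affine f c d : smooth1 f -> smooth1 (fun x => f (c * x + d)).
Proof.
move=> sf.
apply: (@deriv_alg_smooth1 [set g | exists2 h, smooth1 h & g = fun x => h (c * x + d)]).
  move=> _ [h sh ->]; exists (fun x => c * derive1 h (c * x + d)).
    apply: (@deriv_algZ _ c (fun x => derive1 h (c * x + d))).
    apply: deriv_alg_base; exists (derive1 h); first exact: smooth1_derive1.
    reflexivity.
  move=> x; apply: is_derive_affine; rewrite derive1E.
  exact/derivableP/smooth1_derivable.
by apply: deriv_alg_base; exists f.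
Qed.

(** Used at the point 0, where the two branches of [flat n] meet. *)
Lemma is_derive0_quadratic (f : R -> R) (C : R) : 0 <= C -> f 0 = 0 ->
  (forall x, `|f x| <= C * x ^+ 2) -> is_derive (0 : R) 1 f 0.
Proof.
move=> C0 f0 fC.
have H : h^-1 *: ((f \o shift 0) (h *: 1) - f 0) @[h --> (0 : R)^'] --> (0 : R).
  apply/cvgr0Pnorm_lt => e e0; near=> h.
  have h0 : h != 0 by near: h; exact: nbhs_dnbhs_neq.
  rewrite /= f0 subr0 addr0 scaler1 normrZ normfV mulrC ltr_pdivrMr ?normr_gt0//.
  apply: le_lt_trans (fC _) _.
  rewrite (_ : h ^+ 2 = `|h| * `|h|); last first.
    by rewrite -normrM -expr2 ger0_norm ?sqr_ge0.
  rewrite mulrA ltr_pM2r ?normr_gt0//.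
  rewrite (@le_lt_trans _ _ ((C + 1) * `|h|))//.
    by rewrite ler_wpM2r// lerDl.
  rewrite mulrC -ltr_pdivlMr ?ltr_wpDl//; near: h.
  apply: nbhs_dnbhs; near=> h; rewrite -(subr0 h) distrC.
  by near: h; apply: (@cvgr_dist_lt _ _ _ _ _ id) => //; rewrite divr_gt0// ltr_wpDl.
split; first by apply/cvg_ex; exists 0.
exact/cvg_lim.
Unshelve. all: by end_near. Qed.

(* The powers x^-n make the family closed under derivation up to linear combination. *)
Definition flat n (x : R) : R := if 0 < x then x^-1 ^+ n * expR (- x^-1) else 0.

Lemma flat_le0 n x : x <= 0 -> flat n x = 0.
Proof. by rewrite /flat leNgt => /negbTE ->. Qed.

Lemma flat_ge0 n x : 0 <= flat n x.
Proof.
by rewrite /flat; case: ifPn => // x0; rewrite mulr_ge0 ?expR_ge0// exprn_ge0// invr_ge0 ltW.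
Qed.

(** Only the term of order n + 2 of the exponential series at 1/x is kept. The two powers beyond n
    give the quadratic vanishing that [is_derive0_quadratic] asks for. *)
Lemma flat_le n x : flat n x <= (n.+2)`!%:R * x ^+ 2.
Proof.
rewrite /flat; case: ifPn => x0; last by rewrite mulr_ge0 ?sqr_ge0.
have y0 : 0 < x^-1 by rewrite invr_gt0.
rewrite expRN ler_pdivrMr ?expR_gt0//.
have /(le_trans (ler_wpDl ler01 (lexx _))) h := @expR_ge1Dxn R _ n.+1 (ltW y0).
have : (n.+2)`!%:R * x ^+ 2 * (x^-1 ^+ n.+2 / (n.+2)`!%:R) <= (n.+2)`!%:R * x ^+ 2 * expR x^-1.
  by apply: ler_wpM2l h; rewrite mulr_ge0 ?sqr_ge0.
apply: le_trans; rewrite le_eqVlt; apply/orP; left; apply/eqP.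
rewrite (_ : x^-1 ^+ n.+2 = x^-1 ^+ n * x^-1 ^+ 2); last by rewrite -exprD addn2.
move: (x^-1 ^+ n) => y; field.
by rewrite pnatr_eq0 -lt0n fact_gt0 gt_eqF.
Qed.

Lemma is_derive_flat n (x : R) :
  is_derive x 1 (flat n) ((- n%:R) * flat n.+1 x + flat n.+2 x).
Proof.
have [x0|x0|<-] := ltrgtP 0 x.
- have xn0 : x != 0 by rewrite gt_eqF.
  apply: (@near_eq_is_derive R R R (fun y : R => y^-1 ^+ n * expR (- y^-1))).
    near=> y; rewrite /flat ifT//; near: y; exact: lt_nbhsr.
  rewrite /flat x0.
  have dV : is_derive x 1 (fun y : R => y^-1) (- x ^- 2).
    by have := @is_deriveV R id x 1 1 xn0 (is_derive_id _ _); rewrite scaler1.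
  have dE : is_derive x 1 (fun y : R => expR (- y^-1)) (expR (- x^-1) * x ^- 2).
    apply: (@is_derive1_comp _ expR (fun y : R => - y^-1)).
    rewrite -[x ^- 2]opprK; exact: is_deriveN.
  have dX : is_derive x 1 (fun y : R => y^-1 ^+ n) ((n%:R * x^-1 ^+ n.-1) *: - x ^- 2).
    rewrite (_ : (fun y => _) = (fun y : R => y^-1) ^+ n); last by rewrite exprfctE.
    exact: is_deriveX.
  apply: (is_derive_eq (is_deriveM dX dE)).
  rewrite /GRing.scale/= -exprVn; move: (x^-1) => y.
  by case: n {dX} => [|n]/=; rewrite ?exprS ?expr0; ring.
- apply: (@near_eq_is_derive R R R (cst 0)).
    near=> y; rewrite flat_le0//= ltW//; near: y; exact: lt_nbhsl.
  by rewrite !flat_le0 ?(ltW x0)// mulr0 addr0; exact: is_derive_cst.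
- rewrite !flat_le0// mulr0 addr0.
  apply: (@is_derive0_quadratic _ (n.+2)`!%:R) => //; first by rewrite /flat ltxx.
  by move=> y; rewrite ger0_norm ?flat_ge0// flat_le.
Unshelve. all: by end_near. Qed.

End smooth_real_functions.

Section tensor_test_functions.
Context {R : realType}.
Local Notation mu := (@lebesgue_measure R).

Lemma smooth1_flat n : smooth1 (@flat R n).
Proof.
apply: (@deriv_alg_smooth1 R (range (@flat R))); last first.
  by apply: deriv_alg_base; exists n.
move=> _ [m _ <-]; exists (fun x => (- m%:R) * flat m.+1 x + flat m.+2 x).
  apply: deriv_algD; last by apply: deriv_alg_base; exists m.+2.
  by apply: deriv_algZ; apply: deriv_alg_base; exists m.+1.
by move=> x; exact: is_derive_flat.
Qed.

(** As k grows this increases to the indicator of ]a, b[, with the support staying in [a, b];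
    identities between integrals of test functions thus pass to intervals by monotone
    convergence. *)
Definition rbump (k : nat) (a b x : R) : R :=
  flat 0 (k.+1%:R * (x - a)) * flat 0 (k.+1%:R * (b - x)).

Lemma smooth1_rbump k a b : smooth1 (rbump k a b).
Proof.
rewrite /rbump; apply: smooth1M.
  have := @smooth1_affine R (flat 0) k.+1%:R (- k.+1%:R * a) (@smooth1_flat 0).
  congr smooth1; apply/funext => x; congr flat; ring.
have := @smooth1_affine R (flat 0) (- k.+1%:R) (k.+1%:R * b) (@smooth1_flat 0).
congr smooth1; apply/funext => x; congr flat; ring.
Qed.

Lemma rbump_ge0 k a b x : 0 <= rbump k a b x.
Proof. by rewrite mulr_ge0 ?flat_ge0. Qed.

Lemma flat0_le1 (x : R) : flat 0 x <= 1.
Proof.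
rewrite /flat; case: ifPn => // x0; rewrite expr0 mul1r expRN invf_le1 ?expR_gt0//.
by rewrite -expR0 ler_expR invr_ge0 ltW.
Qed.

Lemma rbump_le1 k a b x : rbump k a b x <= 1.
Proof. by rewrite mulr_ile1 ?flat_ge0 ?flat0_le1. Qed.

Lemma rbump_supp k a b x : ~ (a < x < b) -> rbump k a b x = 0.
Proof.
rewrite /rbump => /negP; rewrite negb_and -!leNgt => /orP[xa|bx].
  by rewrite flat_le0 ?mul0r// pmulr_rle0 ?ltr0n// subr_le0.
by rewrite [X in _ * X]flat_le0 ?mulr0// pmulr_rle0 ?ltr0n// subr_le0.
Qed.

Lemma flat0_mono (x y : R) : x <= y -> flat 0 x <= flat 0 y.
Proof.
move=> xy; rewrite {1}/flat; case: ifPn => [x0|_]; last exact: flat_ge0.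
rewrite /flat (lt_le_trans x0 xy) !expr0 !mul1r ler_expR lerN2 lef_pV2//.
by rewrite posrE (lt_le_trans x0 xy).
Qed.

Lemma rbump_mono k l a b x : (k <= l)%N -> rbump k a b x <= rbump l a b x.
Proof.
move=> kl; have [|] := pselect (a < x < b); last by move=> /rbump_supp ->; exact: rbump_ge0.
move=> /andP[ax xb]; rewrite ler_pM ?flat_ge0// flat0_mono// ler_wpM2r ?ler_nat//.
  by rewrite subr_ge0 ltW.
by rewrite subr_ge0 ltW.
Qed.

Lemma flat0_cvg (y : R) : 0 < y -> flat 0 (k.+1%:R * y) @[k --> \oo] --> (1 : R).
Proof.
move=> y0; rewrite (_ : (fun k => _) = fun k => expR (- (y^-1 * k.+1%:R^-1))); last first.
  by apply/funext => k; rewrite /flat pmulr_rgt0 ?ltr0n// y0 expr0 mul1r invfM mulrC.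
have : - (y^-1 * k.+1%:R^-1) @[k --> \oo] --> - (y^-1 * 0).
  by apply: cvgN; apply: cvgMr; exact: cvg_harmonic.
rewrite mulr0 oppr0 => /cvg_comp /(_ (@continuous_expR R _)).
by rewrite expR0; apply.
Qed.

Lemma rbump_cvg a b x : rbump k a b x @[k --> \oo] --> (\1_(`]a, b[%classic) x : R).
Proof.
rewrite indicE; have [|/negP] := boolP (a < x < b) => abx.
  rewrite mem_set/= ?in_itv//= -(mulr1 (true%:R)); move/andP: abx => [ax xb].
  by apply: cvgM; apply: flat0_cvg; rewrite subr_gt0.
rewrite memNset/= ?in_itv//=; under eq_fun do rewrite rbump_supp//.
exact: cvg_cst.
Qed.

(* (slide h phi)' (y) = phi y - phi (y - h), so that testing a distributional
   derivative against slide h phi produces the increments of step h. *)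
Definition slide (h : R) (phi : R -> R) (y : R) : R :=
  \int[mu]_(s in `[0, h]) phi (y - s).

Lemma is_derive_slide h phi (y : R) : 0 < h -> continuous phi ->
  is_derive y 1 (slide h phi) (phi y - phi (y - h)).
Proof.
(* The margin 1 on each side keeps z and z - h, for z near y, inside the segment on which [Phi] is a
   primitive of phi; near y, [slide h phi] is z |-> Phi z - Phi (z - h). *)
move=> h0 cphi; set A := y - h - 1; set B := y + 1.
pose Phi z := \int[mu]_(s in `[A, z]) phi s.
have iphi : mu.-integrable `[A, B] (EFin \o phi).
  apply: continuous_compact_integrable; first exact: segment_compact.
  exact: continuous_subspaceT.
have dPhi (z : R) : A < z -> z < B -> is_derive z 1 Phi (phi z).
  move=> Az zB; have [dP Pz] := continuous_FTC1_closed zB iphi Az (cphi z).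
  by split; [exact: dP|rewrite -derive1E].
have dPhi2 (c z : R) : A < z - c -> z - c < B ->
    is_derive c 1 (fun s => - Phi (z - s)) (phi (z - c)).
  move=> Az zB; rewrite -[phi _]opprK; apply: is_deriveN; rewrite -mulN1r.
  have E (s : R) : z - s = (-1) * s + z by rewrite mulN1r addrC.
  rewrite (_ : (fun s => Phi _) = fun s => Phi ((-1) * s + z)); last first.
    by apply/funext => s; rewrite E.
  by apply: is_derive_affine; rewrite -E; exact: dPhi.
apply: (@near_eq_is_derive R R R (fun z => Phi z - Phi (z - h))).
  near=> z.
  have zA : y - 1 < z by near: z; apply: lt_nbhsr; lra.
  have zB : z < B by near: z; apply: lt_nbhsl; rewrite /B; lra.
  rewrite /slide /Rintegral.
  have -> : (\int[mu]_(s in `[0%R, h]) (phi (z - s))%:E)%E =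
      (- Phi (z - h) - - Phi (z - 0))%:E; last by rewrite /= subr0 opprK addrC.
  apply: (@FTC2_is_derive _ (fun s => phi (z - s)) (fun s => - Phi (z - s))) => //.
  - move=> s /andP[s0 sh]; apply: dPhi2; first by rewrite /A; lra.
    by lra.
  - move=> s _; apply: (@continuous_comp _ _ _ (fun s => z - s) phi); last exact: cphi.
    by apply: cvgB; [exact: cvg_cst|exact: cvg_id].
apply: is_deriveB; first by apply: dPhi; rewrite /A /B; lra.
rewrite -[phi (y - h)]mul1r (_ : (fun z => _) = fun z => Phi (1 * z - h)); last first.
  by apply/funext => z; rewrite mul1r.
by apply: is_derive_affine; rewrite mul1r; apply: dPhi; rewrite /A /B; lra.
Unshelve. all: by end_near. Qed.

Definition tensor n (phi : 'I_n -> R -> R) (x : 'rV[R]_n) : R :=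
  \prod_i phi i (x ord0 i).

Definition tensor_deriv n (j : 'I_n) (phi : 'I_n -> R -> R) : 'I_n -> R -> R :=
  fun i => if i == j then derive1 (phi i) else phi i.

Lemma tensor_shift n (phi : 'I_n -> R -> R) j (x : 'rV[R]_n) (h : R) :
  tensor phi (h *: delta_mx ord0 j + x) =
  phi j (h + x ord0 j) * \prod_(i | i != j) phi i (x ord0 i).
Proof.
rewrite /tensor (bigD1 j)//= !mxE !eqxx mulr1; congr (_ * _).
by apply: eq_bigr => i ij; rewrite !mxE eqxx/= (negbTE ij) mulr0 add0r.
Qed.

Lemma is_derive_tensor n (phi : 'I_n -> R -> R) j (x : 'rV[R]_n) :
  (forall i, smooth1 (phi i)) ->
  is_derive x (delta_mx ord0 j) (tensor phi) (tensor (tensor_deriv j phi) x).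
Proof.
move=> sphi.
have H : h^-1 *: ((tensor phi \o shift x) (h *: delta_mx ord0 j) - tensor phi x)
    @[h --> (0 : R)^'] --> tensor (tensor_deriv j phi) x.
  have -> : tensor (tensor_deriv j phi) x =
      derive1 (phi j) (x ord0 j) * \prod_(i | i != j) phi i (x ord0 i).
    rewrite /tensor (bigD1 j)//= /tensor_deriv eqxx; congr (_ * _).
    by apply: eq_bigr => i /negbTE ->.
  rewrite (_ : (fun h => _) = fun h =>
      (h^-1 *: ((phi j \o shift (x ord0 j)) (h *: 1) - phi j (x ord0 j))) *
      \prod_(i | i != j) phi i (x ord0 i)); last first.
    apply/funext => h /=; rewrite tensor_shift -{3}(add0r x) -(scale0r (delta_mx ord0 j)).
    by rewrite tensor_shift add0r scaler1 -mulrBl scalerAl.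
  apply: cvgMl; rewrite derive1E; exact: (@smooth1_derivable R _ (x ord0 j) (sphi j)).
split; first by apply/cvg_ex; exists (tensor (tensor_deriv j phi) x).
exact/cvg_lim.
Qed.

Lemma smooth1_tensor_deriv n j (phi : 'I_n -> R -> R) :
  (forall i, smooth1 (phi i)) -> forall i, smooth1 (tensor_deriv j phi i).
Proof.
by move=> sphi i; rewrite /tensor_deriv; case: ifPn => // _; exact: smooth1_derive1.
Qed.

Lemma continuous_tensor n (phi : 'I_n -> R -> R) :
  (forall i, smooth1 (phi i)) -> continuous (tensor phi).
Proof.
move=> sphi; rewrite /tensor; elim: (index_enum _) => [|i s IH].
  rewrite (_ : (fun x => _) = cst 1); first exact: cst_continuous.
  by apply/funext => x; rewrite big_nil.
rewrite (_ : (fun x => _) =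
    (fun x : 'rV[R]_n => phi i (x ord0 i) * \prod_(i <- s) phi i (x ord0 i))).
  have c1 : continuous (fun x : 'rV[R]_n => phi i (x ord0 i)).
    move=> x; apply: (@continuous_comp _ _ _ (fun y : 'rV[R]_n => y ord0 i) (phi i)).
      exact: coord_continuous.
    exact: smooth1_continuous.
  by move=> x; exact: cvgM (c1 x) (IH x).
by apply/funext => x; rewrite big_cons.
Qed.

(** A partial derivative of a tensor product of smooth functions is again such a product, with one
    factor differentiated, so any word of partial derivatives stays in a class of continuous
    functions. *)
Lemma smooth_tensor n (phi : 'I_n -> R -> R) :
  (forall i, smooth1 (phi i)) -> smooth (tensor phi).
Proof.
move=> sphi s.
have [psi spsi ->] : exists2 psi, forall i, smooth1 (psi i) &
    partials s (tensor phi) = tensor psi.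
  elim: s => [|j s [psi spsi IH]]; first by exists phi.
  exists (tensor_deriv j psi); first exact: smooth1_tensor_deriv.
  rewrite /= IH; apply/funext => x.
  exact: (@derive_val _ _ _ _ _ _ _ (is_derive_tensor j x spsi)).
split; first exact: continuous_tensor.
by move=> j x; have [] := is_derive_tensor j x spsi.
Qed.

Lemma test_function_tensor n (phi : 'I_n -> R -> R) (a b : R) :
  (forall i, smooth1 (phi i)) -> (forall i x, ~ (a <= x <= b) -> phi i x = 0) ->
  test_function (tensor phi).
Proof.
move=> sphi supp; split; first exact: smooth_tensor.
pose B := [set v : 'rV[R]_n | forall i, `[a, b]%classic (v ord0 i)].
have cB : compact B.
  apply: (@rV_compact R n (fun=> `[a, b]%classic)) => i; exact: segment_compact.
apply: (@subclosed_compact _ _ B) => //; first exact: closed_closure.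
rewrite [X in _ `<=` X](closure_id B).1; last first.
  by apply: compact_closed => //; exact: norm_hausdorff.
apply: closureS => x /= /eqP tx i; rewrite /= in_itv/=; apply: contrapT => xab.
by apply: tx; rewrite /tensor (bigD1 i)//= supp// mul0r.
Qed.

End tensor_test_functions.

(** * Translates of functions of bounded variation *)

Section measure_lemmas.
Context {R : realType}.
Local Open Scope ereal_scope.

Lemma ge0_integral_mrestr d (T : measurableType d) (m : {measure set T -> \bar R})
    (D : set T) (mD : measurable D) (f : T -> \bar R) :
  measurable_fun setT f -> (forall x, 0 <= f x) ->
  \int[mrestr m mD]_x f x = \int[m]_(x in D) f x.
Proof.
move=> mf f0.
have negD : mrestr m mD (~` D) = 0 by rewrite /mrestr setICl measure0.
rewrite (@ge0_negligible_integral _ _ _ (mrestr m mD) setT (~` D) f)//; last first.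
  exact: measurableC.
rewrite setTD setCK; apply: eq_measure_integral => A mA AD.
by rewrite /= /mrestr; congr (m _); exact/setIidPl.
Qed.

Section density_plus.
Context d (T : measurableType d) (m : {measure set T -> \bar R})
  (N : {measure set T -> \bar R}) (f : T -> \bar R).
Hypotheses (mf : measurable_fun setT f) (f0 : forall x, 0 <= f x).

(** The two proofs are arguments so that the term itself carries what its measure structure
    requires. *)
Definition density_plus of measurable_fun setT f & (forall x, 0 <= f x) :=
  fun A => \int[m]_(x in A) f x + N A.

Local Notation nu := (density_plus mf f0).

Let nu0 : nu set0 = 0. Proof. by rewrite /nu integral_set0 measure0 adde0. Qed.

Let nu_ge0 A : 0 <= nu A. Proof. by rewrite adde_ge0// integral_ge0. Qed.

Let nu_sigma_additive : semi_sigma_additive nu.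
Proof.
move=> F mF tF mUF; under eq_fun do rewrite big_split; apply: cvgeD => //=.
- by rewrite ge0_adde_def// inE ?integral_ge0.
- exact: semi_sigma_additive_nng_induced.
- exact: measure_semi_sigma_additive.
Qed.

HB.instance Definition _ := isMeasure.Build _ _ _ nu nu0 nu_ge0 nu_sigma_additive.

End density_plus.
End measure_lemmas.

(** * Open boxes as a generating family stable under intersection *)

Section boxes.
Context {R : realType} (n : nat).
Implicit Types a b : 'I_n -> R.

Definition box a b := [set x : 'rV[R]_n | forall i, a i < x ord0 i < b i].

Definition boxes := [set box p.1 p.2 | p in [set: ('I_n -> R) * ('I_n -> R)]].

Lemma measurable_box a b : measurable (box a b).
Proof.
rewrite (_ : box a b = \bigcap_(i in [set: 'I_n])
    ((fun x : 'rV[R]_n => x ord0 i) @^-1` `]a i, b i[%classic)).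
  apply: fin_bigcap_measurable => // i _.
  by rewrite -[X in measurable X]setTI; exact: measurable_rV_coord.
by apply/seteqP; split => x /= h i; [move=> _|]; have := h i; rewrite /= in_itv; [|apply].
Qed.

Lemma setI_closed_boxes : setI_closed boxes.
Proof.
move=> _ _ [[a b] _ <-] [[c d] _ <-] /=.
exists (fun i => Num.max (a i) (c i), fun i => Num.min (b i) (d i)) => //.
apply/seteqP; split => x /=.
  move=> h; split => i /=; have := h i; rewrite gt_max lt_min.
    by move=> /andP[/andP[-> _] /andP[-> _]].
  by move=> /andP[/andP[_ ->] /andP[_ ->]].
move=> [h1 h2] i; have := h1 i; have := h2 i; rewrite gt_max lt_min /=.
by move=> /andP[-> ->] /andP[-> ->].
Qed.

Lemma bound_coord (x : 'rV[R]_n) : exists k : nat, forall i, `|x ord0 i| < k.+1%:R.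
Proof.
exists (Num.truncn (\sum_i `|x ord0 i|)) => i.
apply: le_lt_trans (_ : _ <= \sum_i `|x ord0 i|) _; last by rewrite truncnS_gt.
by rewrite (bigD1 i)//= lerDl sumr_ge0.
Qed.

(** The sigma-algebra is generated by the coordinates, hence by the half-spaces x_i > r, and each of
    these is a countable union of boxes with left end r in direction i and all other ends at
    distance k + 1 from 0. *)
Lemma measurable_boxesE : @measurable _ 'rV[R]_n = <<s boxes>>.
Proof.
apply/seteqP; split; last first.
  apply: smallest_sub; first exact: sigma_algebra_measurable.
  by move=> _ [[a b] _ <-]; exact: measurable_box.
apply: smallest_sub; first exact: smallest_sigma_algebra.
move=> A; rewrite -bigcup_seq => -[i _ [Y mY <-]]; rewrite setTI.
pose C := [set B : set R | <<s boxes>> ((fun x : 'rV[R]_n => x ord0 i) @^-1` B)].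
suff: C Y by [].
have : (@RGenOInfty.G R).-sigma.-measurable Y by rewrite -RGenOInfty.measurableE.
rewrite /measurable/=; apply: smallest_sub.
  have [h0 hC hU] := @smallest_sigma_algebra _ setT boxes.
  split => [|B mB|F mF]; rewrite /C/=.
  - by rewrite preimage_set0.
  - by rewrite setTD preimage_setC -setTD; exact: hC.
  - by rewrite preimage_bigcup; exact: hU.
move=> _ [r ->]; rewrite /C/=.
rewrite (_ : _ @^-1` _ = \bigcup_k box
    (fun l => if l == i then r else - k.+1%:R) (fun=> k.+1%:R)).
  have [_ _ hU] := @smallest_sigma_algebra _ setT boxes; apply: hU => k.
  apply: sub_gen_smallest.
  by exists (fun l => if l == i then r else - k.+1%:R, fun=> k.+1%:R).
apply/seteqP; split => x /=; rewrite in_itv/= andbT.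
  move=> rx; have [k hk] := bound_coord x; exists k => // l.
  have := hk l; rewrite ltr_norml => /andP[h1 h2]; rewrite h2 andbT.
  by case: eqP => [->|].
by move=> [k _ /(_ i)]; rewrite eqxx => /andP[].
Qed.

Lemma bigcup_boxesT : \bigcup_k box (fun=> - k.+1%:R) (fun=> k.+1%:R) = setT.
Proof.
apply/seteqP; split => // x _; have [k hk] := bound_coord x; exists k => // i.
by have := hk i; rewrite ltr_norml.
Qed.

End boxes.

Section bump_tensor.
Context {R : realType} (n : nat).
Implicit Types a b : 'I_n -> R.
Local Open Scope ereal_scope.

Definition bumps k a b : 'I_n -> R -> R := fun i => rbump k (a i) (b i).

Lemma smooth1_bumps k a b i : smooth1 (bumps k a b i).
Proof. exact: smooth1_rbump. Qed.

Lemma measurable_tensor (phi : 'I_n -> R -> R) :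
  (forall i, smooth1 (phi i)) -> measurable_fun setT (tensor phi).
Proof.
move=> sphi; apply: measurable_prod => i _.
have mphi : measurable_fun setT (phi i).
  by apply: continuous_measurable_fun; exact: smooth1_continuous.
exact: (measurableT_comp mphi (@measurable_rV_coord R n i)).
Qed.

Lemma tensor_bumps_ge0 k a b x : (0 <= tensor (bumps k a b) x)%R.
Proof. by apply: prodr_ge0 => i _; exact: rbump_ge0. Qed.

Lemma tensor_bumps_le1 k a b x : (tensor (bumps k a b) x <= 1)%R.
Proof.
apply: (@le_trans _ _ (\prod_(i < n) 1)%R); last by rewrite big1.
by apply: ler_prod => i _; rewrite rbump_ge0 rbump_le1.
Qed.

Lemma tensor_bumps_mono k l a b x : (k <= l)%N ->
  (tensor (bumps k a b) x <= tensor (bumps l a b) x)%R.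
Proof. by move=> kl; apply: ler_prod => i _; rewrite rbump_ge0 rbump_mono. Qed.

Lemma tensor_bumps_cvg a b x :
  tensor (bumps k a b) x @[k --> \oo] --> (\1_(box a b) x : R).
Proof.
rewrite /tensor (_ : \1_(box a b) x =
    (\prod_(i < n) \1_(`]a i, b i[%classic) (x ord0 i))%R); last first.
  have [xab|xab] := pselect (box a b x).
    rewrite indicE mem_set// big1// => i _; rewrite indicE mem_set//=.
    by rewrite in_itv/=; exact: xab.
  rewrite indicE memNset//; move/existsNP : xab => [i xi].
  by rewrite (bigD1 i)//= indicE memNset ?mul0r//= in_itv.
elim: (index_enum _) => [|i s IH].
  under eq_fun do rewrite big_nil.
  by rewrite big_nil; exact: cvg_cst.
under eq_fun do rewrite big_cons; rewrite big_cons.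
by apply: cvgM => //; exact: rbump_cvg.
Qed.

(** Monotone convergence. The measure and the weight are arbitrary, so that it serves both Lebesgue
    measure weighted by a part of the increment and a sliding measure with weight 1. *)
Lemma cvg_integral_bumps (m : {measure set 'rV[R]_n -> \bar R}) a b
    (w : 'rV[R]_n -> R) :
  measurable_fun setT w -> (forall x, 0 <= w x)%R ->
  \int[m]_x (tensor (bumps k a b) x * w x)%:E @[k --> \oo] -->
  \int[m]_(x in box a b) (w x)%:E.
Proof.
move=> mw w0.
have mt k : measurable_fun setT (fun x => (tensor (bumps k a b) x * w x)%:E).
  apply/measurable_EFinP; apply: measurable_funM => //.
  by apply: measurable_tensor => i; exact: smooth1_bumps.
have t0 k x : setT x -> 0 <= (tensor (bumps k a b) x * w x)%:E.
  by move=> _; rewrite lee_fin mulr_ge0// tensor_bumps_ge0.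
have nd x : setT x -> nondecreasing_seq (fun k => (tensor (bumps k a b) x * w x)%:E).
  move=> _ k l kl; rewrite lee_fin ler_wpM2r//; exact: tensor_bumps_mono.
have := @cvg_monotone_convergence _ _ R m setT measurableT _ mt t0 nd.
rewrite [X in _ --> X -> _](_ : _ = \int[m]_(x in box a b) (w x)%:E)//.
rewrite [RHS]integral_mkcond; apply: eq_integral => x _.
apply/cvg_lim => //; rewrite patchE.
have -> : (if x \in box a b then (w x)%:E else 0) = (\1_(box a b) x * w x)%:E.
  by rewrite indicE; case: ifPn => _; rewrite ?mul1r ?mul0r.
apply: cvg_EFin; first exact: nearW.
by apply: cvgM; [exact: tensor_bumps_cvg|exact: cvg_cst].
Qed.

End bump_tensor.

(** * Sliding a finite measure along a coordinate axis *)

Section slide_measure.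
Context {R : realType} (n : nat) (j : 'I_n) (h : R).
Hypothesis h0 : 0 < h.
Local Notation mu := (@lebesgue_measure R).
Local Notation e := (delta_mx ord0 j : 'rV[R]_n).
Variable N : {finite_measure set 'rV[R]_n -> \bar R}.
Local Open Scope ereal_scope.

Lemma measurable_strip : measurable (`[0%R, h]%classic `*` setT : set (measurableTypeR R * 'rV[R]_n)).
Proof. exact: measurableX. Qed.

Lemma measurable_slide :
  measurable_fun [set: measurableTypeR R * 'rV[R]_n] (fun z => z.2 - z.1 *: e)%R.
Proof.
apply: measurable_fun_rV => i; under eq_fun do rewrite !mxE.
apply: measurable_funB.
  by apply: (measurableT_comp (@measurable_rV_coord R n i)); exact: measurable_snd.
by apply: measurable_funM => //; exact: measurable_fst.
Qed.

(** The sum of the translates of N by -s e over 0 <= s <= h. It is dual to [slide]: integrating the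
    function slid in direction j against N amounts to integrating the original one against this
    measure. *)
Definition slide_measure : {measure set 'rV[R]_n -> \bar R} :=
  measure_function_pushforward__canonical__measure_function_Measure
    (mrestr (mu \x N) measurable_strip) measurable_slide.

Lemma slide_measureT : slide_measure setT = h%:E * N setT.
Proof.
rewrite /slide_measure/= /pushforward preimage_setT /mrestr setTI.
rewrite product_measure1E//= lebesgue_measure_itv/= lte_fin h0.
by rewrite oppr0 adde0.
Qed.

Lemma integral_slide_measure (f : 'rV[R]_n -> \bar R) :
  measurable_fun setT f -> (forall x, 0 <= f x) ->
  \int[slide_measure]_x f x =
  \int[N]_x \int[mu]_(s in `[0%R, h]) f (x - s *: e)%R.
Proof.
move=> mf f0; have mfs := measurableT_comp mf measurable_slide.
rewrite (ge0_integral_pushforward measurable_slide)//= preimage_setT.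
rewrite (ge0_integral_mrestr _ measurable_strip mfs); last by move=> x; exact: f0.
rewrite integral_mkcond; set F := _ \_ _.
have mF : measurable_fun setT F.
  by apply/(measurable_restrictT _ measurable_strip); exact: measurable_funTS.
have F0 x : 0 <= F x by apply: erestrict_ge0 => y _; exact: f0.
rewrite (fubini_tonelli2 F mF F0).
apply: eq_integral => x _; rewrite /fubini_G [RHS]integral_mkcond.
apply: eq_integral => s _; rewrite /F /patch.
have [sh|sh] := boolP (s \in `[0%R, h]%classic).
  by rewrite mem_set//; split => //; exact/set_mem.
by rewrite memNset// => -[/mem_set]; rewrite (negbTE sh).
Qed.

End slide_measure.

Section translation_estimate.
Context {R : realType} (n : nat).
Local Notation mu := (@lebesgue_measure R).
Local Notation leb := (@lebesgue_rV R n).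

Definition cube (M : R) := [set v : 'rV[R]_n | forall i, - M <= v ord0 i <= M].

Lemma measurable_cube M : measurable (cube M).
Proof.
rewrite (_ : cube M = \bigcap_(i in [set: 'I_n])
    ((fun x : 'rV[R]_n => x ord0 i) @^-1` `[- M, M]%classic)).
  apply: fin_bigcap_measurable => // i _.
  by rewrite -[X in measurable X]setTI; exact: measurable_rV_coord.
by apply/seteqP; split => x /= H i; [move=> _|]; have := H i; rewrite /= in_itv; [|apply].
Qed.

Lemma compact_cube M : compact (cube M).
Proof.
rewrite (_ : cube M = [set v : 'rV[R]_n | forall i, `[- M, M]%classic (v ord0 i)]).
  by apply: (@rV_compact R n (fun=> `[- M, M]%classic)) => i; exact: segment_compact.
by apply/seteqP; split => x /= H i; have := H i; rewrite /= in_itv.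
Qed.

Lemma integrable_cut (phi w : 'rV[R]_n -> R) (M : R) :
  measurable_fun setT phi -> (forall x, `|phi x| <= 1) ->
  (forall x, ~ cube M x -> phi x = 0) -> measurable_fun setT w ->
  (\int[leb]_(x in cube M) `|w x|%:E < +oo)%E ->
  leb.-integrable setT (fun x => (phi x * w x)%:E).
Proof.
move=> mphi phi1 phi0 mw wM; apply/integrableP; split.
  by apply/measurable_EFinP; exact: measurable_funM.
apply: le_lt_trans wM; rewrite [leRHS]integral_mkcond; apply: ge0_le_integral => //.
- by apply/measurable_EFinP; apply: measurableT_comp => //; exact: measurable_funM.
- apply/(measurable_restrictT _ (measurable_cube M)); apply/measurable_EFinP.
  by apply: measurable_funTS; exact: measurableT_comp.
- move=> x _; rewrite patchE; case: ifPn => [_|/negP].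
    by rewrite abse_EFin lee_fin normrM ler_piMl.
  by rewrite inE => /phi0 ->; rewrite mul0r abse_EFin normr0.
Qed.

Lemma Rintegral_translation (a : 'rV[R]_n) (F : 'rV[R]_n -> R) :
  measurable_fun setT F -> \int[leb]_x F (x + a) = \int[leb]_x F x.
Proof.
move=> mF; rewrite /Rintegral; congr fine; rewrite [LHS]integralE [RHS]integralE.
have mE : measurable_fun setT (EFin \o F) by exact/measurable_EFinP.
congr (_ - _)%E.
  rewrite -(ge0_integral_rV_translation a (measurable_funepos mE)) => [|x//].
  by apply: eq_integral => x _; rewrite !funeposE.
rewrite -(ge0_integral_rV_translation a (measurable_funeneg mE)) => [|x//].
by apply: eq_integral => x _; rewrite !funenegE.
Qed.

Lemma itv_shift (M h s y : R) : 0 <= s <= h ->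
  - M <= y - s <= M -> - (M + h) <= y <= M + h.
Proof. by move=> /andP[s0 sh] /andP[y1 y2]; apply/andP; split; lra. Qed.

Section one_direction.
Variables (j : 'I_n) (h : R) (u : 'rV[R]_n -> R).
Variables np nn : {finite_measure set 'rV[R]_n -> \bar R}.
Hypotheses (h0 : 0 < h) (mu_ : measurable_fun setT u).
Hypothesis loc_u : forall M, (\int[leb]_(x in cube M) `|u x|%:E < +oo)%E.
Hypothesis grad_u : forall phi : 'rV[R]_n -> R, test_function phi ->
  \int[leb]_x (partial j phi x * u x) = - (\int[np]_x phi x - \int[nn]_x phi x).
Local Notation e := (delta_mx ord0 j : 'rV[R]_n).

Let g (x : 'rV[R]_n) := u (x + h *: e) - u x.

Let mut : measurable_fun setT (fun x : 'rV[R]_n => u (x + h *: e)).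
Proof. exact: measurableT_comp mu_ (measurable_rVD _). Qed.

Let mg : measurable_fun setT g.
Proof. exact: measurable_funB. Qed.

(** The translation sends the cube of half-side M into that of half-side M + h. *)
Let loc_ut M : (\int[leb]_(x in cube M) `|u (x + h *: e)|%:E < +oo)%E.
Proof.
apply: le_lt_trans (loc_u (M + h)).
rewrite integral_mkcond [leRHS]integral_mkcond.
set G := (X in (\int[leb]_x X x <= _)%E).
pose F (x : 'rV[R]_n) : \bar R := if x - h *: e \in cube M then `|u x|%:E else 0%E.
have mD : measurable ((fun x : 'rV[R]_n => x - h *: e) @^-1` cube M).
  rewrite -[X in measurable X]setTI; apply: (measurable_rVD (- (h *: e))) => //.
  exact: measurable_cube.
have mF : measurable_fun setT F.
  rewrite (_ : F = (fun x : 'rV[R]_n => `|u x|%:E) \_ ((fun x : 'rV[R]_n => x - h *: e) @^-1` cube M)) //.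
  apply/(measurable_restrictT _ mD).
  by apply/measurable_EFinP; apply: measurable_funTS; exact: measurableT_comp.
have F0 x : (0 <= F x)%E by rewrite /F; case: ifP.
have -> : (\int[leb]_x G x = \int[leb]_x F x)%E.
  rewrite -(ge0_integral_rV_translation (h *: e) mF F0).
  by apply: eq_integral => x _; rewrite /G /F addrK patchE.
apply: ge0_le_integral => //.
- apply/(measurable_restrictT _ (measurable_cube _)); apply/measurable_EFinP.
  by apply: measurable_funTS; exact: measurableT_comp.
move=> x _; rewrite /F patchE; case: ifPn => [|_]; last by case: ifP.
rewrite inE => cx; rewrite ifT// inE => i; have := cx i; rewrite !mxE eqxx/=.
apply: itv_shift; case: (i == j); rewrite ?mulr1 ?mulr0 ?lexx (ltW h0)//.
Qed.

Let loc_g (w : 'rV[R]_n -> R) M : measurable_fun setT w -> (forall x, `|w x| <= `|g x|) ->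
  (\int[leb]_(x in cube M) `|w x|%:E < +oo)%E.
Proof.
move=> mw wg.
apply: (@le_lt_trans _ _ (\int[leb]_(x in cube M) (`|u (x + h *: e)|%:E + `|u x|%:E))%E).
  apply: ge0_le_integral => //; first exact: measurable_cube.
  - by apply/measurable_EFinP/measurable_funTS; exact: measurableT_comp.
  - apply: emeasurable_funD; apply/measurable_EFinP/measurable_funTS; exact: measurableT_comp.
  - by move=> x _; rewrite -EFinD lee_fin (le_trans (wg x))// ler_normB.
rewrite ge0_integralD//; first by rewrite lte_add_pinfty.
- exact: measurable_cube.
- by apply/measurable_EFinP/measurable_funTS; exact: measurableT_comp.
- by apply/measurable_EFinP/measurable_funTS; exact: measurableT_comp.
Qed.


Let gp (x : 'rV[R]_n) := Num.max (g x) 0.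
Let gn (x : 'rV[R]_n) := Num.max (- g x) 0.

Let mgp : measurable_fun setT gp. Proof. exact: measurable_maxr. Qed.

Let mgn : measurable_fun setT gn.
Proof. by apply: measurable_maxr => //; exact: measurableT_comp. Qed.

Let gp0 x : 0 <= gp x. Proof. by rewrite le_max lexx orbT. Qed.
Let gn0 x : 0 <= gn x. Proof. by rewrite le_max lexx orbT. Qed.

Let gpn x : g x = gp x - gn x.
Proof.
rewrite /gp /gn; case/orP: (le_total 0 (g x)) => gx.
  by rewrite max_l// max_r ?oppr_le0// subr0.
by rewrite max_r// max_l ?oppr_ge0// sub0r opprK.
Qed.

Let gp_le x : `|gp x| <= `|g x|.
Proof. by rewrite ger0_norm// ge_max ler_norm normr_ge0. Qed.

Let gn_le x : `|gn x| <= `|g x|.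
Proof. by rewrite ger0_norm// ge_max -normrN ler_norm normr_ge0. Qed.

Section one_bump.
Variables (k : nat) (a b : 'I_n -> R).
Let phi := bumps k a b.

(** The test function for the gradient: its derivative in direction j is the difference of the bump
    and its translate by h e. *)
Let psi : 'I_n -> R -> R := fun i => if i == j then slide h (phi i) else phi i.

Let smooth1_phi i : smooth1 (phi i). Proof. exact: smooth1_bumps. Qed.

Let smooth1_psi i : smooth1 (psi i).
Proof.
rewrite /psi; case: ifPn => // _.
apply: (smooth1_of_derive (g := fun y : R => phi i y - phi i (y - h))).
  by move=> y; apply: is_derive_slide => //; exact: smooth1_continuous.
apply: smooth1B => //; have := @smooth1_affine R (phi i) 1 (- h) (@smooth1_phi i).
by under eq_fun do rewrite mul1r.
Qed.

Let tensor_phi_shift s (x : 'rV[R]_n) : tensor phi (x - s *: e) =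
  phi j (x ord0 j - s) * \prod_(i | i != j) phi i (x ord0 i).
Proof. by rewrite addrC -scaleNr tensor_shift addrC. Qed.

Let tensor_psi (x : 'rV[R]_n) :
  (tensor psi x)%:E = (\int[mu]_(s in `[0%R, h]) (tensor phi (x - s *: e))%:E)%E.
Proof.
under eq_integral do rewrite tensor_phi_shift mulrC EFinM.
have cs : continuous (fun s : R => phi j (x ord0 j - s)).
  move=> s; apply: (@continuous_comp _ _ _ (fun s : R => x ord0 j - s) (phi j)).
    by apply: cvgB; [exact: cvg_cst|exact: cvg_id].
  exact: smooth1_continuous.
have ms : measurable_fun setT (fun s : R => (phi j (x ord0 j - s))%:E).
  by apply/measurable_EFinP; exact: continuous_measurable_fun.
rewrite ge0_integralZl//=; last 3 first.
- exact: measurable_funTS.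
- by move=> s _; rewrite lee_fin; exact: rbump_ge0.
- by rewrite lee_fin; apply: prodr_ge0 => i _; exact: rbump_ge0.
rewrite /tensor (bigD1 j)//= /psi eqxx mulrC EFinM; congr (_ * _)%E.
  by congr EFin; apply: eq_bigr => i /negbTE ->.
rewrite /slide /Rintegral fineK//.
apply: integrable_fin_num => //.
by apply: continuous_compact_integrable; [exact: segment_compact|exact: continuous_subspaceT].
Qed.

Let M := \sum_i (`|a i| + `|b i|).

Let aM i : - M <= a i /\ b i <= M.
Proof.
have H : `|a i| + `|b i| <= M.
  by rewrite /M (bigD1 i)//= lerDl sumr_ge0// => l _; rewrite addr_ge0.
split.
  rewrite lerNl (le_trans _ H)// (le_trans (ler_norm _))// normrN.
  by rewrite lerDl.
by rewrite (le_trans _ H)// (le_trans (ler_norm _))// lerDr.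
Qed.

Let supp_phi i (x : R) : ~ (- M <= x <= M) -> phi i x = 0.
Proof.
move=> xM; apply: rbump_supp => /andP[ax xb]; apply: xM; have [h1 h2] := aM i.
by apply/andP; split; lra.
Qed.

Let supp_psi i (x : R) : ~ (- (M + h) <= x <= M + h) -> psi i x = 0.
Proof.
rewrite /psi => xM; case: ifPn => _; last first.
  apply: supp_phi => xi; apply/xM/(@itv_shift _ _ 0); rewrite ?lexx ?(ltW h0) ?subr0//.
rewrite /slide /Rintegral (eq_integral (cst 0%E)) ?integral0// => s.
rewrite inE/= in_itv/= => /andP[s0 sh]; congr EFin; apply: supp_phi => xs.
by apply/xM/(@itv_shift _ _ s); rewrite ?s0.
Qed.

Let test_psi : test_function (tensor psi).
Proof. exact: (test_function_tensor smooth1_psi supp_psi). Qed.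

Let partial_psi (x : 'rV[R]_n) :
  partial j (tensor psi) x = tensor phi x - tensor phi (x - h *: e).
Proof.
rewrite /partial (@derive_val _ _ _ _ _ _ _ (is_derive_tensor j x smooth1_psi)).
rewrite tensor_phi_shift -{2}(subr0 x) -(scale0r e) tensor_phi_shift subr0 -mulrBl.
rewrite /tensor (bigD1 j)//= /tensor_deriv eqxx; congr (_ * _).
  rewrite /psi eqxx derive1E; apply: derive_val.
  by apply: is_derive_slide => //; exact: smooth1_continuous.
by apply: eq_bigr => i /negbTE ij; rewrite ij /psi ij.
Qed.

Let mphi : measurable_fun setT (tensor phi).
Proof. exact: measurable_tensor. Qed.

Let cut_phi (w : 'rV[R]_n -> R) : measurable_fun setT w ->
  (\int[leb]_(x in cube M) `|w x|%:E < +oo)%E ->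
  leb.-integrable setT (fun x => (tensor phi x * w x)%:E).
Proof.
move=> mw; apply: integrable_cut => //.
- by move=> x; rewrite ger0_norm ?tensor_bumps_ge0 ?tensor_bumps_le1.
- move=> x /existsNP[i xi]; rewrite /tensor (bigD1 i)//= supp_phi ?mul0r//.
Qed.

(** Summation by parts for increments: translation invariance moves the shift from u to the bump,
    the resulting difference of bumps is the j-th derivative of [tensor psi], and the definition of
    the distributional gradient applies. *)
Let Rintegral_phi_g : \int[leb]_x (tensor phi x * g x) =
  \int[np]_x tensor psi x - \int[nn]_x tensor psi x.
Proof.
rewrite -[RHS]opprK -(grad_u test_psi).
transitivity (\int[leb]_x (tensor phi x * u (x + h *: e) - tensor phi x * u x)).
  by congr fine; apply: eq_integral => x _; rewrite mulrBr.
have mtphi : measurable_fun setT (fun x : 'rV[R]_n => tensor phi (x - h *: e)).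
  exact: measurableT_comp mphi (measurable_rVD _).
rewrite RintegralB//; [|exact: cut_phi|exact: cut_phi].
have -> : \int[leb]_x (tensor phi x * u (x + h *: e)) =
    \int[leb]_x (tensor phi (x - h *: e) * u x).
  have := Rintegral_translation (h *: e) (measurable_funM mtphi mu_) => <-.
  by congr fine; apply: eq_integral => x _ /=; rewrite addrK.
rewrite -opprB; congr (- _); rewrite -RintegralB//; last 2 first.
- exact: cut_phi.
- apply: (@integrable_cut _ _ (M + h)) => //.
  + by move=> x; rewrite ger0_norm ?tensor_bumps_ge0 ?tensor_bumps_le1.
  + move=> x /existsNP[i xi]; rewrite /tensor (bigD1 i)//= supp_phi ?mul0r// !mxE eqxx/=.
    move=> xM; apply: xi; apply: itv_shift xM.
    by case: (i == j); rewrite ?mulr1 ?mulr0 ?lexx (ltW h0).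
by congr fine; apply: eq_integral => x _; rewrite partial_psi mulrBl.
Qed.

Let Rintegral_psi (N : {finite_measure set 'rV[R]_n -> \bar R}) :
  (\int[N]_x tensor psi x)%:E = (\int[slide_measure j h N]_x (tensor phi x)%:E)%E.
Proof.
have mE : measurable_fun setT (fun x => (tensor phi x)%:E) by exact/measurable_EFinP.
have t0 x : (0 <= (tensor phi x)%:E)%E by rewrite lee_fin tensor_bumps_ge0.
have fin : (\int[slide_measure j h N]_x (tensor phi x)%:E < +oo)%E.
  apply: (@le_lt_trans _ _ (\int[slide_measure j h N]_x (cst 1%E x))%E).
    by apply: ge0_le_integral => //= x _; rewrite lee_fin tensor_bumps_le1.
  rewrite integral_cst// mul1e slide_measureT// lte_mul_pinfty//.
    by rewrite lee_fin ltW.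
  by rewrite ltey_eq fin_num_measure.
rewrite integral_slide_measure// in fin *; rewrite /Rintegral fineK.
  by apply: eq_integral => x _; exact: tensor_psi.
rewrite (eq_integral _ _ (fun x _ => tensor_psi x)) ge0_fin_numE//.
by apply: integral_ge0 => x _; apply: integral_ge0.
Qed.

Lemma bumps_balance :
  (\int[leb]_x (tensor (bumps k a b) x * gp x)%:E +
     \int[slide_measure j h nn]_x (tensor (bumps k a b) x * 1)%:E =
   \int[leb]_x (tensor (bumps k a b) x * gn x)%:E +
     \int[slide_measure j h np]_x (tensor (bumps k a b) x * 1)%:E)%E.
Proof.
have ip := cut_phi mgp (loc_g _ mgp gp_le); have iq := cut_phi mgn (loc_g _ mgn gn_le).
have <- : ((\int[leb]_x (tensor phi x * gp x))%:E = \int[leb]_x (tensor phi x * gp x)%:E)%E.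
  by rewrite fineK//; exact: integrable_fin_num.
have <- : ((\int[leb]_x (tensor phi x * gn x))%:E = \int[leb]_x (tensor phi x * gn x)%:E)%E.
  by rewrite fineK//; exact: integrable_fin_num.
under eq_integral do rewrite mulr1; under [in RHS]eq_integral do rewrite mulr1.
rewrite -!Rintegral_psi -!EFinD; congr EFin.
have : \int[leb]_x (tensor phi x * gp x) - \int[leb]_x (tensor phi x * gn x) =
    \int[np]_x tensor psi x - \int[nn]_x tensor psi x.
  rewrite -Rintegral_phi_g -RintegralB//.
  by congr fine; apply: eq_integral => x _; rewrite gpn mulrBr.
move/eqP; rewrite subr_eq => /eqP ->.
by rewrite -addrA addrC -addrA; congr (_ + _); rewrite addrC subrK.
Qed.

End one_bump.

Let mEgp : measurable_fun setT (EFin \o gp). Proof. exact/measurable_EFinP. Qed.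
Let mEgn : measurable_fun setT (EFin \o gn). Proof. exact/measurable_EFinP. Qed.
Let Egp0 x : (0 <= (EFin \o gp) x)%E. Proof. by rewrite lee_fin. Qed.
Let Egn0 x : (0 <= (EFin \o gn) x)%E. Proof. by rewrite lee_fin. Qed.

(* The increment g is the density of the difference of the measures obtained by
   sliding the parts np and nn of the derivative; with the negative parts moved
   across, this becomes the equality of two positive measures. *)
Let m1 : {measure set 'rV[R]_n -> \bar R} :=
  density_plus leb (slide_measure j h nn) mEgp Egp0.
Let m2 : {measure set 'rV[R]_n -> \bar R} :=
  density_plus leb (slide_measure j h np) mEgn Egn0.

Let balance_cvg (N : {measure set 'rV[R]_n -> \bar R}) (w : 'rV[R]_n -> R) a b :
  measurable_fun setT w -> (forall x, 0 <= w x) ->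
  (\int[leb]_x (tensor (bumps k a b) x * w x)%:E +
    \int[N]_x (tensor (bumps k a b) x * 1)%:E @[k --> \oo] -->
  \int[leb]_(x in box a b) (w x)%:E + N (box a b))%E.
Proof.
move=> mw w0; apply: cvgeD.
- by apply: ge0_adde_def; rewrite inE ?measure_ge0 ?integral_ge0// => x _; rewrite lee_fin.
- exact: cvg_integral_bumps.
have -> : (N (box a b) = \int[N]_(x in box a b) 1%:E)%E.
  by rewrite integral_cst ?mul1e//; exact: measurable_box.
exact: cvg_integral_bumps.
Qed.

Let m12_box a b : m1 (box a b) = m2 (box a b).
Proof.
pose s1 k : \bar R := (\int[leb]_x (tensor (bumps k a b) x * gp x)%:E +
  \int[slide_measure j h nn]_x (tensor (bumps k a b) x * 1)%:E)%E.
pose s2 k : \bar R := (\int[leb]_x (tensor (bumps k a b) x * gn x)%:E +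
  \int[slide_measure j h np]_x (tensor (bumps k a b) x * 1)%:E)%E.
have c1 : s1 k @[k --> \oo] --> m1 (box a b) by exact: balance_cvg.
have c2 : s2 k @[k --> \oo] --> m2 (box a b) by exact: balance_cvg.
have E : s1 = s2 by apply/funext => k; exact: bumps_balance.
rewrite E in c1; rewrite -(cvg_lim _ c1)//; exact/cvg_lim.
Qed.

Let slide_fin (N : {finite_measure set 'rV[R]_n -> \bar R}) A :
  measurable A -> (slide_measure j h N A <= h%:E * N setT)%E.
Proof.
by move=> mA; rewrite -(slide_measureT j h0); apply: le_measure; rewrite ?inE.
Qed.

Let m1_box_fin k : (m1 (box (fun=> (- k.+1%:R)%R) (fun=> k.+1%:R)) < +oo)%E.
Proof.
have mb := @measurable_box R n (fun=> (- k.+1%:R)%R) (fun=> k.+1%:R).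
rewrite /m1 /= /density_plus; apply: lte_add_pinfty.
  apply: le_lt_trans (loc_g k.+1%:R mgp gp_le); apply: le_trans.
    apply: (@ge0_subset_integral _ _ _ leb _ (cube k.+1%:R)) => //.
    - exact: measurable_cube.
    - exact: measurable_funTS.
    - by move=> x H i; have /andP[/ltW -> /ltW ->] := H i.
  rewrite (eq_integral (fun x => `|gp x|%:E))// => x _.
  by rewrite /= ger0_norm.
apply: le_lt_trans (slide_fin nn mb) _; rewrite lte_mul_pinfty// ?lee_fin ?(ltW h0)//.
by rewrite ltey_eq fin_num_measure.
Qed.

(** Equality on boxes extends by uniqueness of measures: boxes are stable under intersection,
    generate the sigma-algebra, and those centred at 0 exhaust the space with finite mass. *)
Let m12 A : measurable A -> m1 A = m2 A.
Proof.
apply: (@measure_unique _ _ _ (@boxes R n)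
  (fun k => box (fun=> (- k.+1%:R)%R) (fun=> k.+1%:R))).
- exact: measurable_boxesE.
- exact: setI_closed_boxes.
- by move=> k; exists (fun=> (- k.+1%:R)%R, fun=> k.+1%:R).
- exact: bigcup_boxesT.
- by move=> _ [[a b] _ <-]; exact: m12_box.
- exact: m1_box_fin.
Qed.

(** On the set where g >= 0 the density of [m2] vanishes, so equality of the measures bounds the
    integral of g there by the mass of the slid np, at most h np(R^n). On the complement the roles
    are exchanged. *)
Lemma translation_coord :
  (\int[leb]_x `|g x|%:E <= h%:E * (np setT + nn setT))%E.
Proof.
pose E := [set x | 0 <= g x].
have mE : measurable E.
  rewrite (_ : E = g @^-1` `[0, +oo[%classic).
    by rewrite -[X in measurable X]setTI; exact: mg.
  by apply/seteqP; split => x /=; rewrite in_itv/= andbT.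
have mabs : measurable_fun setT (fun x => `|g x|%:E).
  by apply/measurable_EFinP; exact: measurableT_comp.
have mnE : measurable (~` E) by exact: measurableC.
rewrite -[X in integral _ X](setUv E) ge0_integral_setU//; last 2 first.
- by rewrite setUv.
- by apply/disj_setPS; rewrite setICr.
rewrite muleDr ?ge0_adde_def ?inE ?measure_ge0//.
have pE : (\int[leb]_(x in E) `|g x|%:E <= h%:E * np setT)%E.
  apply: le_trans (slide_fin np mE).
  have := m12 mE; rewrite /m1 /m2 /= /density_plus.
  rewrite [X in (_ = X + _)%E -> _](_ : _ = 0%E); last first.
    rewrite (eq_integral (cst 0%E)) ?integral0// => x /[!inE] Ex.
    by rewrite /= /gn max_r// oppr_le0.
  rewrite add0e => <-; rewrite [leLHS](eq_integral (EFin \o gp)).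
    by rewrite leeDl.
  move=> x /[!inE] Ex.
  by rewrite /= /gp max_l// ger0_norm.
have nE : (\int[leb]_(x in ~` E) `|g x|%:E <= h%:E * nn setT)%E.
  apply: le_trans (slide_fin nn mnE).
  have := m12 mnE; rewrite /m1 /m2 /= /density_plus.
  rewrite [X in (X + _ = _)%E -> _](_ : _ = 0%E); last first.
    rewrite (eq_integral (cst 0%E)) ?integral0// => x /[!inE]/= /negP; rewrite -ltNge => /ltW Ex.
    by rewrite /= /gp max_r.
  rewrite add0e => ->; rewrite [leLHS](eq_integral (EFin \o gn)).
    by rewrite leeDl.
  move=> x /[!inE]/= /negP.
  by rewrite -ltNge => /ltW Ex; rewrite /= /gn max_l ?oppr_ge0// ler0_norm.
exact: leeD.
Qed.

End one_direction.
End translation_estimate.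

(** * Increments of complex functions of bounded variation in L^1 *)

Section bv_translation.
Context {R : realType} (n : nat).
Local Notation leb := (@lebesgue_rV R n).
Local Notation e j := (delta_mx ord0 j : 'rV[R]_n).

(** Exposes the Hahn decomposition chosen inside [charge_integral], so that the two Jordan parts can
    serve as np and nn. *)
Lemma charge_integralE (nu : {charge set 'rV[R]_n -> \bar R}) :
  exists P N (hPN : hahn_decomposition nu P N), forall phi,
    charge_integral nu phi =
    \int[jordan_pos hPN]_x phi x - \int[jordan_neg hPN]_x phi x.
Proof.
rewrite /charge_integral; case: cid => P hP; case: cid => N hPN.
by exists P, N, hPN.
Qed.

Lemma normc_ge_absRe (z : R[i]) : `|complex.Re z| <= Normc.normc z.
Proof.
case: z => a b /=; rewrite -sqrtr_sqr; apply: ler_wsqrtr.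
by rewrite lerDl sqr_ge0.
Qed.

Lemma normc_ge_absIm (z : R[i]) : `|complex.Im z| <= Normc.normc z.
Proof.
case: z => a b /=; rewrite -sqrtr_sqr; apply: ler_wsqrtr.
by rewrite lerDr sqr_ge0.
Qed.

Lemma normc_le_ReIm (z : R[i]) :
  Normc.normc z <= `|complex.Re z| + `|complex.Im z|.
Proof.
case: z => a b /=; rewrite -[leRHS]ger0_norm ?addr_ge0// -sqrtr_sqr.
apply: ler_wsqrtr; rewrite sqrrD !real_normK ?num_real//.
by rewrite addrAC lerDl mulrn_wge0// mulr_ge0.
Qed.

Lemma cenorm_ge_coord m (v : 'rV[R[i]]_m) j : Normc.normc (v ord0 j) <= cenorm v.
Proof.
have nn : 0 <= Normc.normc (v ord0 j) by exact: le_trans (normr_ge0 _) (normc_ge_absRe _).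
rewrite -[leLHS]ger0_norm// -sqrtr_sqr; apply: ler_wsqrtr.
by rewrite (bigD1 j)//= lerDl sumr_ge0// => i _; exact: sqr_ge0.
Qed.

(** The partition into P, N and empty sets is a competitor in the supremum defining the total
    variation. The Jordan parts have masses q(P) and -q(N), and q is dominated by the vector measure
    on each set. *)
Lemma jordan_le_total_variation (nu : vector_charge n) (q : {charge set 'rV[R]_n -> \bar R})
    (V : R) P N (hPN : hahn_decomposition q P N) :
  (forall A, `|fine (q A)| <= cenorm (vector_charge_val nu A)) ->
  (Defs.total_variation nu <= V%:E)%E ->
  (jordan_pos hPN setT + jordan_neg hPN setT <= V%:E)%E.
Proof.
move=> qnu; apply: le_trans; have [[mP posP] [mN negN] PN PN0] := hPN.
pose E k := match k with 0%N => P | 1%N => N | _ => set0 end.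
apply: (@le_trans _ _ (\sum_(k <oo) (cenorm (vector_charge_val nu (E k)))%:E)%E); last first.
  apply: ereal_sup_ubound; exists E => //; split.
  - by case=> [|[|k]]//=.
  - apply/trivIsetP => -[|[|k]] [|[|l]] _ _ //= _; rewrite ?setI0 ?set0I//.
    by rewrite setIC.
  - rewrite -PN; apply/seteqP; split => x.
      by move=> [[|[|k]]] _ //= Ex; [left|right].
    by move=> [Px|Nx]; [exists 0%N|exists 1%N].
have cn0 k : (0 <= (cenorm (vector_charge_val nu (E k)))%:E)%E by rewrite lee_fin sqrtr_ge0.
apply: (@le_trans _ _ (\sum_(0 <= k < 2) (cenorm (vector_charge_val nu (E k)))%:E)%E); last first.
  exact: nneseries_lim_ge.
have qE A : measurable A -> q A = (fine (q A))%:E by move=> mA; rewrite fineK// fin_num_measure.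
rewrite big_nat_recr//= big_nat1 jordan_posE jordan_negE cjordan_posE cjordan_negE.
rewrite /crestr0 mem_set// /crestr !setTI.
apply: leeD.
  apply: le_trans (_ : (`|fine (q P)|%:E <= _)%E); last by rewrite lee_fin.
  by rewrite {1}(qE _ mP) lee_fin ler_norm.
apply: le_trans (_ : (`|fine (q N)|%:E <= _)%E); last by rewrite lee_fin.
by rewrite {1}(qE _ mN) -EFinN lee_fin -normrN ler_norm.
Qed.

Section real_valued.
Variables (u : 'rV[R]_n -> R) (V : R).
Hypothesis mu_ : measurable_fun setT u.
Hypothesis loc_u : forall M, (\int[leb]_(x in cube M) `|u x|%:E < +oo)%E.
Hypothesis grad_u : forall j, exists np nn : {finite_measure set 'rV[R]_n -> \bar R},
  (np setT + nn setT <= V%:E)%E /\ forall phi, test_function phi ->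
    \int[leb]_x (partial j phi x * u x) = - (\int[np]_x phi x - \int[nn]_x phi x).

Let mut a : measurable_fun setT (fun x : 'rV[R]_n => `|u (x + a) - u x|%:E).
Proof.
apply/measurable_EFinP; apply: measurableT_comp => //; apply: measurable_funB => //.
exact: measurableT_comp mu_ (measurable_rVD _).
Qed.

Lemma translation_dir j (h : R) :
  (\int[leb]_x `|u (x + h *: e j) - u x|%:E <= (V * `|h|)%:E)%E.
Proof.
wlog h0 : h / 0 < h.
  move=> H; have [hpos|hneg|<-] := ltrgtP 0 h; first exact: H.
    have := H (- h); rewrite oppr_gt0 hneg normrN => /(_ isT); apply: le_trans.
    rewrite -(ge0_integral_rV_translation (- h *: e j) (mut (h *: e j))) => [|x//].
    rewrite le_eqVlt; apply/orP; left; apply/eqP; apply: eq_integral => x _.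
    by rewrite -addrA -scalerDl addNr scale0r addr0 distrC.
  rewrite normr0 mulr0 (eq_integral (cst 0%E)) ?integral0// => x _.
  by rewrite scale0r addr0 subrr normr0.
have [np [nn [npV H]]] := grad_u j.
apply: le_trans (translation_coord h0 mu_ loc_u H) _.
by rewrite mulrC EFinM ger0_norm ?(ltW h0)// lee_wpmul2l// lee_fin ltW.
Qed.

(** The path from x to x + h follows the coordinate axes one after another; translation invariance
    lets each step start from a displaced point, and the l^1 norm of h results. *)
Lemma translation_real (h : 'rV[R]_n) :
  (\int[leb]_x `|u (x + h) - u x|%:E <= (V * \sum_j `|h ord0 j|)%:E)%E.
Proof.
rewrite [in leLHS](row_sum_delta h); elim: (index_enum _) => [|j s IH].
  rewrite !big_nil mulr0 (eq_integral (cst 0%E)) ?integral0// => x _.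
  by rewrite addr0 subrr normr0.
rewrite !big_cons mulrDr EFinD; set a := \sum_(j <- s) _ in IH *.
apply: le_trans (leeD (translation_dir j (h ord0 j)) IH).
rewrite -(ge0_integral_rV_translation a (mut (h ord0 j *: e j))) => [|x//].
rewrite -ge0_integralD//; last first.
  exact: (measurableT_comp (mut _) (measurable_rVD a)).
apply: ge0_le_integral => //.
- by apply: emeasurable_funD => //; exact: (measurableT_comp (mut _) (measurable_rVD a)).
- move=> x _; rewrite -EFinD lee_fin.
  rewrite (_ : u (x + (h ord0 j *: e j + a)) - u x =
    (u (x + a + h ord0 j *: e j) - u (x + a)) + (u (x + a) - u x)); last first.
    by rewrite subrKA -[x + a + _]addrA (addrC a).
  exact: ler_normD.
Qed.

End real_valued.

Lemma measurable_sqrt : measurable_fun setT (@Num.sqrt R).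
Proof. by apply: continuous_measurable_fun; exact: sqrt_continuous. Qed.

Lemma measurable_normc d (T : measurableType d) (f : T -> R[i]) :
  cmeasurable_fun setT f -> measurable_fun setT (fun x => Normc.normc (f x)).
Proof.
move=> [mRe mIm].
rewrite (_ : (fun x => _) =
    (fun x => Num.sqrt (complex.Re (f x) ^+ 2 + complex.Im (f x) ^+ 2))).
  apply: measurableT_comp; first exact: measurable_sqrt.
  by apply: measurable_funD; exact: measurable_funX.
by apply/funext => x; case: (f x).
Qed.

Lemma ReB (z w : R[i]) : complex.Re (z - w) = complex.Re z - complex.Re w.
Proof. by case: z w => [a b] [c e]. Qed.

Lemma ImB (z w : R[i]) : complex.Im (z - w) = complex.Im z - complex.Im w.
Proof. by case: z w => [a b] [c e]. Qed.

Lemma cmeasurable_diff (f : 'rV[R]_n -> R[i]) (h : 'rV[R]_n) :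
  cmeasurable_fun setT f -> cmeasurable_fun setT (fun x : 'rV[R]_n => f (x + h) - f x).
Proof.
move=> [mRe mIm]; split.
  under eq_fun do rewrite ReB; apply: measurable_funB => //.
  exact: (measurableT_comp mRe (measurable_rVD h)).
under eq_fun do rewrite ImB; apply: measurable_funB => //.
exact: (measurableT_comp mIm (measurable_rVD h)).
Qed.

(** The factor 2 comes from treating real and imaginary parts separately, each of variation at most
    V in every direction. *)
Lemma BV_translation (f : 'rV[R]_n -> R[i]) (nu : vector_charge n) (V : R) :
  locally_integrable_rV f -> distr_gradient f nu ->
  (Defs.total_variation nu <= V%:E)%E -> forall h : 'rV[R]_n,
  (\int[leb]_x (Normc.normc (f (x + h) - f x))%:E <=
   (2 * V * \sum_j `|h ord0 j|)%:E)%E.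
Proof.
move=> [[mRe mIm] loc_f] Df nuV h.
have mN : measurable_fun setT (fun x => Normc.normc (f x)) by exact: measurable_normc.
have loc (P : R[i] -> R) : measurable_fun setT (P \o f) ->
    (forall z, `|P z| <= Normc.normc z) ->
    forall M, (\int[leb]_(x in cube M) `|P (f x)|%:E < +oo)%E.
  move=> mP Pn M; apply: le_lt_trans (loc_f _ (@compact_cube R n M)).
  apply: ge0_le_integral => //; first exact: measurable_cube.
  - by apply/measurable_EFinP/measurable_funTS; exact: measurableT_comp.
  - by apply/measurable_EFinP/measurable_funTS.
  - by move=> x _; rewrite lee_fin.
have hRe := @translation_real (fun x => complex.Re (f x)) V mRe
  (loc (@complex.Re R) mRe normc_ge_absRe) _ h.
have hIm := @translation_real (fun x => complex.Im (f x)) V mIm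
  (loc (@complex.Im R) mIm normc_ge_absIm) _ h.
rewrite -mulrA mulr2n mulrDl !mul1r EFinD.
apply: le_trans (leeD (hRe _) (hIm _)); last 2 first.
- move=> j; have [P [N [hPN qE]]] := charge_integralE (nu j).1.
  exists (jordan_pos hPN), (jordan_neg hPN); split.
    apply: (jordan_le_total_variation hPN _ nuV) => A.
    have := cenorm_ge_coord (vector_charge_val nu A) j; apply: le_trans.
    by rewrite mxE; exact: (normc_ge_absRe (fine ((nu j).1 A) +i* fine ((nu j).2 A))%C).
  move=> phi tphi; rewrite -qE; have /(congr1 (@complex.Re R))/= := Df phi tphi j.
  move=> <-; congr fine; apply: eq_integral => x _; congr EFin.
  by case: (f x) => a b /=; rewrite mul0r subr0.
- move=> j; have [P [N [hPN qE]]] := charge_integralE (nu j).2.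
  exists (jordan_pos hPN), (jordan_neg hPN); split.
    apply: (jordan_le_total_variation hPN _ nuV) => A.
    have := cenorm_ge_coord (vector_charge_val nu A) j; apply: le_trans.
    by rewrite mxE; exact: (normc_ge_absIm (fine ((nu j).1 A) +i* fine ((nu j).2 A))%C).
  move=> phi tphi; rewrite -qE; have /(congr1 (@complex.Im R))/= := Df phi tphi j.
  move=> <-; congr fine; apply: eq_integral => x _; congr EFin.
  by case: (f x) => a b /=; rewrite mul0r addr0.
have [mR mI] := cmeasurable_diff h (conj mRe mIm).
have mR' : measurable_fun setT (fun x : 'rV[R]_n => `|complex.Re (f (x + h)) - complex.Re (f x)|%:E).
  by apply/measurable_EFinP; under eq_fun do rewrite -ReB; exact: measurableT_comp.
have mI' : measurable_fun setT (fun x : 'rV[R]_n => `|complex.Im (f (x + h)) - complex.Im (f x)|%:E).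
  by apply/measurable_EFinP; under eq_fun do rewrite -ImB; exact: measurableT_comp.
rewrite -ge0_integralD//; apply: ge0_le_integral => //.
- by move=> x _; rewrite lee_fin; exact: le_trans (normr_ge0 _) (normc_ge_absRe _).
- by apply/measurable_EFinP/measurable_normc.
- exact: emeasurable_funD.
- by move=> x _; rewrite -EFinD lee_fin -ReB -ImB normc_le_ReIm.
Qed.
End bv_translation.

(** * Level decomposition of weighted averages of increments *)

Section weighted_increments.
Context {R : realType} (n : nat).
Hypothesis n0 : (0 < n)%N.
Local Notation mu := (@lebesgue_measure R).
Local Notation leb := (@lebesgue_rV R n).
Local Notation X := 'rV[R]_n.

(** For D <= rho^2 the factor D^(e/2) is at most rho^e; otherwise D^(-1/4) is at most rho^(-1/2).
    The first kernel decays fast enough to be integrated against |h|, the second is still integrable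
    against a bounded function. *)
Lemma powR_split (D rho e : R) : 0 < D -> 0 < rho -> 0 < e ->
  D `^ (- (n%:R + 1) / 2) <= rho `^ e * D `^ (- (n%:R + (1 + e)) / 2) +
    rho `^ (- 2^-1) * D `^ (- (n%:R + 2^-1) / 2).
Proof.
move=> D0 r0 e0; have D_0 : D != 0 by rewrite gt_eqF.
have [Dr|rD] := leP D (rho ^+ 2).
  rewrite ler_wpDr ?mulr_ge0 ?powR_ge0//.
  rewrite (_ : - (n%:R + 1) / 2 = e / 2 + (- (n%:R + (1 + e)) / 2)); last by field.
  rewrite powRD ?D_0 ?implybT// ler_wpM2r ?powR_ge0//.
  rewrite (_ : rho `^ e = (rho ^+ 2) `^ (e / 2)); last first.
    by rewrite -powR_mulrn ?(ltW r0)// -powRrM mulrC mulfVK.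
  by apply: ge0_ler_powR; rewrite ?nnegrE ?(ltW D0) ?sqr_ge0// divr_ge0// ltW.
rewrite ler_wpDl ?mulr_ge0 ?powR_ge0//.
rewrite (_ : - (n%:R + 1) / 2 = - 2^-1 / 2 + (- (n%:R + 2^-1) / 2)); last by field.
rewrite powRD ?D_0 ?implybT// ler_wpM2r ?powR_ge0//.
rewrite (_ : rho `^ (- 2^-1) = (rho ^+ 2) `^ (- 2^-1 / 2)); last first.
  by rewrite -powR_mulrn ?(ltW r0)// -powRrM mulrC mulfVK.
by apply: ler_powR_neg; rewrite ?exprn_gt0 ?(ltW rD)// mulNr oppr_le0 divr_ge0.
Qed.

(** With a = 1 and H the size of the increments of f, a multiple of it dominates the gradient of the
    Poisson extension; the other values of a come from [powR_split]. *)
Definition wincr (a : R) (H : X * X -> R) (z : X * measurableTypeR R) : \bar R :=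
  (\int[leb]_h (ksq z.2 h `^ (- (n%:R + a) / 2) * H (z.1, h))%:E)%E.

Section one_H.
Variable H : X * X -> R.
Hypotheses (mH : measurable_fun setT H) (H0 : forall p, 0 <= H p).

Let mHx x : measurable_fun setT (fun h => H (x, h)).
Proof. exact: (measurableT_comp mH (pair1_measurable x)). Qed.

Lemma wincr_ge0 a z : (0 <= wincr a H z)%E.
Proof. by apply: integral_ge0 => h _; rewrite lee_fin mulr_ge0 ?powR_ge0. Qed.

Let mwH a : measurable_fun [set: (X * measurableTypeR R) * X]
  (fun q => (ksq q.1.2 q.2 `^ (- (n%:R + a) / 2) * H (q.1.1, q.2))%:E).
Proof.
apply/measurable_EFinP; apply: measurable_funM.
  have m2 : measurable_fun [set: (X * measurableTypeR R) * X] (fun q => (q.1.2, q.2)).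
    apply/measurable_fun_pairP; split => //=.
      exact: (measurableT_comp measurable_snd measurable_fst).
    exact: measurable_snd.
  exact: (measurableT_comp (@measurable_ksq_powR R n _) m2).
have m1 : measurable_fun [set: (X * measurableTypeR R) * X] (fun q => (q.1.1, q.2)).
  apply/measurable_fun_pairP; split => //=.
    exact: (measurableT_comp measurable_fst measurable_fst).
  exact: measurable_snd.
exact: (measurableT_comp mH m1).
Qed.

Lemma measurable_wincr a : measurable_fun setT (wincr a H).
Proof.
have := @measurable_fun_fubini_tonelli_F _ _ _ _ R leb _ (mwH a).
by apply => q; rewrite lee_fin mulr_ge0 ?powR_ge0.
Qed.

Lemma wincr_le_bound (a M t : R) (x : X) : 0 < a -> 0 < t -> 0 <= M ->
  {ae leb, forall h, H (x, h) <= M} ->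
  (wincr a H (x, t) <= (M * ksq_cst n a * t `^ (- a))%:E)%E.
Proof.
move=> a0 t0 M0 HM; rewrite -mulrA EFinM.
apply: (@le_trans _ _ (M%:E * \int[leb]_h (ksq t h `^ (- (n%:R + a) / 2))%:E)%E); last first.
  by apply: lee_wpmul2l; rewrite ?lee_fin//; exact: integral_ksq_powR.
have mk : measurable_fun setT (fun h : X => (ksq t h `^ (- (n%:R + a) / 2))%:E).
  by apply/measurable_EFinP; exact: measurable_ksq_powR2.
rewrite -ge0_integralZl//; last by move=> h _; rewrite lee_fin powR_ge0.
apply: ae_ge0_le_integral => //.
- by move=> h _; rewrite lee_fin mulr_ge0 ?powR_ge0.
- apply/measurable_EFinP; apply: measurable_funM => //.
  exact: measurable_ksq_powR2.
- by move=> h _; rewrite -EFinM lee_fin mulr_ge0 ?powR_ge0.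
- exact: measurable_funeM.
apply: filterS HM => h HM _; rewrite -EFinM lee_fin mulrC ler_wpM2r ?powR_ge0//.
Qed.

Lemma wincr_split (rho e t : R) (x : X) : 0 < rho -> 0 < e -> 0 < t ->
  (wincr 1 H (x, t) <= (rho `^ e)%:E * wincr (1 + e) H (x, t) +
     (rho `^ (- 2^-1))%:E * wincr 2^-1 H (x, t))%E.
Proof.
move=> r0 e0 t0.
have mk a : measurable_fun setT (fun h : X => (ksq t h `^ (- (n%:R + a) / 2) * H (x, h))%:E).
  by apply/measurable_EFinP; apply: measurable_funM => //; exact: measurable_ksq_powR2.
have k0 a h : (0 <= (ksq t h `^ (- (n%:R + a) / 2) * H (x, h))%:E)%E.
  by rewrite lee_fin mulr_ge0 ?powR_ge0.
rewrite /wincr/= -!ge0_integralZl//; [|exact: powR_ge0|exact: powR_ge0].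
rewrite -ge0_integralD//; first last.
- exact: measurable_funeM.
- by move=> h _; rewrite mule_ge0// lee_fin powR_ge0.
- exact: measurable_funeM.
- by move=> h _; rewrite mule_ge0// lee_fin powR_ge0.
apply: ge0_le_integral => //.
- by apply: emeasurable_funD; exact: measurable_funeM.
- move=> h _; rewrite -!EFinM -EFinD lee_fin !mulrA -mulrDl ler_wpM2r//.
  by apply: powR_split => //; exact: ksq_gt0.
Qed.

(** Tonelli puts the x-integral inside, where the L^1 bound on increments applies. Each |h_j| is at
    most D^(1/2), which uses up the 1 in the exponent and leaves a kernel that is integrable because
    e > 0; the n coordinates give the factor n. *)
Lemma integral_wincr (e V t : R) : 0 < e -> 0 <= V -> 0 < t ->
  (forall h, \int[leb]_x (H (x, h))%:E <= (V * \sum_j `|h ord0 j|)%:E)%E ->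
  (\int[leb]_x wincr (1 + e) H (x, t) <= (V * (n%:R * ksq_cst n e) * t `^ (- e))%:E)%E.
Proof.
move=> e0 V0 t0 HV.
have mk : measurable_fun [set: X * X] (fun q => (ksq t q.2 `^ (- (n%:R + (1 + e)) / 2) * H q)%:E).
  apply/measurable_EFinP; apply: measurable_funM => //.
  exact: (measurableT_comp (@measurable_ksq_powR2 R n _ t) measurable_snd).
have k0 q : (0 <= (ksq t q.2 `^ (- (n%:R + (1 + e)) / 2) * H q)%:E)%E.
  by rewrite lee_fin mulr_ge0 ?powR_ge0.
have -> : (\int[leb]_x wincr (1 + e) H (x, t) =
    \int[leb]_h \int[leb]_x (ksq t h `^ (- (n%:R + (1 + e)) / 2) * H (x, h))%:E)%E.
  exact: etrans (esym (@fubini_tonelli1 _ _ _ _ R leb leb _ mk k0))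
    (@fubini_tonelli2 _ _ _ _ R leb leb _ mk k0).
apply: (@le_trans _ _ (\int[leb]_h ((V * n%:R)%:E * (ksq t h `^ (- (n%:R + e) / 2))%:E))%E).
  apply: ge0_le_integral => //.
  - by move=> h _; apply: integral_ge0 => x _; exact: (k0 (x, h)).
  - exact: (@measurable_fun_fubini_tonelli_G _ _ _ _ R leb _ mk k0).
  - apply: measurable_funeM; apply/measurable_EFinP; exact: measurable_ksq_powR2.
  - move=> h _; under eq_integral do rewrite EFinM.
    rewrite ge0_integralZl//; last 3 first.
    + by apply/measurable_EFinP; exact: (measurableT_comp mH (pair2_measurable h)).
    + by move=> x _; rewrite lee_fin.
    + by rewrite lee_fin powR_ge0.
    apply: le_trans (lee_wpmul2l _ (HV h)) _; first by rewrite lee_fin powR_ge0.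
    rewrite -!EFinM lee_fin mulrCA -mulrA ler_wpM2l//.
    rewrite (_ : - (n%:R + e) / 2 = - (n%:R + (1 + e)) / 2 + 2^-1); last by field.
    rewrite powRD ?(gt_eqF (ksq_gt0 h t0)) ?implybT// mulrCA ler_wpM2l ?powR_ge0//.
    apply: (@le_trans _ _ (\sum_(j < n) ksq t h `^ 2^-1)); last first.
      by rewrite sumr_const card_ord mulr_natl.
    apply: ler_sum => j _; rewrite powR12_sqrt ?(ltW (ksq_gt0 h t0))//.
    rewrite -sqrtr_sqr ler_wsqrtr// (le_trans _ (coord_le_ksq t h j))//.
    by rewrite lerDl sqr_ge0.
rewrite ge0_integralZl//; last 3 first.
- by apply/measurable_EFinP; exact: measurable_ksq_powR2.
- by move=> h _; rewrite lee_fin powR_ge0.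
- by rewrite lee_fin mulr_ge0.
rewrite (_ : V * _ * _ = V * n%:R * (ksq_cst n e * t `^ (- e))); last by ring.
rewrite [leRHS]EFinM; apply: lee_wpmul2l; rewrite ?lee_fin ?mulr_ge0//.
exact: integral_ksq_powR.
Qed.

End one_H.
End weighted_increments.

(** * The bound tau + G for increments at one scale *)

Section level_decomposition.
Context {R : realType} (n : nat).
Hypothesis n0 : (0 < n)%N.
Local Notation mu := (@lebesgue_measure R).
Local Notation leb := (@lebesgue_rV R n).
Local Notation X := 'rV[R]_n.
Local Notation half := (X * measurableTypeR R)%type.
Local Notation kappa := (leb \x mu)%E.

Lemma powRD_gt0 (t a b : R) : 0 < t -> t `^ (a + b) = t `^ a * t `^ b.
Proof. by move=> t0; rewrite powRD ?(gt_eqF t0) ?implybT. Qed.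

Variables (p b gamma : R).
Hypotheses (p1 : 1 < p) (b0 : b != 0) (bp : gamma + 1 = b * p).

(** Any e with 0 < 2e < p - 1 would serve. The complementary c = p - 1 - 2e is the exponent for
    [integral_powR_sublevel], and Q^(2e) Q^c = Q^(p-1). *)
Let e := (p - 1) / 4.
Let c := (p - 1) / 2.
Let e0 : 0 < e. Proof. by rewrite divr_gt0// subr_gt0. Qed.
Let c0 : 0 < c. Proof. by rewrite divr_gt0// subr_gt0. Qed.

(** Dominates both kernel constants, for a = 1 when t^b >= Q and for a = 1/2 when t^b < Q; the last
    1 makes it positive. *)
Let C1 := ksq_cst n 2^-1 + ksq_cst n 1 + 1 :> R.
Let C1_gt0 : 0 < C1.
Proof. by rewrite ltr_wpDl// addr_ge0// ksq_cst_ge0. Qed.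

Definition level_cst : R := n%:R * ksq_cst n e * C1 `^ (p - 1) / (`|b| * c).

Lemma level_cst_ge0 : 0 <= level_cst.
Proof.
have ec := ksq_cst_ge0 n (ltW e0); have cc := ltW c0.
exact: divr_ge0 (mulr_ge0 (mulr_ge0 (ler0n _ _) ec) (powR_ge0 _ _)) (mulr_ge0 (normr_ge0 b) cc).
Qed.

(** The density of lambda_gamma with respect to dx dt. *)
Definition dens (z : half) : \bar R := (((z.2 `^ (1 - gamma))^-1)%R)%:E.

Lemma dens_ge0 z : (0 <= dens z)%E.
Proof. by rewrite lee_fin invr_ge0 powR_ge0. Qed.

Lemma measurable_dens : measurable_fun setT dens.
Proof.
apply/measurable_EFinP; under eq_fun do rewrite -powRN.
by apply: (measurableT_comp (measurable_powR _)).
Qed.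

Section one_level.
Variables (H : X * X -> R) (M V tau : R).
Hypotheses (mH : measurable_fun setT H) (H0 : forall q, 0 <= H q).
Hypotheses (M0 : 0 < M) (V0 : 0 <= V) (tau0 : 0 < tau).
Hypothesis HM : {ae leb, forall x, {ae leb, forall h, H (x, h) <= M}}.
Hypothesis HV : forall h,
  (\int[leb]_x (H (x, h))%:E <= (V * \sum_j `|h ord0 j|)%:E)%E.

Let Q := C1 * M / tau.
Let Q0 : 0 < Q. Proof. by rewrite divr_gt0// mulr_gt0. Qed.

(* The first term of [wincr_split] at rho = t (Q t^-b)^2, for which the second one is
   at most tau. *)
Let coef (t : measurableTypeR R) : R :=
  if (0 < t) && (t `^ b < Q) then Q `^ (2 * e) * t `^ (1 - b + e - 2 * b * e) else 0.

Let coef_ge0 t : 0 <= coef t.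
Proof. by rewrite /coef; case: ifP => // _; rewrite mulr_ge0 ?powR_ge0. Qed.

Let mcoef : measurable_fun setT coef.
Proof.
apply: measurable_fun_ifT => //.
  apply: measurable_and; apply: measurable_fun_ltr => //; exact: measurable_powR.
by apply: measurable_funM => //; exact: measurable_powR.
Qed.

Let G (z : half) : \bar R := ((coef z.2)%:E * wincr (1 + e) H z)%E.

Let G0 z : (0 <= G z)%E.
Proof. by rewrite mule_ge0 ?lee_fin ?coef_ge0 ?wincr_ge0. Qed.

Let mG : measurable_fun setT G.
Proof.
apply: emeasurable_funM; last exact: measurable_wincr.
by apply/measurable_EFinP; exact: (measurableT_comp mcoef measurable_snd).
Qed.

(** If t^b >= Q, the bound M alone gives a multiple of M t^(-b), at most tau. If t^b < Q, split at
    rho: the powers of t in the second term cancel, leaving a multiple of M / Q that is at most tau,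
    and the first term is exactly G. *)
Let level_pointwise x t : {ae leb, forall h, H (x, h) <= M} -> 0 < t ->
  ((t `^ (1 - b))%:E * wincr 1 H (x, t) <= tau%:E + G (x, t))%E.
Proof.
move=> Hx t0; have tn0 : t != 0 by rewrite gt_eqF.
have tb0 a : 0 < t `^ a by rewrite powR_gt0.
have MC a : ksq_cst n a <= C1 -> M * ksq_cst n a / Q <= tau.
  move=> aC; rewrite ler_pdivrMr// (_ : tau * Q = M * C1).
    by rewrite ler_wpM2l// ltW.
  by rewrite /Q; field; rewrite gt_eqF.
have [tQ|tQ] := ltP (t `^ b) Q; last first.
  rewrite (@le_trans _ _ tau%:E)//; last by rewrite leeDl.
  apply: le_trans (lee_wpmul2l _ (wincr_le_bound n0 mH H0 ltr01 t0 (ltW M0) Hx)) _.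
    by rewrite lee_fin powR_ge0.
  rewrite -EFinM lee_fin mulrCA -powRD_gt0//.
  rewrite (_ : 1 - b + -1 = - b) ?powRN; last by ring.
  apply: le_trans (MC 1 _); last by rewrite /C1 -addrA addrCA lerDl addr_ge0 ?ksq_cst_ge0.
  rewrite ler_wpM2l ?mulr_ge0 ?ksq_cst_ge0 ?(ltW M0)//.
  by rewrite lef_pV2 ?posrE.
pose rho := t * (Q / t `^ b) ^+ 2.
have q0 : 0 < Q / t `^ b by rewrite divr_gt0.
have r0 : 0 < rho by rewrite mulr_gt0// exprn_gt0.
apply: le_trans (lee_wpmul2l _ (wincr_split mH H0 x r0 e0 t0)) _.
  by rewrite lee_fin powR_ge0.
rewrite ge0_muleDr ?mule_ge0 ?wincr_ge0 ?lee_fin ?powR_ge0// addrC.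
apply: leeD.
  rewrite muleA -EFinM.
  apply: le_trans (lee_wpmul2l _ (wincr_le_bound n0 mH H0 _ t0 (ltW M0) Hx)) _ => //.
    by rewrite lee_fin mulr_ge0 ?powR_ge0.
  rewrite -EFinM lee_fin; apply: le_trans (MC 2^-1 _); last first.
    by rewrite /C1 -addrA lerDl addr_ge0 ?ksq_cst_ge0.
  rewrite le_eqVlt; apply/orP; left; apply/eqP.
  have -> : rho `^ (- 2^-1) = t `^ (- 2^-1) * (t `^ b / Q).
    rewrite /rho powRM ?(ltW t0) ?sqr_ge0//; congr (_ * _).
    rewrite -powR_mulrn ?(ltW q0)// -powRrM mulrN divff ?pnatr_eq0//.
    by rewrite powR_inv1 ?(ltW q0)// invf_div.
  rewrite (_ : t `^ (1 - b) * _ * _ = M * ksq_cst n 2^-1 / Q *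
    (t `^ (1 - b) * t `^ (- 2^-1) * t `^ b * t `^ (- 2^-1))); last by ring.
  rewrite -!powRD_gt0// (_ : 1 - b - 2^-1 + b - 2^-1 = 0) ?powRr0 ?mulr1//.
  by field.
rewrite /G /coef t0 tQ/= muleA -EFinM le_eqVlt; apply/orP; left; apply/eqP.
congr (_%:E * _)%E.
rewrite /rho powRM ?(ltW t0) ?sqr_ge0// -powR_mulrn ?(ltW q0)// -powRrM.
rewrite powRM ?(ltW Q0) ?invr_ge0 ?powR_ge0// mulrCA; rewrite mulrA mulrCA; congr (_ * _).
rewrite -powR_inv1 ?powR_ge0// -!powRrM -!powRD_gt0//; congr (_ `^ _).
by ring.
Qed.

(** Integrating in x first gives V t^(-e) up to a constant. Together with [dens] and [coef], and
    since gamma = b p - 1, the powers of t combine to t^(b c - 1) on the set where t^b < Q. *)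
Let level_integral :
  (\int[kappa]_(z in @halfspace R n) (dens z * G z) <=
   (level_cst * V * M `^ (p - 1) * tau `^ (1 - p))%:E)%E.
Proof.
(* [coef] vanishes for t <= 0, so the integral may be taken over the whole product and Tonelli
   applied. *)
have -> : (\int[kappa]_(z in @halfspace R n) (dens z * G z) =
    \int[kappa]_z (dens z * G z))%E.
  rewrite integral_mkcond; apply: eq_integral => -[x t] _; rewrite patchE.
  case: ifPn => // /negP; rewrite inE /halfspace/= => /negP/negbTE t0.
  by rewrite /G /coef t0/= mul0e mule0.
have mF : measurable_fun setT (fun z => dens z * G z)%E.
  by apply: emeasurable_funM => //; exact: measurable_dens.
have F0 z : (0 <= dens z * G z)%E by rewrite mule_ge0 ?dens_ge0.
rewrite (@fubini_tonelli2 _ _ _ _ R leb mu _ mF F0).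
pose S := [set t : measurableTypeR R | 0 < t /\ t `^ b < Q].
pose K := V * (n%:R * ksq_cst n e) * Q `^ (2 * e).
have K0 : 0 <= K.
  by have ec := ksq_cst_ge0 n (ltW e0); exact: mulr_ge0 (mulr_ge0 V0 (mulr_ge0 (ler0n _ _) ec)) (powR_ge0 _ _).
have mS : measurable S.
  rewrite (_ : S = `]0, +oo[%classic `&` ((fun t => t `^ b) @^-1` `]-oo, Q[%classic)).
    apply: measurableI => //; rewrite -[X in measurable X]setTI.
    exact: measurable_powR.
  by apply/seteqP; split => x/=; rewrite !in_itv/= ?andbT.
pose g := fun t : measurableTypeR R => (t `^ (b * c - 1))%:E.
have mg : measurable_fun setT g by apply/measurable_EFinP; exact: measurable_powR.
have g0 t : (0 <= g t)%E by rewrite lee_fin powR_ge0.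
apply: (@le_trans _ _ (K%:E * \int[mu]_(t in S) g t)%E); last first.
  apply: le_trans (lee_wpmul2l _ (integral_powR_sublevel b0 c0 Q0)) _ => //.
  rewrite -EFinM lee_fin /K /level_cst.
  (* This is Q = C1 M / tau raised to the power p - 1 = 2e + c. *)
  have -> : M `^ (p - 1) = Q `^ (2 * e) * Q `^ c / (C1 `^ (p - 1) * tau `^ (1 - p)).
    rewrite -powRD_gt0// (_ : 2 * e + c = p - 1); last by rewrite /e /c; field.
    rewrite /Q powRM ?mulr_ge0 ?invr_ge0 ?(ltW C1_gt0) ?(ltW M0) ?(ltW tau0)//.
    rewrite powRM ?(ltW C1_gt0) ?(ltW M0)// -powR_inv1 ?(ltW tau0)// -powRrM.
    rewrite (_ : -1 * (p - 1) = 1 - p); last by ring.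
    by field; rewrite !gt_eqF ?powR_gt0.
  have Ct : C1 `^ (p - 1) * tau `^ (1 - p) != 0 by rewrite mulf_neq0// gt_eqF// powR_gt0.
  have bc : `|b| * c != 0 by rewrite mulf_neq0 ?normr_eq0// gt_eqF.
  move: Ct bc; move: (C1 `^ _) (tau `^ _) (Q `^ _) (Q `^ _) (ksq_cst _ _) (`|b| * c) => y1 y2 y3 y4 y5 y6.
  rewrite mulf_eq0 negb_or => /andP[y10 y20] y60.
  by rewrite le_eqVlt; apply/orP; left; apply/eqP; field; rewrite y10 y20 y60.
rewrite -ge0_integralZl//; last by exact: measurable_funTS.
rewrite integral_mkcond; apply: ge0_le_integral => //.
- by move=> t _; apply: integral_ge0.
- exact: (@measurable_fun_fubini_tonelli_G _ _ _ _ R leb _ mF F0).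
- apply/(measurable_restrictT _ mS); apply: measurable_funeM; exact: measurable_funTS.
move=> t _; rewrite patchE /fubini_G.
have [tS|tS] := boolP (t \in S); last first.
  rewrite (eq_integral (cst 0%E)) ?integral0// => x _.
  rewrite /G /coef ifF ?mul0e ?mule0//=; apply/negbTE/negP => /andP[t1 t2].
  by move/negP: tS; apply; rewrite inE.
move: tS; rewrite inE => -[t0 tQ].
rewrite (eq_integral (fun x => ((t `^ (gamma - 1)) * coef t)%:E * wincr (1 + e) H (x, t))%E); last first.
  by move=> x _; rewrite /G /dens/= muleA -EFinM -powRN opprB.
rewrite ge0_integralZl//; last 3 first.
- exact: (measurableT_comp (measurable_wincr mH H0 (1 + e)) (pair2_measurable t)).
- by move=> x _; exact: wincr_ge0.
- by rewrite lee_fin mulr_ge0 ?powR_ge0.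
apply: le_trans (lee_wpmul2l _ (integral_wincr n0 mH H0 e0 V0 t0 HV)) _.
  by rewrite lee_fin mulr_ge0 ?powR_ge0.
rewrite -EFinM lee_fin /coef t0 tQ/= /K /g.
rewrite (_ : b * c - 1 = gamma - 1 + (1 - b + e - 2 * b * e) + - e); last first.
  by rewrite (_ : gamma = b * p - 1) /e /c; [field|rewrite -bp addrK].
rewrite !powRD_gt0// le_eqVlt; apply/orP; left; apply/eqP.
by ring.
Qed.

Lemma level_decomposition : exists G' : half -> \bar R,
  [/\ measurable_fun setT G', (forall z, 0 <= G' z)%E,
    {ae leb, forall x, forall t, 0 < t ->
      ((t `^ (1 - b))%:E * wincr 1 H (x, t) <= tau%:E + G' (x, t))%E} &
    (\int[kappa]_(z in @halfspace R n) (dens z * G' z) <=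
     (level_cst * V * M `^ (p - 1) * tau `^ (1 - p))%:E)%E].
Proof.
exists G; split => //; move: HM; apply: filterS => x Hx t t0.
exact: level_pointwise.
Qed.

End one_level.
End level_decomposition.

(** * Summation over the scales *)

Section level_series.
Context {R : realType} (n : nat).
Hypothesis n0 : (0 < n)%N.
Local Notation mu := (@lebesgue_measure R).
Local Notation leb := (@lebesgue_rV R n).
Local Notation X := 'rV[R]_n.
Local Notation half := (X * measurableTypeR R)%type.
Local Notation kappa := (leb \x mu)%E.
Variables (p b gamma : R).
Hypotheses (p1 : 1 < p) (b0 : b != 0) (bp : gamma + 1 = b * p).

Lemma wincr_series (a t : R) (x : X) (H : X * X -> R) (Hk : nat -> X * X -> R) :
  measurable_fun setT H -> (forall q, 0 <= H q) ->
  (forall k, measurable_fun setT (Hk k)) -> (forall k q, 0 <= Hk k q) ->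
  {ae leb, forall h, (H (x, h))%:E <= \sum_(k <oo) (Hk k (x, h))%:E}%E ->
  (wincr a H (x, t) <= \sum_(k <oo) wincr a (Hk k) (x, t))%E.
Proof.
move=> mH H0 mHk Hk0 HH.
have mk K : measurable_fun setT K -> measurable_fun setT
    (fun h : X => (ksq t h `^ (- (n%:R + a) / 2) * K (x, h))%:E).
  move=> mK; apply/measurable_EFinP; apply: measurable_funM.
    exact: measurable_ksq_powR2.
  exact: (measurableT_comp mK (pair1_measurable x)).
rewrite -[leRHS]integral_nneseries//; last 2 first.
- by move=> k; exact: mk.
- by move=> k h _; rewrite lee_fin mulr_ge0 ?powR_ge0.
apply: ae_ge0_le_integral => //.
- by move=> h _; rewrite lee_fin mulr_ge0 ?powR_ge0.
- exact: mk.
- by move=> h _; apply: nneseries_ge0 => k _ _; rewrite lee_fin mulr_ge0 ?powR_ge0.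
- apply: ge0_emeasurable_sum => [k h _ _|k _]; last exact: mk.
  by rewrite lee_fin mulr_ge0 ?powR_ge0.
move: HH; apply: filterS => h hh _.
under eq_eseriesr do rewrite EFinM.
rewrite nneseriesZl; last by move=> k _; rewrite lee_fin.
by rewrite EFinM; apply: lee_wpmul2l => //; rewrite lee_fin powR_ge0.
Qed.

(** The height lambda is distributed as tau_k = lambda a_k / A, with sum at most lambda. The k-th
    integral is then a constant times B (lambda / A)^(1-p) a_k, again summable to A. *)
Lemma level_series (H : X * X -> R) (Hk : nat -> X * X -> R) (M V a : nat -> R)
    (A B lambda : R) :
  measurable_fun setT H -> (forall q, 0 <= H q) ->
  (forall k, measurable_fun setT (Hk k)) -> (forall k q, 0 <= Hk k q) ->
  (forall k, 0 < M k) -> (forall k, 0 <= V k) -> (forall k, 0 < a k) ->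
  0 < A -> 0 <= B -> 0 < lambda ->
  (forall k, {ae leb, forall x, {ae leb, forall h, Hk k (x, h) <= M k}}) ->
  (forall k h, \int[leb]_x (Hk k (x, h))%:E <= (V k * \sum_j `|h ord0 j|)%:E)%E ->
  (forall k, V k * M k `^ (p - 1) <= B * a k `^ p) ->
  (\sum_(k <oo) (a k)%:E <= A%:E)%E ->
  {ae leb, forall x,
    {ae leb, forall h, (H (x, h))%:E <= \sum_(k <oo) (Hk k (x, h))%:E}%E} ->
  exists G : half -> \bar R,
  [/\ measurable_fun setT G, (forall z, 0 <= G z)%E,
    {ae leb, forall x, forall t, 0 < t ->
      ((t `^ (1 - b))%:E * wincr 1 H (x, t) <= lambda%:E + G (x, t))%E} &
    (\int[kappa]_(z in @halfspace R n) (dens gamma z * G z) <=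
     (level_cst n p b * B * A `^ p * lambda `^ (1 - p))%:E)%E].
Proof.
move=> mH H0 mHk Hk0 M0 V0 a0 A0 B0 l0 HM HV VM aA HH.
pose tau k := lambda / A * a k.
have tau0 k : 0 < tau k by rewrite mulr_gt0// divr_gt0.
have G_ k := level_decomposition n0 p1 b0 bp (mHk k) (Hk0 k) (M0 k) (V0 k) (tau0 k)
  (HM k) (HV k).
pose G k := sval (cid (G_ k)).
have mG k : measurable_fun setT (G k) by have [] := svalP (cid (G_ k)).
have G0 k z : (0 <= G k z)%E by have [_ + _ _] := svalP (cid (G_ k)); apply.
have Gae : {ae leb, forall x, forall k t, 0 < t ->
    ((t `^ (1 - b))%:E * wincr 1 (Hk k) (x, t) <= (tau k)%:E + G k (x, t))%E}.
  by apply/ae_foralln => k; have [_ _ + _] := svalP (cid (G_ k)).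
have Gint k : (\int[kappa]_(z in @halfspace R n) (dens gamma z * G k z) <=
    (level_cst n p b * V k * M k `^ (p - 1) * tau k `^ (1 - p))%:E)%E.
  by have [_ _ _ +] := svalP (cid (G_ k)).
exists (fun z => \sum_(k <oo) G k z)%E; split.
- by apply: ge0_emeasurable_sum => // k z _ _.
- by move=> z; apply: nneseries_ge0.
- move: HH; apply: filterS2 Gae => x Gx Hx t t0.
  apply: le_trans (lee_wpmul2l _ (wincr_series 1 t mH H0 mHk Hk0 Hx)) _.
    by rewrite lee_fin powR_ge0.
  rewrite -nneseriesZl; last by move=> k _; exact: wincr_ge0.
  apply: (@le_trans _ _ (\sum_(k <oo) ((tau k)%:E + G k (x, t)))%E).
    apply: lee_nneseries => [k _ _|k _]; last exact: Gx.
    by rewrite mule_ge0 ?wincr_ge0// lee_fin powR_ge0.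
  rewrite nneseriesD; last 2 first.
  + by move=> k _ _; rewrite lee_fin ltW.
  + by move=> k _ _.
  apply: leeD => //; under eq_eseriesr do rewrite /tau EFinM.
  rewrite nneseriesZl; last by move=> k _; rewrite lee_fin ltW.
  apply: le_trans (lee_wpmul2l _ aA) _; first by rewrite lee_fin ltW// divr_gt0.
  by rewrite -EFinM lee_fin divfK// gt_eqF.
- have mhs : measurable (@halfspace R n) by exact: measurable_halfspace.
  rewrite (eq_integral (fun z => \sum_(k <oo) (dens gamma z * G k z))%E); last first.
    by move=> z _; rewrite nneseriesZl// => k _.
  rewrite integral_nneseries//; last 2 first.
  + move=> k; apply: measurable_funTS; apply: emeasurable_funM => //.
    exact: measurable_dens.
  + by move=> k z _; rewrite mule_ge0 ?dens_ge0.
  pose K := level_cst n p b * B * lambda `^ (1 - p) * A `^ (p - 1).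
  have lc0 : 0 <= level_cst n p b by exact: level_cst_ge0.
  have K0 : 0 <= K by exact: mulr_ge0 (mulr_ge0 (mulr_ge0 lc0 B0) (powR_ge0 _ _)) (powR_ge0 _ _).
  apply: (@le_trans _ _ (\sum_(k <oo) (K%:E * (a k)%:E))%E).
    apply: lee_nneseries => [k _ _|k _].
      by apply: integral_ge0 => z _; rewrite mule_ge0 ?dens_ge0.
    apply: le_trans (Gint k) _; rewrite -EFinM lee_fin.
    apply: (@le_trans _ _ (level_cst n p b * (B * a k `^ p) * tau k `^ (1 - p))).
      by rewrite ler_wpM2r ?powR_ge0// -mulrA ler_wpM2l.
    rewrite le_eqVlt; apply/orP; left; apply/eqP.
    have ak := a0 k; rewrite /tau /K powRM ?(ltW ak) ?divr_ge0 ?(ltW l0) ?(ltW A0)//.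
    rewrite powRM ?invr_ge0 ?(ltW l0) ?(ltW A0)// -(powR_inv1 (ltW A0)) -powRrM.
    rewrite (_ : -1 * (1 - p) = p - 1); last by ring.
    have ak1 : a k `^ p * a k `^ (1 - p) = a k.
      by rewrite -powRD_gt0// addrCA subrr addr0 powRr1// ltW.
    rewrite -[in RHS]ak1; ring.
  rewrite nneseriesZl; last by move=> k _; rewrite lee_fin ltW.
  apply: le_trans (lee_wpmul2l _ aA) _; first by rewrite lee_fin.
  rewrite -EFinM lee_fin /K le_eqVlt; apply/orP; left; apply/eqP.
  have -> : A `^ p = A `^ (p - 1) * A.
    by rewrite -[X in _ * X](powRr1 (ltW A0)) -powRD_gt0// subrK.
  by ring.
Qed.

End level_series.

(** * The gradient of the Poisson extension *)

Section poisson_gradient.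
Context {R : realType} (n : nat).
Local Notation mu := (@lebesgue_measure R).
Local Notation leb := (@lebesgue_rV R n).
Local Notation X := 'rV[R]_n.
Local Notation half := (X * measurableTypeR R)%type.

Definition incr (f : X -> R[i]) (q : X * X) : R := Normc.normc (f (q.1 + q.2) - f q.1).

Lemma incr_ge0 f q : 0 <= incr f q.
Proof. by rewrite /incr; case: (_ - _) => a b; exact: sqrtr_ge0. Qed.

Lemma cmeasurable_comp d (T : measurableType d) (f : X -> R[i]) (g : T -> X) :
  cmeasurable_fun setT f -> measurable_fun setT g ->
  cmeasurable_fun setT (fun z => f (g z)).
Proof.
by move=> [mR mI] mg; split; [exact: (measurableT_comp mR mg)|exact: (measurableT_comp mI mg)].
Qed.

Lemma cmeasurableB d (T : measurableType d) (f g : T -> R[i]) :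
  cmeasurable_fun setT f -> cmeasurable_fun setT g ->
  cmeasurable_fun setT (fun z => f z - g z).
Proof.
move=> [fR fI] [gR gI]; split.
  by under eq_fun do rewrite ReB; exact: measurable_funB.
by under eq_fun do rewrite ImB; exact: measurable_funB.
Qed.

Lemma measurable_addX : measurable_fun [set: X * X] (fun q => q.1 + q.2).
Proof.
apply: measurable_fun_rV => i; under eq_fun do rewrite mxE.
apply: measurable_funD; apply: (measurableT_comp (@measurable_rV_coord R n i)).
  exact: measurable_fst.
exact: measurable_snd.
Qed.

Lemma measurable_incr f : cmeasurable_fun setT f -> measurable_fun setT (incr f).
Proof.
move=> mf; apply: measurable_normc; apply: cmeasurableB.
  exact: (cmeasurable_comp mf measurable_addX).
exact: (cmeasurable_comp mf measurable_fst).
Qed.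

Lemma ksq_opp t (x y : X) : enorm (x - y) ^+ 2 + t ^+ 2 = ksq t (y - x).
Proof.
rewrite -/(ksq t (x - y)) !ksqE; congr (_ + _); apply: eq_bigr => j _.
by rewrite !mxE -sqrrN opprB.
Qed.

Definition kernel_factor (j : 'I_(n + 1)) (q : half * X) : R :=
  match fintype.split j with
  | inl i => (n.+1%:R * q.1.2) * (q.2 ord0 i - q.1.1 ord0 i)
  | inr _ => \sum_(i < n) (q.2 - q.1.1) ord0 i ^+ 2 - n%:R * q.1.2 ^+ 2
  end.

Lemma grad_poisson_kernelE (j : 'I_(n + 1)) (q : half * X) :
  grad_poisson_kernel q.1 q.2 ord0 j =
  (ksq q.1.2 (q.2 - q.1.1) `^ (n.+3%:R / 2))^-1 * kernel_factor j q.
Proof.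
case: q => [[x t] y]; rewrite /= /kernel_factor !mxE ksq_opp; congr (_ * _).
case: (fintype.split j) => i; rewrite !mxE//= ?ord1 ?eqxx ?mulr1n.
by have := ksq_opp t x y; rewrite ksqE => /addIr ->.
Qed.

Lemma kernel_factor_le (j : 'I_(n + 1)) (q : half * X) : 0 < q.1.2 ->
  `|kernel_factor j q| <= n.+1%:R * ksq q.1.2 (q.2 - q.1.1).
Proof.
case: q => [[x t] y]/= t0; rewrite /kernel_factor/=; case: (fintype.split j) => i.
  rewrite normrM normrM ger0_norm// -mulrA ler_wpM2l//.
  apply: le_trans (coord_le_ksq t (y - x) i); rewrite !mxE.
  move: (y ord0 i - x ord0 i) => s; rewrite (ger0_norm (ltW t0)).
  have s2 : s ^+ 2 = `|s| ^+ 2 by rewrite real_normK ?num_real.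
  rewrite s2; have := sqr_ge0 (`|s| - t); have := normr_ge0 s; nra.
rewrite ksqE; set S := \sum_(_ < _) _.
have S0 : 0 <= S by apply: sumr_ge0 => k _; exact: sqr_ge0.
have t20 := sqr_ge0 t; have nn : (0 : R) <= n%:R by [].
by rewrite ler_norml -natr1; apply/andP; split; nra.
Qed.

(** Each numerator is quadratic in (h, t), hence at most (n + 1) D, and cancels one power of D out
    of (n + 3)/2. *)
Lemma grad_kernel_le (j : 'I_(n + 1)) (q : half * X) : 0 < q.1.2 ->
  `|grad_poisson_kernel q.1 q.2 ord0 j| <=
  n.+1%:R * ksq q.1.2 (q.2 - q.1.1) `^ (- (n%:R + 1) / 2).
Proof.
move=> t0; have D0 := ksq_gt0 (q.2 - q.1.1) t0.
rewrite grad_poisson_kernelE normrM ger0_norm ?invr_ge0 ?powR_ge0// -powRN.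
rewrite (_ : - (n.+3%:R / 2) = - (n%:R + 1) / 2 + -1); last first.
  by rewrite (_ : n.+3%:R = n%:R + 3) -?natrD ?addn3//; field.
rewrite powRD_gt0// (powR_inv1 (ltW D0)) -mulrA [leRHS]mulrC ler_wpM2l ?powR_ge0//.
by rewrite mulrC ler_pdivrMr// kernel_factor_le.
Qed.

Lemma measurable_grad_kernel (j : 'I_(n + 1)) :
  measurable_fun [set: half * X] (fun q => grad_poisson_kernel q.1 q.2 ord0 j).
Proof.
under eq_fun do rewrite grad_poisson_kernelE -powRN.
have mt : measurable_fun [set: half * X] (fun q => q.1.2 : R).
  exact: (measurableT_comp measurable_snd measurable_fst).
have md : measurable_fun [set: half * X] (fun q => q.2 - q.1.1).
  apply: measurable_fun_rV => i; under eq_fun do rewrite !mxE.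
  apply: measurable_funB; apply: (measurableT_comp (@measurable_rV_coord R n i)).
    exact: measurable_snd.
  exact: (measurableT_comp measurable_fst measurable_fst).
apply: measurable_funM.
  have m2 : measurable_fun [set: half * X] (fun q => (q.1.2, q.2 - q.1.1)).
    by apply/measurable_fun_pairP; split.
  exact: (measurableT_comp (@measurable_ksq_powR R n _) m2).
rewrite /kernel_factor; case: (fintype.split j) => i.
  apply: measurable_funM; first exact: measurable_funM.
  apply: measurable_funB; apply: (measurableT_comp (@measurable_rV_coord R n i)).
    exact: measurable_snd.
  exact: (measurableT_comp measurable_fst measurable_fst).
apply: measurable_funB; last by apply: measurable_funM => //; exact: measurable_funX.
apply: measurable_sum => k; apply: measurable_funX.
exact: (measurableT_comp (@measurable_rV_coord R n k) md).
Qed.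

Lemma Rintegral_abs_le d (T : measurableType d) (m : {measure set T -> \bar R})
    (f : T -> R) : measurable_fun setT f ->
  (`|\int[m]_x f x|%:E <= \int[m]_x `|f x|%:E)%E.
Proof.
move=> mf; have mE : measurable_fun setT (EFin \o f) by exact/measurable_EFinP.
apply: le_trans (le_abse_integral m measurableT mE); rewrite /Rintegral.
(* The real integral is [fine] of the extended one, hence 0 when that is infinite; the bound
   therefore holds for every measurable f. *)
have H (I : \bar R) : (`|fine I|%:E <= `|I|)%E.
  by case: I => [r||] //=; rewrite normr0 leey.
exact: H.
Qed.

Lemma measurable_Rintegral d (T : measurableType d) (F : T * X -> R) :
  measurable_fun setT F -> measurable_fun setT (fun z => \int[leb]_y F (z, y)).
Proof.
move=> mF; have mE : measurable_fun setT (EFin \o F) by exact/measurable_EFinP.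
apply: (measurableT_comp (fine_measurable measurableT)).
under eq_fun do rewrite integralE; apply: emeasurable_funB.
  have := @measurable_fun_fubini_tonelli_F _ _ _ _ R leb _ (measurable_funepos mE)
    (funepos_ge0 _).
  congr measurable_fun; apply/funext => z; apply: eq_integral => y _.
  by rewrite !funeposE.
have := @measurable_fun_fubini_tonelli_F _ _ _ _ R leb _ (measurable_funeneg mE)
  (funeneg_ge0 _).
congr measurable_fun; apply/funext => z; apply: eq_integral => y _.
by rewrite !funenegE.
Qed.

Lemma normc_real (r : R) : Normc.normc (r%:C)%C = `|r|.
Proof. by rewrite /= expr0n addr0 sqrtr_sqr. Qed.

Section function.
Variable f : X -> R[i].
Hypothesis mf : cmeasurable_fun setT f.

Let term (j : 'I_(n + 1)) (q : half * X) : R[i] :=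
  (grad_poisson_kernel q.1 q.2 ord0 j)%:C%C * (f q.2 - f q.1.1).

Let mterm j : cmeasurable_fun setT (term j).
Proof.
have [mR mI] : cmeasurable_fun [set: half * X] (fun q => f q.2 - f q.1.1).
  apply: cmeasurableB; first exact: (cmeasurable_comp mf measurable_snd).
  apply: (cmeasurable_comp mf).
  exact: (measurableT_comp measurable_fst measurable_fst).
have mk := measurable_grad_kernel j; split.
  rewrite (_ : (fun q => _) = (fun q : half * X => grad_poisson_kernel q.1 q.2 ord0 j *
    complex.Re (f q.2 - f q.1.1))); first exact: measurable_funM.
  by apply/funext => q; rewrite /term; case: (_ - _) => a c /=; rewrite mul0r subr0.
rewrite (_ : (fun q => _) = (fun q : half * X => grad_poisson_kernel q.1 q.2 ord0 j *
  complex.Im (f q.2 - f q.1.1))); first exact: measurable_funM.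
by apply/funext => q; rewrite /term; case: (_ - _) => a c /=; rewrite mul0r addr0.
Qed.

Lemma cmeasurable_Kop b j :
  cmeasurable_fun setT (fun z => Kop b f z ord0 j).
Proof.
have [mR mI] := mterm j.
pose Re z := \int[leb]_y complex.Re (term j (z, y)).
pose Im z := \int[leb]_y complex.Im (term j (z, y)).
have KE z : Kop b f z ord0 j =
    (z.2 `^ (1 - b) * (@poisson_cst R n * Re z) +i* (z.2 `^ (1 - b) * (@poisson_cst R n * Im z)))%C.
  rewrite /Kop /grad_poisson !mxE /cintegral -/(Re z) -/(Im z); simpc.
  by [].
have mt : measurable_fun [set: half] (fun z => z.2 `^ (1 - b)).
  exact: (measurableT_comp (measurable_powR _) measurable_snd).
split.
  under eq_fun do rewrite KE/=; apply: measurable_funM => //.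
  by apply: measurable_funM => //; exact: measurable_Rintegral mR.
under eq_fun do rewrite KE/=; apply: measurable_funM => //.
by apply: measurable_funM => //; exact: measurable_Rintegral mI.
Qed.

(** After the substitution y = x + h the kernel bound produces [wincr]. Real and imaginary parts are
    estimated separately, whence the factor 2. *)
Lemma normc_Kop_le b z j : 0 < z.2 ->
  ((Normc.normc (Kop b f z ord0 j))%:E <=
   (2 * `| @poisson_cst R n| * n.+1%:R * z.2 `^ (1 - b))%:E * wincr 1 (incr f) z)%E.
Proof.
case: z => x t /= t0; have [mR mI] := mterm j.
have nT q : Normc.normc (term j q) =
    `|grad_poisson_kernel q.1 q.2 ord0 j| * Normc.normc (f q.2 - f q.1.1).
  by rewrite /term Normc.normcM normc_real.
have mn : measurable_fun setT (fun q => Normc.normc (term j q)) by exact: measurable_normc.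
pose I := (\int[leb]_y (Normc.normc (term j ((x, t), y)))%:E)%E.
have mny : measurable_fun setT (fun y => (Normc.normc (term j ((x, t), y)))%:E).
  by apply/measurable_EFinP; exact: (measurableT_comp mn (pair1_measurable (x, t))).
have part (P : R[i] -> R) : (forall w, `|P w| <= Normc.normc w) ->
    measurable_fun setT (fun q => P (term j q)) ->
    (`|\int[leb]_y P (term j ((x, t), y))|%:E <= I)%E.
  move=> Pn mP.
  have mPy : measurable_fun setT (fun y => P (term j ((x, t), y))).
    exact: (measurableT_comp mP (pair1_measurable (x, t))).
  apply: le_trans (Rintegral_abs_le leb mPy) _; apply: ge0_le_integral => //.
  - by apply/measurable_EFinP; exact: measurableT_comp.
  - by move=> y _; rewrite lee_fin.
have IW : (I <= n.+1%:R%:E * wincr 1 (incr f) (x, t))%E.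
  rewrite /I -(ge0_integral_rV_translation x mny); last first.
    by move=> y; rewrite lee_fin; case: (term _ _) => a c; exact: sqrtr_ge0.
  rewrite /wincr -ge0_integralZl//=; last 2 first.
  - apply/measurable_EFinP; apply: measurable_funM; first exact: measurable_ksq_powR2.
    exact: (measurableT_comp (measurable_incr mf) (pair1_measurable x)).
  - by move=> h _; rewrite lee_fin mulr_ge0 ?powR_ge0 ?incr_ge0.
  apply: ge0_le_integral; first exact: measurableT.
  - by move=> y _; rewrite lee_fin; case: (term _ _) => a c; exact: sqrtr_ge0.
  - exact: (measurableT_comp mny (measurable_rVD x)).
  - apply: measurable_funeM; apply/measurable_EFinP; apply: measurable_funM.
      exact: measurable_ksq_powR2.
    exact: (measurableT_comp (measurable_incr mf) (pair1_measurable x)).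
  move=> h _; rewrite -EFinM lee_fin nT [X in _ <= X]mulrA.
  have -> : incr f (x, h) = Normc.normc (f (h + x) - f x) by rewrite /incr/= (addrC h x).
  apply: ler_wpM2r; first by case: (_ - _) => a c; exact: sqrtr_ge0.
  by have := @grad_kernel_le j ((x, t), h + x) t0; rewrite /= addrK.
apply: (@le_trans _ _ ((`| @poisson_cst R n| * t `^ (1 - b))%:E * (I + I))%E); last first.
  rewrite (_ : 2 * _ * _ * _ = `| @poisson_cst R n| * t `^ (1 - b) * (n.+1%:R + n.+1%:R)); last by ring.
  rewrite [in leRHS]EFinM -muleA; apply: lee_wpmul2l.
    by rewrite lee_fin mulr_ge0 ?powR_ge0.
  rewrite EFinD ge0_muleDl ?lee_fin//; exact: leeD.
rewrite /Kop /grad_poisson !mxE !Normc.normcM !normc_real/=.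
rewrite ger0_norm ?powR_ge0// mulrCA mulrA EFinM; apply: lee_wpmul2l.
  by rewrite lee_fin mulr_ge0 ?powR_ge0.
apply: (@le_trans _ _ (`|\int[leb]_y complex.Re (term j ((x, t), y))|%:E +
  `|\int[leb]_y complex.Im (term j ((x, t), y))|%:E)%E).
  rewrite -EFinD lee_fin.
  exact: (normc_le_ReIm (cintegral leb (fun y => term j ((x, t), y)))).
apply: leeD.
  by apply: (part (@complex.Re R)) => // w; exact: normc_ge_absRe.
by apply: (part (@complex.Im R)) => // w; exact: normc_ge_absIm.
Qed.

End function.
End poisson_gradient.

Lemma cenorm_le_sum {R : realType} n (v : 'rV[R[i]]_n) :
  cenorm v <= \sum_j Normc.normc (v ord0 j).
Proof.
have nn j : 0 <= Normc.normc (v ord0 j) by exact: le_trans (normr_ge0 _) (normc_ge_absRe _).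
have s0 : 0 <= \sum_j Normc.normc (v ord0 j) by exact: sumr_ge0.
rewrite -[leRHS]ger0_norm// -sqrtr_sqr; apply: ler_wsqrtr.
rewrite expr2 mulr_suml; apply: ler_sum => j _.
rewrite expr2; apply: ler_wpM2l => //.
by rewrite (bigD1 j)//= lerDl sumr_ge0.
Qed.

(** * Dyadic decompositions from the K-functional *)

Section dyadic_sum.
Context {R : realType}.
Local Notation mu := (@lebesgue_measure R).

(** Superlevel sets of a monotone function on an interval are intervals. The K-functional is
    measurable in t for this reason. *)
Lemma measurable_nondecreasing_ereal (D : set R) (K : R -> \bar R) :
  is_interval D -> (forall s t, D s -> D t -> s <= t -> (K s <= K t)%E) ->
  measurable_fun D K.
Proof.
move=> iD Kle mD.
apply: (measurability _ (ErealGenOInfty.measurableE R)) => // _ [_ [x ->] <-].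
apply: is_interval_measurable => s t [Ds Ks] [Dt Kt] z /andP[sz zt].
have Dz : D z by apply: (iD s t); rewrite ?sz.
split => //=; move: Ks => /=; rewrite !in_itv/= !andbT => Ks.
exact: lt_le_trans Ks (Kle _ _ _ _ _).
Qed.

(** On ]s, 2s], of length s, monotonicity of K bounds the integrand below by (2s)^(-1/p) K(s) /
    (2s). The loss 2^(-1-1/p) is more than 1/4 because p > 1, and disjointness lets the pieces be
    added. *)
Lemma dyadic_sum_le (p : R) (K : R -> \bar R) (s : nat -> R) : 1 < p ->
  (forall t : R, (0 < t)%R -> 0 <= K t)%E ->
  (forall u t, 0 < u -> u <= t -> (K u <= K t)%E) ->
  (forall k, 0 < s k) -> trivIset setT (fun k => `]s k, 2 * s k]%classic) ->
  (\sum_(k <oo) (s k `^ (- p^-1))%:E * K (s k) <=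
   4%:E * \int[mu]_(t in `]0%R, +oo[) ((t `^ (- p^-1))%:E * K t * (t^-1)%:E))%E.
Proof.
move=> p1 K0 Kle s0 ts.
pose D : set R := `]0%R, +oo[%classic.
have Dgt t : D t -> 0 < t by rewrite /D/= in_itv/= andbT.
pose F t := ((t `^ (- p^-1))%:E * K t * (t^-1)%:E)%E.
have F0 t : D t -> (0 <= F t)%E.
  move=> /Dgt t0; rewrite !mule_ge0// ?K0// lee_fin ?powR_ge0//.
  by rewrite invr_ge0 ltW.
have mF : measurable_fun D F.
  apply: emeasurable_funM; last first.
    apply/measurable_EFinP; apply: (eq_measurable_fun (fun t => t `^ (- 1))).
      by move=> t /[1!inE] /Dgt t0; rewrite powR_inv1// ltW.
    by apply: measurable_funTS; exact: measurable_powR.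
  apply: emeasurable_funM.
    by apply/measurable_EFinP; apply: measurable_funTS; exact: measurable_powR.
  apply: measurable_nondecreasing_ereal.
    by move=> u t /Dgt u0 _ z /andP[uz _]; rewrite /D/= in_itv/= andbT (lt_le_trans u0).
  by move=> u t /Dgt u0 _; exact: Kle.
pose I k : set R := `]s k, 2 * s k]%classic.
have ID : \bigcup_k I k `<=` D.
  move=> t [k _]; rewrite /I/= /D/= !in_itv/= andbT => /andP[+ _].
  exact: lt_trans.
have mI k : measurable (I k) by exact: measurable_itv.
have mUI : measurable (\bigcup_k I k) by exact: bigcupT_measurable.
apply: (@le_trans _ _ (4%:E * \int[mu]_(t in \bigcup_k I k) F t)%E); last first.
  by apply: lee_wpmul2l; [rewrite lee_fin|exact: ge0_subset_integral].
rewrite ge0_integral_bigcup//; last 2 first.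
- exact: measurable_funS (measurable_itv _) ID mF.
- by move=> t /ID; exact: F0.
rewrite -nneseriesZl; last first.
  by move=> k _; apply: integral_ge0 => t It; apply: F0; apply: ID; exists k.
apply: lee_nneseries => [k _ _|k _].
  by rewrite mule_ge0// ?K0// lee_fin powR_ge0.
pose c := ((2 * s k) `^ (- p^-1) * (2 * s k)^-1)%:E.
have sk2 : 0 < 2 * s k by rewrite mulr_gt0.
have c0 : (0 <= c)%E by rewrite lee_fin mulr_ge0 ?powR_ge0// invr_ge0 ltW.
apply: (@le_trans _ _ (4%:E * \int[mu]_(t in I k) (c * K (s k)))%E); last first.
  apply: lee_wpmul2l; first by rewrite lee_fin.
  apply: ge0_le_integral => //.
  - exact: measurable_itv.
  - by move=> t _; apply: mule_ge0 => //; exact: K0.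
  - apply: measurable_funS (measurable_itv _) _ mF => t It.
    by apply: ID; exists k.
  move=> t; rewrite /I/= in_itv/= => /andP[st t2].
  have t0 : 0 < t by exact: lt_trans st.
  rewrite /F muleAC -EFinM; apply: lee_pmul => //; first exact: K0.
    2: by apply: Kle => //; exact: ltW.
  rewrite lee_fin; apply: ler_pM; rewrite ?powR_ge0//.
  - by rewrite invr_ge0 ltW.
  - apply: ler_powR_neg => //; first by rewrite oppr_le0 invr_ge0; lra.
  - by rewrite lef_pV2// posrE.
have muI : mu (I k) = (s k)%:E.
  rewrite /I lebesgue_measure_itv/= lte_fin ltr_pMl// ltr1n -EFinB.
  by congr EFin; ring.
have -> : (\int[mu]_(t in I k) (c * K (s k)) = c * K (s k) * (s k)%:E)%E.
  rewrite -muI; apply: integral_cst; exact: measurable_itv.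
rewrite -muleA (muleC (K (s k))) !muleA -!EFinM; apply: lee_wpmul2r; first exact: K0.
rewrite lee_fin powRM ?(ltW (s0 k))// invfM.
have -> : 4 * (2 `^ (- p^-1) * s k `^ (- p^-1) * (2^-1 * (s k)^-1)) * s k =
    2 * (2 `^ (- p^-1)) * s k `^ (- p^-1) :> R by field; rewrite gt_eqF.
rewrite ler_peMl ?powR_ge0//.
rewrite -[leLHS](@mulfV _ 2)//; apply: ler_wpM2l => //.
rewrite -[leLHS]powR_inv1//; apply: ler_powR; first by rewrite ler1n.
by rewrite lerN2 invf_le1 ?ltW// (lt_trans _ p1).
Qed.

End dyadic_sum.

(** * Near-optimal splittings for the K-functional *)

Section peetre.
Context {R : realType} (n : nat).
Local Notation leb := (@lebesgue_rV R n).
Local Notation fct := ('rV[R]_n -> R[i]).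
Local Notation K := (peetreK (@Vinf R n) (@BV R n) (@Vinf_norm R n) (@BV_norm R n)).

Lemma Vinf_norm_ge0 (f : fct) : (0 <= Vinf_norm f)%E.
Proof. by apply: le_ereal_inf_tmp => _ [c _ <-]; exact: Lnorm_ge0. Qed.

Lemma total_variation_ge0 (nu : vector_charge n) : (0 <= Defs.total_variation (R := R) nu)%E.
Proof.
pose E k : set 'rV[R]_n := if k is 0%N then setT else set0.
apply: (@le_trans _ _ (\sum_(k <oo) (cenorm (vector_charge_val nu (E k)))%:E)%E).
  by apply: nneseries_ge0 => k _ _; rewrite lee_fin sqrtr_ge0.
apply: ereal_sup_ubound; exists E => //; split.
- by case => [|k]; [exact: measurableT|exact: measurable0].
- by apply/trivIsetP => -[|i] [|j] _ _ //= _; rewrite ?setI0 ?set0I.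
- by apply/seteqP; split => // x _; exists 0%N.
Qed.

Lemma BV_norm_ge0 (f : fct) : (0 <= BV_norm f)%E.
Proof. by apply: le_ereal_inf_tmp => _ [nu _ <-]; exact: total_variation_ge0. Qed.

Lemma peetreK_ge0 t (f : fct) : 0 <= t -> (0 <= K t f)%E.
Proof.
move=> t0; apply: le_ereal_inf_tmp => _ [g _ <-]; apply: adde_ge0.
  exact: Vinf_norm_ge0.
by apply: mule_ge0; [rewrite lee_fin|exact: BV_norm_ge0].
Qed.

Lemma le_peetreK s t (f : fct) : s <= t -> (K s f <= K t f)%E.
Proof.
move=> st; apply: le_ereal_inf_tmp => _ [g hg <-].
apply: (@le_trans _ _ (Vinf_norm g.1 + s%:E * BV_norm g.2)%E).
  by apply: ereal_inf_lbound; exists g.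
apply: leeD => //; apply: lee_wpmul2r; [exact: BV_norm_ge0|by rewrite lee_fin].
Qed.

Lemma Lnorm_oo_ae (g : 'rV[R]_n -> R) (m : R) :
  (Lnorm leb +oo%E (fun x => (g x)%:E) <= m%:E)%E ->
  {ae leb, forall x, `|g x| <= m}.
Proof.
rewrite unlock /=; case: ifPn => [_ /ess_supP|].
  by apply: filterS => x /=; rewrite lee_fin.
(* On a space of measure 0 the L^oo norm takes a default value, but there everything holds almost
   everywhere. *)
move=> leb0 _; exists setT; split => //.
by apply/eqP; rewrite eq_le measure_ge0 leNgt leb0.
Qed.

(** What is used of a decomposition that shows K(s, f) < m. The norms of f0 and f1 are infima; here
    they are replaced by witnesses, a constant c and a gradient measure nu. *)
Definition peetre_split (f f0 f1 : fct) (s m : R) :=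
  [/\ cmeasurable_fun setT f0, locally_integrable_rV f1,
      exists c, {ae leb, forall x, Normc.normc (f0 x - c) <= m},
      exists2 nu, distr_gradient f1 nu & (Defs.total_variation nu <= (m / s)%:E)%E &
      eq_mod_cst f (fun x => f0 x + f1 x)].

(** The strict inequality passes through the three infima in turn: over decompositions, over
    constants and over gradient measures. *)
Lemma peetre_split_ex (f : fct) (s m : R) : 0 < s -> (K s f < m%:E)%E ->
  exists f0 f1, peetre_split f f0 f1 s m.
Proof.
move=> s0 /ereal_inf_lt[_ [[f0 f1] /= [[mf0 _] [lf1 _] fE] <-]] Km.
have B0 := BV_norm_ge0 f1; have V0 := Vinf_norm_ge0 f0.
have sB0 : (0 <= s%:E * BV_norm f1)%E by rewrite mule_ge0// lee_fin ltW.
have Vm : (Vinf_norm f0 < m%:E)%E by apply: le_lt_trans Km; rewrite leeDl.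
have Bm : (BV_norm f1 < (m / s)%:E)%E.
  rewrite -(@lte_pmul2l _ s%:E)// -EFinM mulrCA mulfV ?gt_eqF// mulr1.
  by apply: le_lt_trans Km; rewrite leeDr.
exists f0, f1; split => //.
- have /ereal_inf_lt[_ [c _ <-] cm] := Vm; exists c.
  apply: filterS (Lnorm_oo_ae (ltW cm)) => x; exact: le_trans (ler_norm _).
- by have /ereal_inf_lt[_ [nu nuf <-] cm] := Bm; exists nu => //; exact: ltW.
Qed.

End peetre.

Section decomposition.
Context {R : realType} (n : nat).
Local Notation fct := ('rV[R]_n -> R[i]).
Local Notation K := (peetreK (@Vinf R n) (@BV R n) (@Vinf_norm R n) (@BV_norm R n)).

(** The common properties of the sequences 2^k and 2^-k. *)
Definition dyadic_family (s : nat -> R) :=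
  [/\ forall k, 0 < s k, trivIset setT (fun k => `]s k, 2 * s k]%classic) &
      forall k, Num.min (s k) (s k)^-1 = 2^-1 ^+ k].

Lemma Vinf_BV_norm1E p (f : fct) :
  Vinf_BV_norm p^-1 1 f = (\int[@lebesgue_measure R]_(t in `]0%R, +oo[)
    ((t `^ (- p^-1))%:E * K t f * (t^-1)%:E))%E.
Proof.
have F0 t : `]0%R, +oo[%classic t -> (0 <= (t `^ (- p^-1))%:E * K t f)%E.
  rewrite /= in_itv/= andbT => t0; apply: mule_ge0; first by rewrite lee_fin powR_ge0.
  by apply: peetreK_ge0; exact: ltW.
rewrite /Vinf_BV_norm /interp_norm invr1 poweRe1; last first.
  apply: integral_ge0 => t t0; rewrite poweRe1; last exact: F0.
  apply: mule_ge0; first exact: F0.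
  by move: t0; rewrite /= in_itv/= andbT lee_fin invr_ge0 => /ltW.
by apply: eq_integral => t /[1!inE] t0; rewrite poweRe1//; exact: F0.
Qed.

(** The splittings are functions of the scale, chosen before the family s: the increasing and the
    decreasing family then share their splitting at scale 1, where the two telescoping sums meet. *)
Lemma interp_decomposition (p A : R) (f : fct) : 1 < p ->
  (4%:E * Vinf_BV_norm p^-1 1 f < A%:E)%E ->
  exists f0 f1 : R -> fct, exists a : R -> R, forall s, dyadic_family s ->
    (forall k, 0 < a (s k) /\
      peetre_split f (f0 (s k)) (f1 (s k)) (s k) (s k `^ p^-1 * a (s k))) /\
    (\sum_(k <oo) (a (s k))%:E <= A%:E)%E.
Proof.
move=> p1 fA.
have N0 : (0 <= 4%:E * Vinf_BV_norm p^-1 1 f)%E.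
  by apply: mule_ge0; [rewrite lee_fin|rewrite /Vinf_BV_norm /interp_norm; exact: poweR_ge0].
have [S SE] : exists S : R, (4%:E * Vinf_BV_norm p^-1 1 f = S%:E)%E.
  by exists (fine (4%:E * Vinf_BV_norm p^-1 1 f)); rewrite fineK// ge0_fin_numE// (lt_trans fA) ?ltry.
have SA : S < A by rewrite -lte_fin -SE.
have d0 : 0 < A - S by rewrite subr_gt0.
(* The factor min(s, 1/s) makes the excess over K summable both for s = 2^k and
   for s = 2^-k, with a single choice at s = 1. *)
pose a s := s `^ (- p^-1) * fine (K s f) + (A - S) / 2 * Num.min s s^-1.
have /boolp.choice[g gP] : forall s, exists g : fct * fct,
    0 < s -> (K s f < +oo)%E -> peetre_split f g.1 g.2 s (s `^ p^-1 * a s).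
  move=> s; have [s0|s0] := ltP 0 s; last by exists (f, f).
  have [Ks|Ks] := ltP (K s f) +oo%E; last by exists (f, f).
  have Kfin : K s f \is a fin_num by rewrite ge0_fin_numE ?peetreK_ge0// ltW.
  have [|f0 [f1 h]] := @peetre_split_ex R n f s (s `^ p^-1 * a s) s0.
    rewrite -(fineK Kfin) lte_fin /a mulrDr mulrA -powRD; last by rewrite (gt_eqF s0) implybT.
    rewrite subrr powRr0 mul1r ltrDl mulr_gt0 ?powR_gt0//.
    by rewrite mulr_gt0 ?divr_gt0// lt_min s0 invr_gt0.
  by exists (f0, f1).
exists (fun s => (g s).1), (fun s => (g s).2), a => s [s0 ts ms].
have K0 k : (0 <= K (s k) f)%E by apply: peetreK_ge0; exact: ltW.
have KS : (\sum_(k <oo) (s k `^ (- p^-1))%:E * K (s k) f <= S%:E)%E.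
  rewrite -SE Vinf_BV_norm1E; apply: (@dyadic_sum_le R p (fun t => K t f) s p1) => //.
  - by move=> t t0; apply: peetreK_ge0; exact: ltW.
  - by move=> u t _; exact: le_peetreK.
(* An infinite value would make one term of the bounded series infinite; so [fine] in [a] loses
   nothing at the scales s k, and the default pairs (f, f) do not occur there. *)
have Koo k : (K (s k) f < +oo)%E.
  rewrite ltNge; apply/negP; rewrite leye_eq => /eqP Ke.
  have : ((s k `^ (- p^-1))%:E * K (s k) f <= S%:E)%E.
    have h j : (0 <= (s j `^ (- p^-1))%:E * K (s j) f)%E.
      by rewrite mule_ge0// lee_fin powR_ge0.
    apply: le_trans KS; apply: le_trans (nneseries_lim_ge k.+1 (fun j _ _ => h j)).
    by rewrite big_nat_recr//= leeDr// sume_ge0.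
  by rewrite Ke gt0_muley ?lte_fin ?powR_gt0.
split=> [k|].
  split; last exact: gP.
  rewrite ltr_wpDl//; first by rewrite mulr_ge0 ?powR_ge0 ?fine_ge0.
  by rewrite mulr_gt0 ?divr_gt0// ms exprn_gt0.
apply: (@le_trans _ _ (\sum_(k <oo) ((s k `^ (- p^-1))%:E * K (s k) f +
    ((A - S) / (2 ^ k.+1)%:R)%:E))%E).
  apply: lee_nneseries => [k _ _|k _].
    rewrite lee_fin addr_ge0//; first by rewrite mulr_ge0 ?powR_ge0 ?fine_ge0.
    by rewrite mulr_ge0 ?ms ?exprn_ge0// divr_ge0// ltW.
  rewrite -[X in (_ * X)%E]fineK ?ge0_fin_numE// -EFinM -EFinD lee_fin /a ms lerD2l.
  by rewrite natrX exprS invfM exprVn mulrA.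
rewrite nneseriesD; last 2 first.
- by move=> k _ _; rewrite mule_ge0// lee_fin powR_ge0.
- by move=> k _ _; rewrite lee_fin divr_ge0// ltW.
rewrite (_ : A%:E = S%:E + (A - S)%:E)%E; last by rewrite -EFinD subrKC.
by apply: leeD => //; apply: epsilon_trick0; exact: ltW.
Qed.

End decomposition.

(** * Exceptional null sets in x and in h *)

Section almost_everywhere.
Context {R : realType} (n : nat).
Local Notation leb := (@lebesgue_rV R n).
Local Notation X := 'rV[R]_n.

Lemma ae_translation (P : X -> Prop) : {ae leb, forall x, P x} ->
  forall x, {ae leb, forall h, P (x + h)}.
Proof.
move=> [B [mB B0 sub]] x; exists ((fun h => h + x) @^-1` B).
have mB' : measurable ((fun h => h + x) @^-1` B).
  by rewrite -[X in measurable X]setTI; exact: measurable_rVD.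
split => //.
  have m1 : measurable_fun setT (fun h : X => (\1_B h : R)%:E).
    by apply/measurable_EFinP; exact: measurable_indic.
  have l1 (A : set X) : measurable A -> (\int[leb]_h (\1_A h)%:E = leb A)%E.
    by move=> mA; rewrite integral_indic// setIT.
  rewrite -(l1 _ mB') -[RHS]B0 -(l1 _ mB).
  rewrite -(ge0_integral_rV_translation x m1); last by move=> h; rewrite lee_fin.
  by apply: eq_integral => h _; rewrite !indicE.
by move=> h /= Ph; apply: sub => /=; rewrite addrC.
Qed.

(** By Tonelli, null sections in one variable make E null for the product measure, hence almost all
    its sections in the other variable are null. *)
Lemma ae_ae_swap (E : set (X * X)) : measurable E ->
  (forall h, {ae leb, forall x, ~ E (x, h)}) ->
  {ae leb, forall x, {ae leb, forall h, ~ E (x, h)}}.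
Proof.
move=> mE E0.
pose f q : \bar R := (\1_E q)%:E.
have mf : measurable_fun setT f by apply/measurable_EFinP; exact: measurable_indic.
have f0 q : (0 <= f q)%E by rewrite lee_fin.
have z g : measurable_fun setT g -> (forall x : X, 0 <= g x)%E ->
    (\int[leb]_x g x = 0)%E <-> {ae leb, forall x, g x = 0%E}.
  move=> mg g0; have h := ae_eq_integral_abs leb measurableT mg.
  have e : (\int[leb]_x `|g x| = \int[leb]_x g x)%E.
    by apply: eq_integral => x _; rewrite gee0_abs.
  rewrite -e h /ae_eq; split; apply: filterS => x //; exact.
have fh h : (\int[leb]_x f (x, h) = 0)%E.
  apply/z => //; first exact: (measurableT_comp mf (pair2_measurable h)).
  apply: filterS (E0 h) => x Ex; rewrite /f indicE memNset//.
have : (\int[leb]_x \int[leb]_h f (x, h) = 0)%E.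
  transitivity (\int[leb]_h \int[leb]_x f (x, h))%E.
    exact: etrans (esym (@fubini_tonelli1 _ _ _ _ R leb leb _ mf f0))
      (@fubini_tonelli2 _ _ _ _ R leb leb _ mf f0).
  by under eq_integral do rewrite fh; exact: integral0.
move/z => ae0.
have {}ae0 : {ae leb, forall x, (\int[leb]_h f (x, h) = 0)%E}.
  apply: ae0 => [|x]; last exact: integral_ge0.
  exact: (@measurable_fun_fubini_tonelli_F _ _ _ _ R leb _ mf f0).
apply: filterS ae0 => x /z fx.
apply: filterS (fx _ _) => [h|//|//].
  rewrite /f indicE => + Exh; rewrite mem_set// => -[] /eqP; rewrite oner_eq0//.
exact: (measurableT_comp mf (pair1_measurable x)).
Qed.

(** Summable errors cannot all exceed the fixed positive gap H - S. This removes the remainder of a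
    telescoping sum. *)
Lemma nneseries_lt_oo_le (H S : \bar R) (e : nat -> \bar R) :
  (forall N, 0 <= e N)%E -> (\sum_(N <oo) e N < +oo)%E -> (0 <= H)%E -> (0 <= S)%E ->
  (H < +oo)%E ->
  (forall N, H <= S + e N)%E -> (H <= S)%E.
Proof.
move=> e0 eoo H0 S0 Hoo HS.
rewrite leNgt; apply/negP => SH.
have Soo : (S < +oo)%E by exact: lt_trans Hoo.
have [h hE] : exists h : R, H = h%:E.
  by exists (fine H); rewrite fineK// ge0_fin_numE.
have [s sE] : exists s : R, S = s%:E.
  by exists (fine S); rewrite fineK// ge0_fin_numE.
have d0 : 0 < h - s by rewrite subr_gt0 -lte_fin -hE -sE.
have ed N : ((h - s)%:E <= e N)%E.
  by have := HS N; rewrite hE sE -leeBlDl// EFinB.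
set Z := (\sum_(N <oo) e N)%E in eoo *.
have Z0 : (0 <= Z)%E by apply: nneseries_ge0 => k _ _; exact: e0.
have [z zE] : exists z : R, Z = z%:E.
  by exists (fine Z); rewrite fineK// ge0_fin_numE.
have zN N : (h - s) *+ N <= z.
  rewrite -lee_fin -zE; apply: le_trans (nneseries_lim_ge N (fun j _ _ => e0 j)).
  apply: (@le_trans _ _ (\sum_(0 <= i < N) (h - s)%:E)%E); last exact: lee_sum.
  by rewrite sumEFin sumr_const_nat subn0.
have := zN (Num.truncn (z / (h - s))).+1.
rewrite leNgt -mulr_natl => /negP; apply.
by rewrite -ltr_pdivrMr// truncnS_gt.
Qed.

End almost_everywhere.

Section split_increments.
Context {R : realType} (n : nat).
Local Notation leb := (@lebesgue_rV R n).
Local Notation X := 'rV[R]_n.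
Local Notation fct := (X -> R[i]).

Lemma ae_ae_translation (P : X -> Prop) : {ae leb, forall x, P x} ->
  {ae leb, forall x, {ae leb, forall h, P x /\ P (x + h)}}.
Proof.
move=> aeP; apply: filterS (aeP) => x Px.
by apply: filterS (ae_translation aeP x) => h.
Qed.

Lemma incr_sub_le (g g' : fct) q : incr (fun x => g x - g' x) q <= incr g q + incr g' q.
Proof.
rewrite /incr -(normcN (g' _ - _)).
apply: le_trans (le_normcD _ _); rewrite le_eqVlt; apply/orP; left; apply/eqP.
by congr Normc.normc; ring.
Qed.

Lemma incr_telescope (g : nat -> fct) q N :
  incr (g 0%N) q <= \sum_(0 <= k < N) incr (fun x => g k x - g k.+1 x) q + incr (g N) q.
Proof.
elim: N => [|N IH]; first by rewrite big_geq// add0r.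
apply: le_trans IH _; rewrite big_nat_recr//= -addrA lerD2l.
rewrite /incr; apply: le_trans (le_normcD _ _).
rewrite le_eqVlt; apply/orP; left; apply/eqP; congr Normc.normc; ring.
Qed.

Section one_split.
Context (f f0 f1 : fct) (s m : R) (fs : peetre_split f f0 f1 s m).

(** The constant c cancels in the increment, and the bound m is used at x and at x + h. *)
Lemma split_incr0_le :
  {ae leb, forall x, {ae leb, forall h, incr f0 (x, h) <= 2 * m}}.
Proof.
have [_ _ [c cm] _ _] := fs.
apply: filterS (ae_ae_translation cm) => x; apply: filterS => h [fx fxh].
rewrite /incr/= (_ : _ - _ = (f0 (x + h) - c) - (f0 x - c)); last by ring.
apply: le_trans (le_normcD _ _) _; rewrite normcN.
by rewrite mulr_natl mulr2n lerD.
Qed.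

Lemma split_incr_le :
  {ae leb, forall x, {ae leb, forall h, incr f (x, h) <= incr f0 (x, h) + incr f1 (x, h)}}.
Proof.
have [_ _ _ _ [c cm]] := fs.
apply: filterS (ae_ae_translation cm) => x; apply: filterS => h [fx fxh].
rewrite /incr/= fx fxh; apply: le_trans (le_normcD _ _).
rewrite le_eqVlt; apply/orP; left; apply/eqP; congr Normc.normc; ring.
Qed.

Lemma split_integral_incr1 h :
  (\int[leb]_x (incr f1 (x, h))%:E <= (2 * (m / s) * \sum_j `|h ord0 j|)%:E)%E.
Proof. by have [_ l1 _ [nu nuf nuV] _] := fs; exact: BV_translation l1 nuf nuV h. Qed.

End one_split.

Section two_splits.
Context (f f0 f1 f0' f1' : fct) (s m s' m' : R).
Hypotheses (fs : peetre_split f f0 f1 s m) (fs' : peetre_split f f0' f1' s' m').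

(* On the left the difference is bounded, on the right it has bounded variation. *)
Lemma split_incr_sub : {ae leb, forall x, {ae leb, forall h,
  incr (fun y => f0 y - f0' y) (x, h) = incr (fun y => f1 y - f1' y) (x, h)}}.
Proof.
have [_ _ _ _ [c cm]] := fs; have [_ _ _ _ [c' cm']] := fs'.
apply: filterS2 (ae_ae_translation cm) (ae_ae_translation cm') => x.
apply: filterS2 => h [fx fxh] [fx' fxh'].
rewrite /incr/= -normcN; congr Normc.normc.
have E y : f y = f0 y + f1 y + c -> f y = f0' y + f1' y + c' ->
    f0 y - f0' y = f1' y - f1 y + (c' - c).
  by move=> -> e; rewrite -(addrK (f1 y + c) (f0 y)) addrA e; ring.
by rewrite (E _ fxh fxh') (E _ fx fx'); ring.
Qed.

Lemma split_incr1_sub_le : {ae leb, forall x, {ae leb, forall h,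
  incr (fun y => f1 y - f1' y) (x, h) <= 2 * (m + m')}}.
Proof.
apply: filterS3 split_incr_sub (split_incr0_le fs) (split_incr0_le fs') => x.
apply: filterS3 => h <- h0 h0'; apply: le_trans (incr_sub_le _ _ _) _.
by rewrite mulrDr lerD.
Qed.

Lemma split_integral_incr1_sub h :
  (\int[leb]_x (incr (fun y => f1 y - f1' y) (x, h))%:E <=
   (2 * (m / s + m' / s') * \sum_j `|h ord0 j|)%:E)%E.
Proof.
have [_ [mf1 _] _ _ _] := fs; have [_ [mf1' _] _ _ _] := fs'.
have mi g : cmeasurable_fun setT g ->
    measurable_fun setT (fun x : X => (incr g (x, h))%:E).
  move=> mg; apply/measurable_EFinP.
  exact: (measurableT_comp (measurable_incr mg) (pair2_measurable h)).
rewrite mulrDr mulrDl EFinD.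
apply: le_trans (leeD (split_integral_incr1 fs h) (split_integral_incr1 fs' h)).
rewrite -ge0_integralD//; last 4 first.
- by move=> x _; rewrite lee_fin incr_ge0.
- exact: mi.
- by move=> x _; rewrite lee_fin incr_ge0.
- exact: mi.
apply: ge0_le_integral => //.
- by move=> x _; rewrite lee_fin incr_ge0.
- exact: mi (cmeasurableB mf1 mf1').
- by apply: emeasurable_funD; exact: mi.
by move=> x _; rewrite -EFinD lee_fin; exact: incr_sub_le.
Qed.

End two_splits.
End split_increments.

Section dyadic_families.
Context {R : realType}.

Lemma trivIset_dyadic (s : nat -> R) :
  (forall i j, (i < j)%N -> 2 * s i <= s j) \/ (forall i j, (i < j)%N -> 2 * s j <= s i) ->
  trivIset setT (fun k => `]s k, 2 * s k]%classic).
Proof.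
move=> sij; apply: ltn_trivIset => j i ij.
apply/seteqP; split => // t []; rewrite /= !in_itv/= => /andP[it ti] /andP[jt tj].
case: sij => /(_ _ _ ij) h.
  by have := le_lt_trans (le_trans ti h) jt; rewrite ltxx.
by have := le_lt_trans (le_trans tj h) it; rewrite ltxx.
Qed.

Lemma dyadic_family_large : dyadic_family (fun k => 2 ^+ k : R).
Proof.
split=> [k||k]; first exact: exprn_gt0.
  apply: trivIset_dyadic; left => i j ij.
  by rewrite -exprS; apply: ler_weXn2l => //; rewrite ler1n.
rewrite exprVn; apply/min_idPr.
apply: (@le_trans _ _ 1); last by apply: exprn_ege1; rewrite ler1n.
by rewrite invf_le1 ?exprn_gt0//; apply: exprn_ege1; rewrite ler1n.
Qed.

Lemma dyadic_family_small : dyadic_family (fun k => 2^-1 ^+ k : R).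
Proof.
split=> [k||k]; first by rewrite exprn_gt0// invr_gt0.
  apply: trivIset_dyadic; right => i j ij; rewrite -(subnKC ij) exprD exprS.
  rewrite !mulrA mulfV// mul1r ler_piMr ?exprn_ge0// ?invr_ge0//.
  by apply: exprn_ile1; rewrite ?invr_ge0// invf_le1// ler1n.
rewrite exprVn invrK; apply/min_idPl.
apply: (@le_trans _ _ 1); last by apply: exprn_ege1; rewrite ler1n.
by rewrite invf_le1 ?exprn_gt0//; apply: exprn_ege1; rewrite ler1n.
Qed.

Lemma nneseries_shift_le (u : nat -> \bar R) : (forall k, 0 <= u k)%E ->
  (\sum_(k <oo) u k.+1 <= \sum_(k <oo) u k)%E.
Proof.
move=> u0; apply: lime_le; first by apply: is_cvg_nneseries => k _ _; exact: u0.
apply: nearW => N; apply: le_trans (nneseries_lim_ge N.+1 (fun j _ _ => u0 j)).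
by rewrite big_nat_recl//= leeDr.
Qed.

End dyadic_families.

(** * Telescoping upwards and downwards from scale 1 *)

Section dyadic_level.
Context {R : realType} (n : nat).
Hypothesis n0 : (0 < n)%N.
Local Notation mu := (@lebesgue_measure R).
Local Notation leb := (@lebesgue_rV R n).
Local Notation X := 'rV[R]_n.
Local Notation fct := (X -> R[i]).
Local Notation half := (X * measurableTypeR R)%type.
Local Notation kappa := (leb \x mu)%E.
Variables (p b gamma : R).
Hypotheses (p1 : 1 < p) (b0 : b != 0) (bp : gamma + 1 = b * p).

Let pV0 : 0 < p^-1. Proof. by rewrite invr_gt0 (lt_trans _ p1). Qed.
Let pV1 : p^-1 < 1. Proof. by rewrite invf_lt1// (lt_trans _ p1). Qed.

Section decomposed.
Variables (f : fct) (f0 f1 : R -> fct) (a : R -> R) (A : R).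
Let good s := [/\ 0 < s, 0 < a s & peetre_split f (f0 s) (f1 s) s (s `^ p^-1 * a s)].
Hypothesis A0 : 0 < A.

(** Compares the splittings at scales u and 2u. With c = a(u) + a(2u) and 2^(1/p) <= 2, the bounds
    become M = 4 u^(1/p) c and V = 2 u^(1/p-1) c, and the powers of u cancel in V M^(p-1) = 2
    4^(p-1) c^p. The sum of the c is at most 2A. *)
Lemma level_pairs (u : nat -> R) (H : X * X -> R) (lambda : R) :
  (forall k, good (u k)) -> (forall k, good (2 * u k)) ->
  (\sum_(k <oo) (a (u k))%:E <= A%:E)%E ->
  (\sum_(k <oo) (a (2 * u k))%:E <= A%:E)%E ->
  measurable_fun setT H -> (forall q, 0 <= H q) -> 0 < lambda ->
  {ae leb, forall x, {ae leb, forall h, (H (x, h))%:E <=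
    \sum_(k <oo) (incr (fun y => f1 (u k) y - f1 (2 * u k) y) (x, h))%:E}%E} ->
  exists G : half -> \bar R,
  [/\ measurable_fun setT G, (forall z, 0 <= G z)%E,
    {ae leb, forall x, forall t, 0 < t ->
      ((t `^ (1 - b))%:E * wincr 1 H (x, t) <= lambda%:E + G (x, t))%E} &
    (\int[kappa]_(z in @halfspace R n) (dens gamma z * G z) <=
     (level_cst n p b * (2 * 4 `^ (p - 1)) * (2 * A) `^ p * lambda `^ (1 - p))%:E)%E].
Proof.
move=> gu g2u Au A2u mH H0 l0 HH.
pose c k := a (u k) + a (2 * u k).
pose M k := 4 * u k `^ p^-1 * c k.
pose V k := 2 * u k `^ (p^-1 - 1) * c k.
have u0 k : 0 < u k by have [] := gu k.
have au k : 0 < a (u k) by have [] := gu k.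
have a2u k : 0 < a (2 * u k) by have [] := g2u k.
have c0 k : 0 < c k by rewrite addr_gt0.
have mg k : cmeasurable_fun setT (fun y => f1 (u k) y - f1 (2 * u k) y).
  have [_ _ [_ [m1 _] _ _ _]] := gu k; have [_ _ [_ [m2 _] _ _ _]] := g2u k.
  exact: cmeasurableB.
have p2 : 2 `^ p^-1 <= 2 :> R.
  by rewrite -[leRHS]powRr1//; apply: ler_powR; [rewrite ler1n|exact: ltW].
have m2 k : (2 * u k) `^ p^-1 <= 2 * u k `^ p^-1.
  by rewrite powRM ?(ltW (u0 _))// ler_wpM2r ?powR_ge0.
have divm s : 0 < s -> s `^ p^-1 / s = s `^ (p^-1 - 1).
  by move=> s0; rewrite powRD_gt0 // powR_inv1// ltW.
apply: (@level_series R n n0 p b gamma p1 b0 bp H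
  (fun k => incr (fun y => f1 (u k) y - f1 (2 * u k) y)) M V c) => //.
- by move=> k; exact: measurable_incr.
- by move=> k q; exact: incr_ge0.
- by move=> k; rewrite !mulr_gt0// powR_gt0.
- by move=> k; rewrite mulr_ge0 ?(ltW (c0 k))// mulr_ge0// powR_ge0.
- by rewrite mulr_gt0.
- move=> k; have [_ _ s1] := gu k; have [_ _ s2] := g2u k.
  apply: filterS (split_incr1_sub_le s1 s2) => x; apply: filterS => h hle.
  apply: le_trans hle _; rewrite /M /c.
  have : (2 * u k) `^ p^-1 * a (2 * u k) <= 2 * u k `^ p^-1 * a (2 * u k).
    by rewrite ler_pM2r.
  have : 0 <= u k `^ p^-1 * a (u k) by rewrite mulr_ge0 ?powR_ge0 ?(ltW (au k)).
  lra.
- move=> k h; have [_ _ s1] := gu k; have [_ _ s2] := g2u k.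
  apply: le_trans (split_integral_incr1_sub s1 s2 h) _.
  rewrite lee_fin ler_wpM2r ?sumr_ge0// /V -[leRHS]mulrA ler_wpM2l//.
  rewrite /c mulrDr lerD//.
    by rewrite mulrAC divm.
  rewrite mulrAC divm ?mulr_gt0//; apply: ler_wpM2r; first exact: ltW.
  apply: ler_powR_neg => //; first by rewrite subr_le0 ltW.
  by rewrite ler_peMl ?ler1n// ltW.
- move=> k; rewrite /V /M powRM ?(ltW (c0 _))//; last by rewrite mulr_ge0 ?powR_ge0.
  rewrite powRM ?powR_ge0// -powRrM.
  have -> : c k `^ p = c k * c k `^ (p - 1).
    by rewrite -{2}(powRr1 (ltW (c0 k))) -powRD_gt0// addrC subrK.
  have e : u k `^ (p^-1 - 1) * u k `^ (p^-1 * (p - 1)) = 1.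
    rewrite -powRD_gt0// (_ : _ + _ = 0) ?powRr0//.
    by field; rewrite gt_eqF// (lt_trans _ p1).
  rewrite (_ : _ * _ * _ = (u k `^ (p^-1 - 1) * u k `^ (p^-1 * (p - 1))) *
    (2 * 4 `^ (p - 1) * (c k * c k `^ (p - 1)))); last by ring.
  by rewrite e mul1r.
rewrite (_ : (\sum_(k <oo) (c k)%:E = \sum_(k <oo) ((a (u k))%:E + (a (2 * u k))%:E))%E)//.
rewrite nneseriesD; last 2 first.
- by move=> k _ _; rewrite lee_fin ltW.
- by move=> k _ _; rewrite lee_fin ltW.
by rewrite mulr_natl mulr2n EFinD; exact: leeD.
Qed.

(** The remainder after N steps is the increment of f1 at scale s = 2^N, of L^1 norm in x at most 2
    s^(1/p-1) a(s) |h|_1 <= 2 a(s) |h|_1. These norms are summable, so for each h the series of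
    remainders is finite for almost every x; [ae_ae_swap] puts the quantifiers in the required
    order. *)
Lemma level_large (lambda : R) : (forall k, good (2 ^+ k)) ->
  (\sum_(k <oo) (a (2 ^+ k))%:E <= A%:E)%E -> 0 < lambda ->
  exists G : half -> \bar R,
  [/\ measurable_fun setT G, (forall z, 0 <= G z)%E,
    {ae leb, forall x, forall t, 0 < t ->
      ((t `^ (1 - b))%:E * wincr 1 (incr (f1 1)) (x, t) <= lambda%:E + G (x, t))%E} &
    (\int[kappa]_(z in @halfspace R n) (dens gamma z * G z) <=
     (level_cst n p b * (2 * 4 `^ (p - 1)) * (2 * A) `^ p * lambda `^ (1 - p))%:E)%E].
Proof.
move=> gs As l0.
have a0 k : (0 <= (a (2 ^+ k))%:E)%E by have [_ /ltW] := gs k; rewrite lee_fin.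
have m1 k : cmeasurable_fun setT (f1 (2 ^+ k)) by have [_ _ [_ []]] := gs k.
pose e N q := (incr (f1 (2 ^+ N)) q)%:E.
have e0 N q : (0 <= e N q)%E by rewrite lee_fin incr_ge0.
have me N : measurable_fun setT (e N) by apply/measurable_EFinP; exact: measurable_incr.
pose Z q := (\sum_(N <oo) e N q)%E.
have mZ : measurable_fun setT Z by apply: ge0_emeasurable_sum.
apply: (@level_pairs (fun k => 2 ^+ k)) => //.
- by move=> k; rewrite -exprS.
- under eq_eseriesr do rewrite -exprS.
  exact: le_trans (nneseries_shift_le a0) As.
- exact: (measurable_incr (m1 0%N)).
- by move=> q; exact: incr_ge0.
have Zfin : {ae leb, forall x, {ae leb, forall h, ~ [set q | Z q = +oo%E] (x, h)}}.
  apply: ae_ae_swap => [|h].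
    rewrite (_ : [set _ | _] = setT `&` Z @^-1` [set +oo%E]); last by rewrite setTI.
    by apply: mZ => //; exact: emeasurable_set1.
  have mZh : measurable_fun setT (fun x => Z (x, h)).
    exact: (measurableT_comp mZ (pair2_measurable h)).
  have Z0 x : (0 <= Z (x, h))%E by apply: nneseries_ge0.
  suff Zi : leb.-integrable setT (fun x => Z (x, h)).
    by apply: filterS (integrable_ae measurableT Zi) => x /(_ I) + /= => /[swap] ->.
  apply/integrableP; split => //.
  under eq_integral do rewrite gee0_abs//.
  rewrite integral_nneseries//; last first.
    by move=> N; exact: (measurableT_comp (me N) (pair2_measurable h)).
  pose D := 2 * \sum_j `|h ord0 j|.
  have D0 : 0 <= D by rewrite mulr_ge0// sumr_ge0.
  apply: (@le_lt_trans _ _ (\sum_(N <oo) (D%:E * (a (2 ^+ N))%:E))%E).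
    apply: lee_nneseries => [N _ _|N _]; first exact: integral_ge0.
    have [s0 /ltW as0 sN] := gs N.
    apply: le_trans (split_integral_incr1 sN h) _.
    rewrite -EFinM lee_fin /D mulrAC; apply: ler_wpM2l => //.
    rewrite mulrAC -[leRHS]mul1r; apply: ler_wpM2r => //.
    rewrite ler_pdivrMr// mul1r -[leRHS]powRr1 ?(ltW s0)//.
    by apply: ler_powR; [apply: exprn_ege1; rewrite ler1n|exact: ltW].
  rewrite nneseriesZl//; apply: le_lt_trans (lee_wpmul2l _ As) _ => //.
  by rewrite -EFinM ltry.
apply: filterS Zfin => x; apply: filterS => h Zfin.
apply: (@nneseries_lt_oo_le _ _ _ (fun N => e N (x, h))) => //.
- by rewrite ltey; apply/eqP.
- by rewrite lee_fin incr_ge0.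
- by apply: nneseries_ge0 => k _ _; rewrite lee_fin incr_ge0.
- by rewrite ltry.
move=> N; have := incr_telescope (fun k => f1 (2 ^+ k)) (x, h) N.
rewrite expr0 -lee_fin EFinD => /le_trans; apply.
apply: leeD => //; rewrite -sumEFin.
under eq_bigr do rewrite exprS.
apply: (nneseries_lim_ge N) => k _ _; by rewrite lee_fin incr_ge0.
Qed.

(** Here f0 is telescoped, with remainder at most 2 s^(1/p) a(s) <= 2 a(s) almost everywhere. Its
    successive differences have the increments of those of f1, so [level_pairs] applies with u_k =
    2^-(k+1), for which 2 u_k = 2^-k. *)
Lemma level_small (lambda : R) : (forall k, good (2^-1 ^+ k)) ->
  (\sum_(k <oo) (a (2^-1 ^+ k))%:E <= A%:E)%E -> 0 < lambda ->
  exists G : half -> \bar R,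
  [/\ measurable_fun setT G, (forall z, 0 <= G z)%E,
    {ae leb, forall x, forall t, 0 < t ->
      ((t `^ (1 - b))%:E * wincr 1 (incr (f0 1)) (x, t) <= lambda%:E + G (x, t))%E} &
    (\int[kappa]_(z in @halfspace R n) (dens gamma z * G z) <=
     (level_cst n p b * (2 * 4 `^ (p - 1)) * (2 * A) `^ p * lambda `^ (1 - p))%:E)%E].
Proof.
move=> gs As l0.
have a0 k : (0 <= (a (2^-1 ^+ k))%:E)%E by have [_ /ltW] := gs k; rewrite lee_fin.
have m0 k : cmeasurable_fun setT (f0 (2^-1 ^+ k)) by have [_ _ []] := gs k.
have half2 k : 2 * 2^-1 ^+ k.+1 = 2^-1 ^+ k :> R by rewrite exprS mulrA mulfV// mul1r.
pose m k := 2 * ((2^-1 ^+ k) `^ p^-1 * a (2^-1 ^+ k)).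
have m_ge0 k : (0 <= (m k)%:E)%E.
  by rewrite lee_fin mulr_ge0// mulr_ge0 ?powR_ge0//; have := a0 k; rewrite lee_fin.
have moo : (\sum_(k <oo) (m k)%:E < +oo)%E.
  apply: (@le_lt_trans _ _ (\sum_(N <oo) (2%:E * (a (2^-1 ^+ N))%:E))%E).
    apply: lee_nneseries => // N _; rewrite -EFinM lee_fin; apply: ler_wpM2l => //.
    apply: ler_piMl; first by have := a0 N; rewrite lee_fin.
    apply: (@le_trans _ _ (1 `^ p^-1)); last by rewrite powR1.
    apply: ge0_ler_powR => //; first exact: ltW.
    - by rewrite nnegrE exprn_ge0// invr_ge0.
    - by rewrite nnegrE.
    - by apply: exprn_ile1; rewrite ?invr_ge0// invf_le1// ler1n.
  rewrite nneseriesZl//; apply: le_lt_trans (lee_wpmul2l _ As) _ => //.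
  by rewrite -EFinM ltry.
apply: (@level_pairs (fun k => 2^-1 ^+ k.+1)) => //.
- by move=> k; rewrite half2.
- exact: le_trans (nneseries_shift_le a0) As.
- by under eq_eseriesr do rewrite half2.
- exact: (measurable_incr (m0 0%N)).
- by move=> q; exact: incr_ge0.
have ae0 : {ae leb, forall x, forall N, {ae leb, forall h, incr (f0 (2^-1 ^+ N)) (x, h) <= m N}}.
  by apply/ae_foralln => N; have [_ _ sN] := gs N; exact: split_incr0_le sN.
have aeS : {ae leb, forall x, forall N, {ae leb, forall h,
    incr (fun y => f0 (2^-1 ^+ N) y - f0 (2^-1 ^+ N.+1) y) (x, h) =
    incr (fun y => f1 (2^-1 ^+ N.+1) y - f1 (2^-1 ^+ N) y) (x, h)}}.
  apply/ae_foralln => N; have [_ _ s1] := gs N; have [_ _ s2] := gs N.+1.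
  apply: filterS (split_incr_sub s1 s2) => x; apply: filterS => h ->.
  by rewrite /incr -normcN; congr Normc.normc; ring.
apply: filterS2 ae0 aeS => x /ae_foralln ae0 /ae_foralln aeS.
apply: filterS2 ae0 aeS => h hm hS.
apply: (@nneseries_lt_oo_le _ _ _ (fun N => (m N)%:E)) => //.
- by rewrite lee_fin incr_ge0.
- by apply: nneseries_ge0 => k _ _; rewrite lee_fin incr_ge0.
- by rewrite ltry.
move=> N; have := incr_telescope (fun k => f0 (2^-1 ^+ k)) (x, h) N.
rewrite expr0 -lee_fin EFinD => /le_trans; apply.
apply: leeD; last by rewrite lee_fin.
rewrite -sumEFin; under eq_bigr do rewrite hS.
under [leRHS]eq_eseriesr do rewrite half2.
apply: (nneseries_lim_ge N) => k _ _; by rewrite lee_fin incr_ge0.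
Qed.

End decomposed.

(** Two equal contributions, from the large and from the small scales, each with half of lambda. *)
Definition level_bound (A lambda : R) : R :=
  2 * (level_cst n p b * (2 * 4 `^ (p - 1)) * (2 * A) `^ p * (lambda / 2) `^ (1 - p)).

Lemma level_interp (f : fct) (A lambda : R) : cmeasurable_fun setT f ->
  (4%:E * Vinf_BV_norm p^-1 1 f < A%:E)%E -> 0 < lambda ->
  exists G : half -> \bar R,
  [/\ measurable_fun setT G, (forall z, 0 <= G z)%E,
    {ae leb, forall x, forall t, 0 < t ->
      ((t `^ (1 - b))%:E * wincr 1 (incr f) (x, t) <= lambda%:E + G (x, t))%E} &
    (\int[kappa]_(z in @halfspace R n) (dens gamma z * G z) <= (level_bound A lambda)%:E)%E].
Proof.
move=> mf fA l0; have l20 : 0 < lambda / 2 by rewrite divr_gt0.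
have [f0 [f1 [a gs]]] := interp_decomposition p1 fA.
have [gl Al] := gs _ (dyadic_family_large (R := R)).
have [gsm Asm] := gs _ (dyadic_family_small (R := R)).
have A0 : 0 < A.
  rewrite -lte_fin; apply: lt_le_trans Al.
  apply: lt_le_trans (nneseries_lim_ge 1%N _); last first.
    by move=> k _ _; rewrite lee_fin ltW//; have [] := gl k.
  by rewrite big_nat1 lte_fin; have [] := gl 0%N.
have [k|G1 [mG1 G10 G1ae G1int]] := @level_large f f0 f1 a A A0 (lambda / 2) _ Al l20.
  by have [] := gl k; split => //; rewrite exprn_gt0.
have [k|G0 [mG0 G00 G0ae G0int]] := @level_small f f0 f1 a A A0 (lambda / 2) _ Asm l20.
  by have [] := gsm k; split => //; rewrite exprn_gt0// invr_gt0.
have := gl 0%N; rewrite expr0 => -[_ s1].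
have [m0 [m1 _] _ _ _] := s1.
exists (fun z => G0 z + G1 z)%E; split.
- exact: emeasurable_funD.
- by move=> z; exact: adde_ge0.
- apply: filterS3 G0ae G1ae (split_incr_le s1) => x h0 h1 hx t t0.
  rewrite [X in (X%:E + _)%E](splitr lambda) EFinD addeACA.
  apply: le_trans (leeD (h0 t t0) (h1 t t0)).
  rewrite -ge0_muleDr; last 2 first.
  + by apply: wincr_ge0 => q; exact: incr_ge0.
  + by apply: wincr_ge0 => q; exact: incr_ge0.
  apply: lee_wpmul2l; first by rewrite lee_fin powR_ge0.
  have mi g : cmeasurable_fun setT g -> measurable_fun setT
      (fun h : X => (ksq t h `^ (- (n%:R + 1) / 2) * incr g (x, h))%:E).
    move=> mg; apply/measurable_EFinP; apply: measurable_funM.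
      exact: measurable_ksq_powR2.
    exact: (measurableT_comp (measurable_incr mg) (pair1_measurable x)).
  have i0 g h : (0 <= (ksq t h `^ (- (n%:R + 1) / 2) * incr g (x, h))%:E)%E.
    by rewrite lee_fin mulr_ge0 ?powR_ge0 ?incr_ge0.
  rewrite -ge0_integralD//; [|exact: mi|exact: mi].
  apply: ae_ge0_le_integral => //; first exact: mi.
  + by move=> h _; apply: adde_ge0; exact: i0.
  + by apply: emeasurable_funD; exact: mi.
  apply: filterS hx => h hh _; rewrite -EFinD lee_fin -mulrDr.
  by apply: ler_wpM2l => //; exact: powR_ge0.
- under eq_integral do rewrite ge0_muleDr//.
  rewrite ge0_integralD//; last 5 first.
  + exact: measurable_halfspace.
  + by move=> z _; rewrite mule_ge0 ?dens_ge0.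
  + by apply: measurable_funTS; apply: emeasurable_funM => //; exact: measurable_dens.
  + by move=> z _; rewrite mule_ge0 ?dens_ge0.
  + by apply: measurable_funTS; apply: emeasurable_funM => //; exact: measurable_dens.
  by rewrite /level_bound mulr_natl mulr2n EFinD; exact: leeD.
Qed.
End dyadic_level.

(** * The weak-type bound *)

Section weak_type.
Context {R : realType} (n : nat).
Hypothesis n0 : (0 < n)%N.
Local Notation mu := (@lebesgue_measure R).
Local Notation leb := (@lebesgue_rV R n).
Local Notation X := 'rV[R]_n.
Local Notation fct := (X -> R[i]).
Local Notation half := (X * measurableTypeR R)%type.
Local Notation kappa := (leb \x mu)%E.
Local Notation hs := (@halfspace R n).

(** The bounds of the n + 1 components are added; the final 1 makes the constant positive. *)
Definition Kop_cst : R := (n + 1)%:R * (2 * `| @poisson_cst R n| * n.+1%:R) + 1.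

Lemma Kop_cst_gt0 : 0 < Kop_cst.
Proof. by rewrite ltr_wpDl// !mulr_ge0. Qed.

Lemma ae_fst (P : X -> Prop) : {ae leb, forall x, P x} ->
  {ae kappa, forall z : half, P z.1}.
Proof.
move=> [B [mB B0 sub]]; exists (B `*` setT); split.
- exact: measurableX.
- by rewrite [LHS](product_measure1E leb mu mB measurableT) [X in (X * _)%E]B0 mul0e.
by move=> z /= Pz; split => //; exact: sub.
Qed.

Section one_function.
Variables (f : fct) (mf : cmeasurable_fun setT f).

Lemma measurable_cenorm_Kop b : measurable_fun setT (fun z : half => cenorm (Kop b f z)).
Proof.
apply: (measurableT_comp measurable_sqrt); apply: measurable_sum => j.
apply: measurable_funX; apply: measurable_normc; exact: cmeasurable_Kop.
Qed.

Lemma cenorm_Kop_le b (z : half) : 0 < z.2 ->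
  ((cenorm (Kop b f z))%:E <= Kop_cst%:E * ((z.2 `^ (1 - b))%:E * wincr 1 (incr f) z))%E.
Proof.
move=> z0; have W0 : (0 <= (z.2 `^ (1 - b))%:E * wincr 1 (incr f) z)%E.
  apply: mule_ge0; first by rewrite lee_fin powR_ge0.
  by apply: wincr_ge0 => q; exact: incr_ge0.
apply: (@le_trans _ _ (\sum_(j < n + 1) (Normc.normc (Kop b f z ord0 j))%:E)%E).
  by rewrite sumEFin lee_fin; exact: cenorm_le_sum.
pose c : R := 2 * `| @poisson_cst R n| * n.+1%:R.
have c0 : 0 <= c by rewrite !mulr_ge0.
apply: (@le_trans _ _ (\sum_(j < n + 1) (c%:E * ((z.2 `^ (1 - b))%:E * wincr 1 (incr f) z)))%E).
  apply: lee_sum => j _; rewrite muleA -EFinM; exact: normc_Kop_le.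
rewrite -ge0_sume_distrl; last by move=> j _; rewrite lee_fin.
apply: lee_wpmul2r => //; rewrite sumEFin lee_fin sumr_const card_ord.
by rewrite -mulr_natl /Kop_cst lerDl.
Qed.

Variables (p b gamma : R).
Hypotheses (p1 : 1 < p) (b0 : b != 0) (bp : gamma + 1 = b * p).

Definition Kop_level (l : R) : set half :=
  [set z | hs z /\ l < cenorm (Kop b f z)].

Lemma measurable_Kop_level l : measurable (Kop_level l).
Proof.
rewrite (_ : Kop_level l = hs `&` [set z | l < cenorm (Kop b f z)])//.
apply: measurableI; first exact: measurable_halfspace.
rewrite (_ : [set z | _] = setT `&` (fun z : half => cenorm (Kop b f z)) @^-1` `]l, +oo[%classic).
  exact: measurable_cenorm_Kop.
by rewrite setTI; apply/seteqP; split => z /=; rewrite in_itv/= andbT.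
Qed.

Lemma lambda_measureE (E : set half) : measurable E -> E `<=` hs ->
  lambda_measure n gamma E = (\int[kappa]_(z in hs) (dens gamma \_ E) z)%E.
Proof.
move=> mE Eh; rewrite /lambda_measure integral_mkcond /lebesgue_half.
rewrite ge0_integral_mrestr//.
- by apply/(measurable_restrictT _ mE); apply: measurable_funTS; exact: measurable_dens.
- by move=> z; rewrite patchE; case: ifP => // _; exact: dens_ge0.
Qed.

(** Chebyshev: with L = l / (2 [Kop_cst]), a point of the level set satisfies l <= [Kop_cst] (L +
    G), that is G >= L, outside a null set. *)
Lemma lambda_Kop_level_le (A l : R) : 0 < l ->
  (4%:E * Vinf_BV_norm p^-1 1 f < A%:E)%E ->
  (lambda_measure n gamma (Kop_level l) <=
   ((l / (2 * Kop_cst))^-1 * level_bound n p b A (l / (2 * Kop_cst)))%:E)%E.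
Proof.
move=> l0 fA; set L := l / _; have C0 := Kop_cst_gt0.
have L0 : 0 < L by rewrite divr_gt0// mulr_gt0.
have [G [mG G0 Gae Gint]] := level_interp n0 p1 b0 bp mf fA L0.
rewrite lambda_measureE; [|exact: measurable_Kop_level|by move=> z []].
have mdG : measurable_fun hs (fun z => dens gamma z * G z)%E.
  by apply: measurable_funTS; apply: emeasurable_funM => //; exact: measurable_dens.
have dG0 z : (0 <= dens gamma z * G z)%E by rewrite mule_ge0 ?dens_ge0.
apply: (@le_trans _ _ (\int[kappa]_(z in hs) (L^-1%:E * (dens gamma z * G z)))%E); last first.
  rewrite ge0_integralZl//; last 2 first.
  - exact: measurable_halfspace.
  - by rewrite lee_fin invr_ge0 ltW.
  by rewrite EFinM; apply: lee_wpmul2l => //; rewrite lee_fin invr_ge0 ltW.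
apply: ae_ge0_le_integral; first exact: measurable_halfspace.
- by move=> z _; rewrite patchE; case: ifP => // _; exact: dens_ge0.
- apply: measurable_funTS.
  apply/(measurable_restrictT _ (measurable_Kop_level l)); apply: measurable_funTS.
  exact: measurable_dens.
- by move=> z _; apply: mule_ge0 => //; rewrite lee_fin invr_ge0 ltW.
- exact: measurable_funeM.
apply: filterS (ae_fst Gae) => -[x t] /= Gz t0.
rewrite patchE; case: ifPn => [|_]; last first.
  by apply: mule_ge0 => //; rewrite lee_fin invr_ge0 ltW.
rewrite inE => -[_ lK].
rewrite muleCA -[leLHS]mule1; apply: lee_wpmul2l; first exact: dens_ge0.
rewrite -(@lee_pmul2l _ L%:E)// mule1 muleA -EFinM mulfV ?gt_eqF// mul1e.
have : (l%:E <= Kop_cst%:E * (L%:E + G (x, t)))%E.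
  apply: le_trans (lee_wpmul2l _ (Gz t t0)); last by rewrite lee_fin ltW.
  apply: le_trans (@cenorm_Kop_le b (x, t) t0).
  by rewrite lee_fin ltW.
rewrite muleC -lee_pdivrMr// -EFinM => h.
have -> : L%:E = ((l / Kop_cst - L)%:E)%E.
  by congr EFin; rewrite /L; field; rewrite gt_eqF.
by rewrite EFinB leeBlDl.
Qed.

Lemma level_const_ge0 : 0 <= level_cst n p b * (2 * 4 `^ (p - 1)).
Proof. by apply: mulr_ge0; [exact: level_cst_ge0|rewrite mulr_ge0 ?powR_ge0]. Qed.

Definition weak_cst : R :=
  (level_cst n p b * (2 * 4 `^ (p - 1)) * (8 * Kop_cst) `^ p) `^ p^-1 + 1.

Lemma weak_cst_gt0 : 0 < weak_cst.
Proof. by rewrite ltr_wpDl// powR_ge0. Qed.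

(** Homogeneity: 2 L^-1 (L/2)^(1-p) = (L/2)^(-p), and 2A / (L/2) = 8 [Kop_cst] A / l, so the
    distribution function decays exactly like l^(-p). *)
Lemma level_boundE (A l : R) : 0 < A -> 0 < l ->
  (l / (2 * Kop_cst))^-1 * level_bound n p b A (l / (2 * Kop_cst)) =
  level_cst n p b * (2 * 4 `^ (p - 1)) * (8 * Kop_cst) `^ p * (A / l) `^ p.
Proof.
move=> A0 l0; have C0 := Kop_cst_gt0.
set L := l / _; have L0 : 0 < L by rewrite divr_gt0// mulr_gt0.
have L20 : 0 < L / 2 by rewrite divr_gt0.
rewrite /level_bound; set c := _ * (2 * _).
rewrite (addrC 1) powRD_gt0// powRr1 ?(ltW L20)//.
have -> : (2 * A) `^ p = (8 * Kop_cst) `^ p * (A / l) `^ p * (L / 2) `^ p.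
  have c8 : 0 <= 8 * Kop_cst by rewrite mulr_ge0// ltW.
  have Al : 0 <= A / l by rewrite divr_ge0// ltW.
  rewrite -powRM// -powRM ?(ltW L20)//; last exact: mulr_ge0.
  by congr (_ `^ _); rewrite /L; field; rewrite !gt_eqF.
by rewrite powRN; field; rewrite !gt_eqF// powR_gt0.
Qed.

Lemma weakLp_Kop_le (A : R) : (4%:E * Vinf_BV_norm p^-1 1 f < A%:E)%E ->
  (weakLp_norm p (lambda_measure n gamma) (Kop b f) <= (weak_cst * A)%:E)%E.
Proof.
move=> fA; have C0 := Kop_cst_gt0; have p0 : 0 < p by exact: lt_trans p1.
have A0 : 0 < A.
  rewrite -lte_fin; apply: le_lt_trans fA; apply: mule_ge0; first by rewrite lee_fin.
  by rewrite /Vinf_BV_norm /interp_norm; exact: poweR_ge0.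
apply: ge_ereal_sup => _ [l /= l0 <-].
set D := level_cst n p b * (2 * 4 `^ (p - 1)) * (8 * Kop_cst) `^ p.
have D0 : 0 <= D by rewrite mulr_ge0 ?powR_ge0 ?level_const_ge0.
have h := lambda_Kop_level_le l0 fA; rewrite level_boundE// -/D in h.
apply: (@le_trans _ _ (l%:E * ((D * (A / l) `^ p)%:E `^ p^-1))%E).
  apply: lee_wpmul2l; first by rewrite lee_fin ltW.
  apply: gt0_ler_poweR => //; first by rewrite invr_ge0 ltW.
  - by rewrite in_itv/= measure_ge0 leey.
  - by rewrite in_itv/= leey andbT lee_fin mulr_ge0 ?powR_ge0.
rewrite poweR_EFin -EFinM lee_fin powRM ?powR_ge0// -powRrM mulfV ?gt_eqF//.
rewrite powRr1; last by rewrite divr_ge0// ltW.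
rewrite mulrCA (mulrC l) divfK ?gt_eqF//.
by rewrite ler_pM2r// /weak_cst lerDl.
Qed.

Lemma weakLp_Kop : (Vinf_BV_norm p^-1 1 f < +oo)%E ->
  weakLp p (lambda_measure n gamma) (Kop b f) /\
  (weakLp_norm p (lambda_measure n gamma) (Kop b f) <=
   (4 * weak_cst)%:E * Vinf_BV_norm p^-1 1 f)%E.
Proof.
move=> foo.
have N0 : (0 <= Vinf_BV_norm p^-1 1 f)%E.
  by rewrite /Vinf_BV_norm /interp_norm; exact: poweR_ge0.
have [N NE] : exists N : R, Vinf_BV_norm p^-1 1 f = N%:E.
  by exists (fine (Vinf_BV_norm p^-1 1 f)); rewrite fineK// ge0_fin_numE.
have w0 := weak_cst_gt0.
have main : (weakLp_norm p (lambda_measure n gamma) (Kop b f) <=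
   (4 * weak_cst)%:E * Vinf_BV_norm p^-1 1 f)%E.
  (* [weakLp_Kop_le] asks for A strictly above four times the norm; an excess of e / [weak_cst] in A
     becomes e in the bound. *)
  rewrite NE -EFinM; apply/lee_addgt0Pr => e e0.
  have := @weakLp_Kop_le (4 * N + e / weak_cst).
  rewrite NE -EFinM lte_fin ltrDl divr_gt0// => /(_ isT) /le_trans; apply.
  by rewrite -EFinD lee_fin mulrDr [X in _ + X <= _]mulrCA mulfV ?gt_eqF// mulr1 mulrCA mulrA.
split => //; split.
  by move=> j; have [mR mI] := cmeasurable_Kop mf b j; split; exact: measurable_funTS.
by apply: le_lt_trans main _; rewrite NE -EFinM ltry.
Qed.

End one_function.

Lemma Kop_bounded (p b gamma : R) : 1 < p -> b != 0 -> gamma + 1 = b * p ->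
  bounded_to_weakLp p^-1 1 p (lambda_measure n gamma) (@Kop R n b).
Proof.
move=> p1 b0 bp; exists (4 * weak_cst p b) => f [mf foo].
exact: (weakLp_Kop mf p1 b0 bp foo).
Qed.

End weak_type.

Lemma Kop_1 {R : realType} d : @Kop R d 1 = @grad_poisson R d.
Proof.
apply/funext => f; apply/funext => z.
by rewrite /Kop subrr powRr0 scale1r.
Qed.

Lemma lambda_measure_1 {R : realType} d (E : set ('rV[R]_d * measurableTypeR R)) :
  measurable E -> lambda_measure d 1 E = lebesgue_half d E.
Proof.
move=> mE; rewrite /lambda_measure -[RHS]mul1e -integral_cst//.
by apply: eq_integral => z _; rewrite /= subrr powRr0 invr1.
Qed.

Theorem corollary1p9 (R : realType) (d : nat) (hd : (1 <= d)%N) :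
  (forall p gamma : R, 1 < p -> gamma \notin `[(-1)%R, 0%R] ->
    bounded_to_weakLp p^-1 1 p (lambda_measure d gamma)
      (Kop ((gamma + 1) / p))) /\
  bounded_to_weakLp 2^-1 1 2 (lebesgue_half d) (@grad_poisson R d).
Proof.
split=> [p gamma p1 gammaN|].
  have p0 : p != 0 by rewrite gt_eqF// (lt_trans _ p1).
  apply: Kop_bounded => //; last by rewrite divfK.
  rewrite mulf_neq0 ?invr_eq0//; apply: contra gammaN.
  by rewrite addr_eq0 => /eqP ->; rewrite in_itv/= lexx lerN10.
(* The case p = 2, gamma = 1, where b = 1: the weight t^(1-b) is 1. *)
have [C hC] : bounded_to_weakLp 2^-1 1 2 (lambda_measure d 1) (@grad_poisson R d).
  rewrite -Kop_1; apply: Kop_bounded => //.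
  - by rewrite ltr1n.
  - by rewrite mul1r.
exists C => f hf; have [[mg goo] gle] := hC f hf.
(* lambda_1 is only identified with dx dt on measurable sets, and the level sets entering the weak
   norm are measurable. *)
have normE : weakLp_norm 2 (lambda_measure d 1) (grad_poisson f) =
    weakLp_norm 2 (lebesgue_half d) (grad_poisson f).
  congr ereal_sup; apply: eq_imagel => l _ /=; congr (_ * (_ `^ _))%E.
  apply: lambda_measure_1; have [mf _] := hf.
  by have := measurable_Kop_level mf 1 l; rewrite /Kop_level Kop_1.
by rewrite /weakLp /= -normE.
Qed.
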